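(* Let $M$ be a compact, orientable, irreducible 3-manifold with incompressible boundary and let $T_1$ and $T_2$ be two torus components of $\partial M$. Let $\psi\colon T_1\to T_2$ and $\sigma\colon T_2\to T_2$ be homeomorphisms, inducing on first homology (with respect to the fixed bases) elements of $SL_2(\mathbb Z)$, where $\sigma$ is Anosov. Then for each $c$ there exists a positive integer $N$ such that for all $n\ge N$ the map $\sigma^n\psi\colon T_1\to T_2$ has $c$-distance at least one.
   Context: $M$ may be disconnected (one or two components). That $\sigma$ is Anosov means in particular that its induced matrix has $|\mathrm{trace}|>2$. Definition of $c$-distance. Orient $M$ and fix a triangulation $\mathcal T$ of $M$ that restricts to one-vertex triangulations on $T_1$ and $T_2$ (such triangulations exist). Normality: a properly embedded arc in a 2-simplex is normal if it connects distinct 1-simplices. A (simple) loop on the boundary of a tetrahedron is normal if it consists of normal arcs; such a loop consists of $3$ or $4n$ normal arcs, and its complexity is $0$ if it has $3$ arcs and $n-1$ if it has $4n$ arcs. A normal isotopy of such a loop is an isotopy that restricts to an isotopy in each boundary simplex of the tetrahedron. A properly embedded surface is normal with respect to the 2-skeleton if it meets the boundary of every tetrahedron in a collection of normal loops; its complexity is the maximum complexity of these loops. Two such surfaces $F,G$ are compatible if on the boundary of each tetrahedron $\Delta$ the normal loops $F\cap\partial\Delta$ and $G\cap\partial\Delta$ can be normally isotoped to be disjoint. A compatibility class is a maximal (under inclusion) set of pairwise compatible surfaces that are normal with respect to the 2-skeleton; its complexity is the maximum of the complexities of its surfaces. Types: a one-vertex triangulation of a torus has two triangles and three edges $e_1,e_2,e_3$.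 A (not necessarily connected) normal curve has coordinates $(x_1,x_2,x_3)$, where $x_i$ is the number of its arcs disjoint from $e_i$ in one triangle (the numbers in the other triangle are then the same). It has type $i$ if $x_i\le x_j$ for all $j\ne i$ (a curve may have more than one type). The type of a surface is the pair of types of its boundary curves on $T_1$ and $T_2$. A typed compatibility class is a compatibility class restricted to its surfaces of one given type. For each $c$ there are finitely many typed compatibility classes of complexity at most $c$. A curve of type $i$ is ''oriented by type'' as follows: after discarding trivial components it has no arcs disjoint from $e_i$, and it is oriented so that all crossings with $e_i$ are in one direction, fixed once and for all. Slopes: a slope is the isotopy class of a connected essential closed curve on a torus. Fix homology bases of $T_1,T_2$ so that the orientation on $T_1$ agrees, and that on $T_2$ disagrees, with the induced boundary orientation. Slopes are then identified with $\widehat{\mathbb Q}=\mathbb Q\cup\{1/0\}$, on which $SL_2(\mathbb Q)$ acts by $q\mapsto\frac{aq+b}{cq+d}$. The slope $\langle c\rangle$ of a possibly disconnected embedded curve $c$ is the slope of any essential component. The maps $\Phi_{\mathcal C}$: for each typed compatibility class $\mathcal C$ there is an element $\Phi_{\mathcal C}\in SL_2(\mathbb Q)$ with $\Phi_{\mathcal C}(\langle S\cap T_2\rangle)=\langle S\cap T_1\rangle$ for every $S\in\mathcal C$ that meets both $T_1$ and $T_2$ (in curves having slopes) and satisfies $S\cap\partial M\subset T_1\cup T_2$. It is chosen as follows. If two such surfaces have distinct slopes on $T_2$, then $\Phi_{\mathcal C}$ is the matrix sending the homology class $[S\cap T_2]$ to $[S\cap T_1]$ for all such $S$, with boundary curves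 oriented by type. If all such surfaces have the same slope $\tau_2$ on $T_2$, then they all have the same slope $\tau_1$ on $T_1$, and $\Phi_{\mathcal C}$ is a fixed choice of element of $SL_2(\mathbb Q)$ with $\Phi_{\mathcal C}(\tau_2)=\tau_1$. Farey graph of a torus $T$: vertices are the slopes on $T$; two are joined by an edge if they have representatives meeting in exactly one point. Distance between slopes is path length in this graph. $c$-distance: for a gluing map (homeomorphism) $\phi\colon T_1\to T_2$, the distance of $\phi\Phi_{\mathcal C}$ is the minimum, over all slopes $\gamma$ on $T_2$, of the distance in the Farey graph of $T_2$ between $\gamma$ and $\phi\Phi_{\mathcal C}(\gamma)$. The $c$-distance of $\phi$ is the minimum of the distances of $\phi\Phi_{\mathcal C}$ over all typed compatibility classes $\mathcal C$ of complexity at most $c$. *)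

(* Defs.v *)
(* The 3-manifold M is a topological space, triangulated by
   finitely many tetrahedra whose faces are glued affinely; curves, arcs and
   surfaces are subsets of M (or of the standard tetrahedron). *)
From HB Require Import structures.
From mathcomp Require Import all_boot all_order all_algebra all_fingroup.
From mathcomp Require Import all_classical all_reals all_analysis.
Set Implicit Arguments.
Unset Strict Implicit.
Unset Printing Implicit Defensive.
Import Order.TTheory GRing.Theory Num.Theory.
Import numFieldNormedType.Exports.

Local Open Scope classical_set_scope.
Local Open Scope ring_scope.

(** * Topological 3-manifolds *)

Definition homeo_on (X Y : topologicalType) (A : set X) (B : set Y)
    (f : X -> Y) : Prop :=
  [/\ set_bij A B f, {within A, continuous f} &
      exists2 g : Y -> X, {within B, continuous g} & {in A, cancel f g}].

Definition embedding (X Y : topologicalType) (A : set X) (f : X -> Y) : Prop :=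
  homeo_on A (f @` A) f.

Definition sqnorm (R : realType) (n : nat) (x : 'rV[R]_n) : R :=
  \sum_i x 0 i ^+ 2.
Definition unit_ball (R : realType) (n : nat) : set 'rV[R]_n :=
  [set x | sqnorm x <= 1].
Definition unit_sphere (R : realType) (n : nat) : set 'rV[R]_n :=
  [set x | sqnorm x = 1].

Definition half_space (R : realType) : set 'rV[R]_3 := [set x : 'rV[R]_3 | 0 <= x 0 0].

Definition is_chart (R : realType) (M : topologicalType)
    (U : set M) (f : M -> 'rV[R]_3) : Prop :=
  open U /\ exists2 V : set 'rV[R]_3, open V & homeo_on U (V `&` @half_space R) f.

Definition manifold3 (R : realType) (M : topologicalType) : Prop :=
  hausdorff_space M /\
  forall p : M, exists U (f : M -> 'rV[R]_3), is_chart U f /\ U p.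

Definition bdry (R : realType) (M : topologicalType) : set M :=
  [set p | exists U (f : M -> 'rV[R]_3), [/\ is_chart U f, U p & f p 0 0 = 0]].

(* Locally flat: near each of its points S is the plane {x_2 = 0} in a chart
   modelled on the half-space {x_0 >= 0}.  At boundary points this says that S
   is proper, with boundary S `&` bdry. *)
Definition proper_surface (R : realType) (M : topologicalType) (S : set M) : Prop :=
  closed S /\
  forall p, S p -> exists U (f : M -> 'rV[R]_3),
    [/\ is_chart U f, U p & forall q, U q -> (S q <-> f q 0 ord_max = 0)].

Definition irreducible3 (R : realType) (M : topologicalType) : Prop :=
  forall s : 'rV[R]_3 -> M,
    embedding (@unit_sphere R 3) s ->
    proper_surface R (s @` @unit_sphere R 3) ->
    (s @` @unit_sphere R 3) `&` @bdry R M = set0 ->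
    exists2 b : 'rV[R]_3 -> M, embedding (@unit_ball R 3) b &
      b @` @unit_sphere R 3 = s @` @unit_sphere R 3.

Definition incompressible_bdry (R : realType) (M : topologicalType) : Prop :=
  forall d : 'rV[R]_2 -> M,
    embedding (@unit_ball R 2) d ->
    proper_surface R (d @` @unit_ball R 2) ->
    (d @` @unit_ball R 2) `&` @bdry R M = d @` @unit_sphere R 2 ->
    exists e : 'rV[R]_2 -> M,
      [/\ embedding (@unit_ball R 2) e, e @` @unit_ball R 2 `<=` @bdry R M &
          e @` @unit_sphere R 2 = d @` @unit_sphere R 2].

Definition at_most_two_components (M : topologicalType) : Prop :=
  exists p q : M,
    [set: M] = connected_component [set: M] p `|` connected_component [set: M] q.

(** * Triangulations *)

(* The standard tetrahedron, in barycentric coordinates indexed by its vertices;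
   the face opposite to the vertex i is {x_i = 0}. *)
Definition simplex (R : realType) : set 'rV[R]_4 :=
  [set x : 'rV[R]_4 | (forall i, 0 <= x 0 i) /\ \sum_i x 0 i = 1].

(* The open face on which exactly the coordinates listed in s vanish. *)
Definition open_face (R : realType) (s : seq 'I_4) : set 'rV[R]_4 :=
  [set x | simplex x /\ forall l, (x 0 l == 0) = (l \in s)].

Definition same_open_face (R : realType) (x y : 'rV[R]_4) : Prop :=
  forall l, (x 0 l == 0) = (y 0 l == 0).

(* A triangulation in the sense of 3-manifold topology (a Delta-complex, so that
   faces of one tetrahedron may be identified): chi t is the characteristic map
   of the tetrahedron t.  The open simplices embed, and points have the same
   image only through an affine identification of the faces carrying them;
   [col_perm p] sends the vertex p j to the vertex j. *)
Record triangulation (R : realType) (M : topologicalType) (K : finType)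
    (chi : K -> 'rV[R]_4 -> M) : Prop := Triangulation {
  tri_continuous : forall t, {within @simplex R, continuous (chi t)};
  tri_cover : forall q, exists t x, simplex x /\ chi t x = q;
  tri_open_inj : forall t x y, simplex x -> simplex y -> same_open_face x y ->
    chi t x = chi t y -> x = y;
  tri_interior : forall t u x y, open_face [::] x -> simplex y ->
    chi t x = chi u y -> t = u /\ x = y;
  tri_glue : forall t u x y, simplex x -> simplex y -> chi t x = chi u y ->
    exists p : 'S_4, y = col_perm p x /\
      forall z, simplex z -> (forall i, x 0 i = 0 -> z 0 i = 0) ->
        chi t z = chi u (col_perm p z)
}.

(* The tetrahedron t carries the orientation given by the order of its vertices
   if o t = false, and the opposite one if o t = true.  Coherence: two
   tetrahedra glued along a face induce opposite orientations on it. *)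
Definition orientation (R : realType) (M : topologicalType) (K : finType)
    (chi : K -> 'rV[R]_4 -> M) (o : K -> bool) : Prop :=
  forall (t u : K) (i : 'I_4) (p : 'S_4), (t != u) || (p i != i) ->
    (forall z, simplex z -> z 0 i = 0 -> chi t z = chi u (col_perm p z)) ->
    o t (+) o u (+) odd_perm p.

(** * Curves on a marked torus *)

(* A torus is given by a universal covering cov : R^2 -> T with deck group Z^2,
   which amounts to a homeomorphism R^2/Z^2 -> T.  It carries the basis of
   H_1(T) formed by the images of the two coordinate directions: the class of a
   closed path is the displacement of its lifts. *)
Definition intvec (R : realType) (v : 'cV[int]_2) : 'cV[R]_2 :=
  map_mx (fun z : int => z%:~R) v.

Definition torus_covering (R : realType) (M : topologicalType)
    (cov : 'cV[R]_2 -> M) (T : set M) : Prop :=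
  [/\ continuous cov, range cov = T &
      forall x y, cov x = cov y <-> exists v, x - y = intvec R v].

Definition path_class (R : realType) (M : topologicalType)
    (cov : 'cV[R]_2 -> M) (g : R -> M) (v : 'cV[int]_2) : Prop :=
  exists l : R -> 'cV[R]_2,
    [/\ {within `[0, 1], continuous l},
        forall s, 0 <= s <= 1 -> cov (l s) = g s & l 1 - l 0 = intvec R v].

Definition simple_closed (R : realType) (X : topologicalType) (g : R -> X) : Prop :=
  [/\ {within `[0, 1], continuous g}, g 0 = g 1 &
      forall s t, 0 <= s < 1 -> 0 <= t < 1 -> g s = g t -> s = t].

Definition trace_of (R : realType) (X : Type) (g : R -> X) : set X :=
  g @` [set s | 0 <= s <= 1].

(* Slopes are elements of the projective line over the rationals, None being
   1/0.  The class with coordinates (a, b) has slope a/b. *)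
Definition slope := option rat.

Definition slope_of (v : 'cV[int]_2) : slope :=
  if v ord_max 0 == 0 then None
  else Some ((v ord0 0)%:~R / (v ord_max 0)%:~R).

Definition mobius (A : 'M[rat]_2) (q : slope) : slope :=
  let num := if q is Some x then A ord0 ord0 * x + A ord0 ord_max
             else A ord0 ord0 in
  let den := if q is Some x then A ord_max ord0 * x + A ord_max ord_max
             else A ord_max ord0 in
  if den == 0 then None else Some (num / den).

Definition essential_curve (R : realType) (M : topologicalType)
    (cov : 'cV[R]_2 -> M) (g : R -> M) (v : 'cV[int]_2) : Prop :=
  [/\ simple_closed g, path_class cov g v & v != 0].

Definition curve_slope (R : realType) (M : topologicalType)
    (cov : 'cV[R]_2 -> M) (g : R -> M) (q : slope) : Prop :=
  exists2 v, essential_curve cov g v & slope_of v = q.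

(* The slope of a curve C (disjoint union of simple closed curves) on T; a simple
   closed curve contained in C is a component of C. *)
Definition has_slope (R : realType) (M : topologicalType)
    (cov : 'cV[R]_2 -> M) (C : set M) (q : slope) : Prop :=
  exists2 g, curve_slope cov g q & trace_of g `<=` C.

Definition farey_adj (R : realType) (M : topologicalType)
    (cov : 'cV[R]_2 -> M) (q r : slope) : Prop :=
  q <> r /\ exists g h : R -> M,
    [/\ curve_slope cov g q, curve_slope cov h r &
        exists x, trace_of g `&` trace_of h = [set x]].

Definition farey_path (R : realType) (M : topologicalType)
    (cov : 'cV[R]_2 -> M) (n : nat) (q r : slope) : Prop :=
  exists p : nat -> slope,
    [/\ p 0%N = q, p n = r & forall i, (i < n)%N -> farey_adj cov (p i) (p i.+1)].

Definition farey_dist (R : realType) (M : topologicalType)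
    (cov : 'cV[R]_2 -> M) (q r : slope) : \bar R :=
  ereal_inf [set d | exists2 n, farey_path cov n q r & d = (n%:R)%:E].

(* The maps induced by f : T1 -> T2 on H_1 and on slopes. *)
Definition induces (R : realType) (M : topologicalType)
    (cov1 cov2 : 'cV[R]_2 -> M) (f : M -> M) (A : 'M[int]_2) : Prop :=
  forall g v, path_class cov1 g v -> path_class cov2 (f \o g) (A *m v).

Definition slope_image (R : realType) (M : topologicalType)
    (cov1 cov2 : 'cV[R]_2 -> M) (f : M -> M) (q r : slope) : Prop :=
  exists2 g, curve_slope cov1 g q & curve_slope cov2 (f \o g) r.

Definition anosov (R : realType) (M : topologicalType)
    (cov : 'cV[R]_2 -> M) (f : M -> M) : Prop :=
  exists2 A, induces cov cov f A & 2 < `|\tr A|.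

(** * Torus boundary components with one-vertex triangulations *)

(* The two triangles of the torus are indexed by bool: triangle b is the face of
   the tetrahedron bt_tet b opposite to its vertex bt_lab b 0, and its edge e_i
   is opposite to its vertex bt_lab b (i + 1), for i : 'I_3.  The direction in
   which curves of type i are to cross e_i is from triangle bt_dir i to
   triangle ~~ bt_dir i. *)
Record bd_torus (R : realType) (M : Type) (K : finType) := BdTorus {
  bt_tet : bool -> K;
  bt_lab : bool -> 'S_4;
  bt_dir : 'I_3 -> bool;
  bt_cov : 'cV[R]_2 -> M
}.

Section BoundaryTorus.
Variables (R : realType) (M : topologicalType) (K : finType).
Variables (chi : K -> 'rV[R]_4 -> M) (T : bd_torus R M K).

Definition bt_apex (b : bool) : 'I_4 := bt_lab T b ord0.
Definition bt_vertex (b : bool) (i : 'I_3) : 'I_4 := bt_lab T b (lift ord0 i).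

Definition bt_face (b : bool) : set 'rV[R]_4 :=
  [set x | simplex x /\ x 0 (bt_apex b) = 0].
Definition bt_face_edge (b : bool) (i : 'I_3) : set 'rV[R]_4 :=
  [set x | bt_face b x /\ x 0 (bt_vertex b i) = 0].

Definition bt_triangle (b : bool) : set M := chi (bt_tet T b) @` bt_face b.
Definition bt_edge (i : 'I_3) : set M :=
  chi (bt_tet T false) @` bt_face_edge false i.
Definition bt_set : set M := bt_triangle false `|` bt_triangle true.

Definition one_vertex_torus : Prop :=
  [/\ exists2 p, @bdry R M p & bt_set = connected_component (@bdry R M) p,
      torus_covering (bt_cov T) bt_set,
      (bt_tet T false, bt_apex false) != (bt_tet T true, bt_apex true),
      forall i, chi (bt_tet T true) @` bt_face_edge true i = bt_edge i &
      forall b c i j, chi (bt_tet T b) (delta_mx 0 (bt_vertex b i)) =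
                      chi (bt_tet T c) (delta_mx 0 (bt_vertex c j))].

(* Lift triangle b to R^2 along the covering.  The differences of the lifted
   vertices are the homology classes of the edges, so the lifted triangle is
   positively oriented exactly when det > 0.  The order (0, 1, 2) of the vertices
   of triangle b gives the induced boundary orientation iff listing the apex
   first gives the orientation of the tetrahedron, i.e. iff
   odd_perm (bt_lab b) = o (bt_tet b).  With rev = false the homology basis
   agrees with the boundary orientation, with rev = true it disagrees. *)
Definition basis_orientation (o : K -> bool) (rev : bool) : Prop :=
  forall (b : bool) (l : 'rV[R]_4 -> 'cV[R]_2),
    {within bt_face b, continuous l} ->
    (forall x, bt_face b x -> bt_cov T (l x) = chi (bt_tet T b) x) ->
    let w (i : nat) := l (delta_mx 0 (bt_vertex b (inord i))) in
    0 < (-1) ^+ (odd_perm (bt_lab T b) (+) o (bt_tet T b) (+) rev) *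
        \det (row_mx (w 1%N - w 0%N) (w 2%N - w 1%N) : 'M[R]_2).

End BoundaryTorus.

(** * Surfaces normal with respect to the 2-skeleton *)

Definition hull (R : realType) (s : seq 'rV[R]_4) : set 'rV[R]_4 :=
  [set x | exists w : 'I_(size s) -> R,
    [/\ forall i, 0 <= w i, \sum_i w i = 1 & x = \sum_i w i *: s`_i]].

Definition polyhedron (R : realType) (A : set 'rV[R]_4) : Prop :=
  exists ss : seq (seq 'rV[R]_4), A = [set x | exists2 s, s \in ss & hull s x].

(* A normal arc in the face opposite to i, from the edge {x_i = x_j = 0} to the
   edge {x_i = x_k = 0}. *)
Definition normal_arc (R : realType) (i j k : 'I_4) (A : set 'rV[R]_4) : Prop :=
  [/\ i != j, i != k, j != k &
   exists a : R -> 'rV[R]_4,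
    [/\ {within `[0, 1], continuous a} /\ trace_of a = A,
        forall s t, 0 <= s <= 1 -> 0 <= t <= 1 -> a s = a t -> s = t,
        open_face [:: i; j] (a 0), open_face [:: i; k] (a 1) &
        forall s, 0 < s < 1 -> open_face [:: i] (a s)]].

(* A simple loop on the boundary of the tetrahedron made of m normal arcs. *)
Definition normal_loop (R : realType) (m : nat) (L : set 'rV[R]_4) : Prop :=
  (exists2 g : R -> 'rV[R]_4, simple_closed g & trace_of g = L) /\
  exists (A : 'I_m -> set 'rV[R]_4) (f : 'I_m -> 'I_4),
    [/\ forall a, exists j k, normal_arc (f a) j k (A a),
        forall a b, a != b -> f a = f b -> A a `&` A b = set0 &
        L = \bigcup_a A a].

Definition loop_complexity (m : nat) : nat :=
  if m == 3%N then 0%N else (m %/ 4).-1.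

Definition normal_isotopy (R : realType) (L : set 'rV[R]_4)
    (h : R -> 'rV[R]_4 -> 'rV[R]_4) : Prop :=
  [/\ {within [set z : R * 'rV[R]_4 | 0 <= z.1 <= 1 /\ L z.2],
        continuous (fun z : R * 'rV[R]_4 => h z.1 z.2)},
      forall x, L x -> h 0 x = x,
      forall s x y, 0 <= s <= 1 -> L x -> L y -> h s x = h s y -> x = y &
      forall s x, 0 <= s <= 1 -> L x -> simplex (h s x) /\ same_open_face x (h s x)].

Section NormalSurfaces.
Variables (R : realType) (M : topologicalType) (K : finType).
Variable chi : K -> 'rV[R]_4 -> M.

Definition in_tet (t : K) (S : set M) : set 'rV[R]_4 :=
  [set x | simplex x /\ S (chi t x)].
Definition on_tet_bdry (t : K) (S : set M) : set 'rV[R]_4 :=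
  [set x | in_tet t S x /\ exists i, x 0 i = 0].

(* Surfaces are piecewise linear with respect to the triangulation. *)
Definition normal_surface (S : set M) : Prop :=
  [/\ proper_surface R S,
      forall t, polyhedron (in_tet t S) &
      forall t, exists n (L : 'I_n -> set 'rV[R]_4),
        [/\ forall a, exists m, normal_loop m (L a),
            forall a b, a != b -> L a `&` L b = set0 &
            on_tet_bdry t S = \bigcup_a L a]].

(* The loops of S on the boundary of t: a simple closed curve contained in a
   disjoint union of such curves is one of them. *)
Definition loop_of (t : K) (S : set M) (m : nat) (L : set 'rV[R]_4) : Prop :=
  normal_loop m L /\ L `<=` on_tet_bdry t S.

Definition complexity_le (c : nat) (S : set M) : Prop :=
  forall t m L, loop_of t S m L -> (loop_complexity m <= c)%N.

Definition compatible (F G : set M) : Prop :=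
  forall t, exists h k : set 'rV[R]_4 -> R -> 'rV[R]_4 -> 'rV[R]_4,
    [/\ forall m L, loop_of t F m L -> normal_isotopy L (h L),
        forall m L, loop_of t G m L -> normal_isotopy L (k L) &
        forall m n L N, loop_of t F m L -> loop_of t G n N ->
          (h L 1 @` L) `&` (k N 1 @` N) = set0].

Definition pairwise_compatible (C : set (set M)) : Prop :=
  (forall F, C F -> normal_surface F) /\
  (forall F G, C F -> C G -> compatible F G).

Definition compatibility_class (C : set (set M)) : Prop :=
  pairwise_compatible C /\
  forall D, pairwise_compatible D -> C `<=` D -> D `<=` C.

(* The arcs of S in triangle b of the torus T that are disjoint from e_i. *)
Definition arcs_off (T : bd_torus R M K) (b : bool) (i : 'I_3) (S : set M) :
    set (set 'rV[R]_4) :=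
  [set A | [/\ exists j k, normal_arc (bt_apex T b) j k A,
               A `<=` in_tet (bt_tet T b) S & A `&` bt_face_edge T b i = set0]].

Definition has_type (T : bd_torus R M K) (i : 'I_3) (S : set M) : Prop :=
  forall b j, (arcs_off T b i S #<= arcs_off T b j S)%card.

Definition typed_class (T1 T2 : bd_torus R M K) (i1 i2 : 'I_3)
    (D : set (set M)) : Prop :=
  exists2 C, compatibility_class C &
    D = [set S | [/\ C S, has_type T1 i1 S & has_type T2 i2 S]].

(* g crosses e_i only in the fixed direction (and does not start on e_i). *)
Definition oriented_by_type (T : bd_torus R M K) (i : 'I_3) (g : R -> M) : Prop :=
  ~ bt_edge chi T i (g 0) /\
  forall s : R, 0 < s < 1 -> bt_edge chi T i (g s) ->
    (\forall r \near s^'-, bt_triangle chi T (bt_dir T i) (g r)) /\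
    (\forall r \near s^'+, bt_triangle chi T (~~ bt_dir T i) (g r)).

(* v is the homology class of the curve in which S meets T, oriented by type: the
   sum of the classes of its essential components. *)
Definition oriented_class (T : bd_torus R M K) (i : 'I_3) (S : set M)
    (v : 'cV[int]_2) : Prop :=
  exists n (g : 'I_n -> R -> M) (w : 'I_n -> 'cV[int]_2),
    [/\ forall a, [/\ essential_curve (bt_cov T) (g a) (w a),
                      trace_of (g a) `<=` S & oriented_by_type T i (g a)],
        forall a b, a != b -> trace_of (g a) `&` trace_of (g b) = set0,
        forall f u, essential_curve (bt_cov T) f u -> trace_of f `<=` S ->
          exists a, trace_of f = trace_of (g a) &
        v = \sum_a w a].

(* Surfaces meeting both tori in curves having slopes, and no other component
   of the boundary. *)
Definition admissible (T1 T2 : bd_torus R M K) (S : set M) : Prop :=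
  [/\ S `&` @bdry R M `<=` bt_set chi T1 `|` bt_set chi T2,
      exists q, has_slope (bt_cov T1) S q &
      exists q, has_slope (bt_cov T2) S q].

Definition to_rat (v : 'cV[int]_2) : 'cV[rat]_2 :=
  map_mx (fun z : int => z%:~R) v.

(* Phi is an admissible choice of the maps of the typed compatibility classes;
   a typed class is given by its type (i1, i2) and its set D of surfaces. *)
Definition is_Phi (T1 T2 : bd_torus R M K)
    (Phi : 'I_3 -> 'I_3 -> set (set M) -> 'M[rat]_2) : Prop :=
  forall i1 i2 D, typed_class T1 T2 i1 i2 D ->
    [/\ \det (Phi i1 i2 D) = 1,
        forall S q1 q2, D S -> admissible T1 T2 S ->
          has_slope (bt_cov T1) S q1 -> has_slope (bt_cov T2) S q2 ->
          mobius (Phi i1 i2 D) q2 = q1 &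
        (exists S S' q q',
           [/\ D S /\ admissible T1 T2 S, D S' /\ admissible T1 T2 S',
               has_slope (bt_cov T2) S q, has_slope (bt_cov T2) S' q' & q <> q']) ->
        forall S v1 v2, D S -> admissible T1 T2 S ->
          oriented_class T1 i1 S v1 -> oriented_class T2 i2 S v2 ->
          Phi i1 i2 D *m to_rat v2 = to_rat v1].

(* The distance of f Phi, for P = Phi of some class, and the c-distance of f.
   The minima are infima of natural numbers, +oo for an empty set. *)
Definition map_distance (T1 T2 : bd_torus R M K) (f : M -> M) (P : 'M[rat]_2) :
    \bar R :=
  ereal_inf [set d | exists q r,
    slope_image (bt_cov T1) (bt_cov T2) f (mobius P q) r /\
    d = farey_dist (bt_cov T2) q r].

Definition c_distance (T1 T2 : bd_torus R M K)
    (Phi : 'I_3 -> 'I_3 -> set (set M) -> 'M[rat]_2) (c : nat) (f : M -> M) :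
    \bar R :=
  ereal_inf [set d | exists i1 i2 D,
    [/\ typed_class T1 T2 i1 i2 D, forall S, D S -> complexity_le c S &
        d = map_distance T1 T2 f (Phi i1 i2 D)]].

End NormalSurfaces.

(* Main.v *)
(* By maximality, two surfaces belong to the same compatibility classes as soon as their
   loops on the boundary of each tetrahedron are the same up to normal isotopy.  Up to normal
   isotopy there are only finitely many loops of bounded complexity, so there are finitely
   many typed classes of complexity at most c, hence finitely many matrices P = Phi_C to
   consider.  For a given P, let d be a common denominator of its entries.  The integers
   x_n = d tr (A^n B P) satisfy x_(n+2) = tr A x_(n+1) - x_n with |tr A| > 2, so that for
   large n they vanish or are large; but if A^n B P fixed a slope, d A^n B P would have an
   integral eigenvalue dividing its determinant d^2, so x_n would be nonzero and bounded.

   Finiteness of loops up to isotopy: in a face, surfaces are piecewise linear, since a convex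
   set contained in finitely many arcs is a segment.  So a loop is a finite union of paths
   along which the squared norm first decreases and then increases.  Raising a level r, the part
   of each path below r is replaced by its chord, as long as no junction of two paths
   is met; a junction that is met is either not a peak, and the paths are merged, or a peak, which
   is pushed across the triangle cut by the level.  When no junction is left all the arcs
   become segments, and disjoint segments whose endpoints are in the same order on the edges
   can be interpolated linearly. *)
Require Import Defs.
From mathcomp Require Import all_boot all_order all_algebra all_fingroup.
From mathcomp Require Import all_classical all_reals all_analysis.
From mathcomp Require Import zify ring lra.
Import Order.TTheory GRing.Theory Num.Theory.
Import numFieldNormedType.Exports.
Local Open Scope classical_set_scope.
Local Open Scope ring_scope.
Set Implicit Arguments.
Unset Strict Implicit.

(** * Rational eigenvectors of powers *)

(** [compatible] moves every loop by its own isotopy and asks for disjointness only between a loop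
    of one surface and a loop of the other. So the nesting and the multiplicity of parallel loops do
    not matter, and a surface may be recorded by the mere set of isotopy types of its loops in each
    tetrahedron. Moreover a normal isotopy moves only the loop and need not extend to the boundary
    of the tetrahedron: it is enough to exhibit parametrised paths, continuous in time, whose
    coincidences never change. These coincidences must then be controlled at all times at once. The
    squared norm serves as a height function for this: being strictly convex, it cuts out of each
    face a convex disc, a segment joining two boundary points not on a common edge is interior to
    the disc, and the crossing of two such segments is read off the signs of determinants. A general
    isotopy cannot be reversed without the continuity of an inverse, so both directions are carried
    along. *)

Lemma lucas_growth (x : nat -> int) (T : int) :
  2 < `|T| -> (forall n, x n.+2 = T * x n.+1 - x n) ->
  forall K : nat, exists N : nat, forall n, (N <= n)%N ->
    x n = 0 \/ (K < `|x n|)%N.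
Proof.
move=> T2 xS K.
have grow n : (`|T| * `|x n.+1| <= `|x n.+2| + `|x n|)%N by rewrite xS; nia.
have T3 : (2 < `|T|)%N by lia.
(* Since [T] has absolute value at least 3, [grow] propagates one strict increase of the absolute
   values to all later indices. Without any increase they are nonincreasing and reach a minimum. *)
have [[n0 ltn0]|nogrow] := pselect (exists n0, (`|x n0| < `|x n0.+1|)%N).
  have inc k : (`|x (n0 + k)| < `|x (n0 + k).+1|)%N.
    elim: k => [|k IHk]; first by rewrite addn0.
    by rewrite addnS; have := grow (n0 + k)%N; nia.
  have big k : (k <= `|x (n0 + k)|)%N.
    elim: k => // k IHk; rewrite addnS; have := inc k; lia.
  exists (n0 + K.+1)%N => n len; right.
  by have := big (n - n0)%N; rewrite subnKC; lia.
have dec n : (`|x n.+1| <= `|x n|)%N.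
  by rewrite leqNgt; apply/negP => lt_n; apply: nogrow; exists n.
have decD n k : (`|x (n + k)| <= `|x n|)%N.
  elim: k => [|k IHk]; first by rewrite addn0.
  by rewrite addnS; apply: leq_trans (dec _) IHk.
have [n0 n0_min] : exists n0, forall n, (`|x n0| <= `|x n|)%N.
  have ex : exists y, `[< exists n, `|x n| = y >]%N.
    by exists `|x 0%N|%N; apply/asboolP; exists 0%N.
  have := ex_minnP ex => -[y /asboolP[n0 <-] min_y]; exists n0 => n.
  by apply: min_y; apply/asboolP; exists n.
(* From the minimum on, three consecutive absolute values are equal, and [3 * y <= 2 * y] forces
   [y = 0]. *)
have x0 : `|x n0|%N = 0%N.
  have := grow n0; have := decD n0 1%N; have := decD n0 2%N.
  by have := n0_min n0.+1; rewrite addn1 addn2; nia.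
exists n0 => n len; left.
by have := decD n0 (n - n0)%N; rewrite subnKC //; lia.
Qed.

Lemma det_mx22 (R : comPzRingType) (A : 'M[R]_2) :
  \det A = A ord0 ord0 * A ord_max ord_max - A ord0 ord_max * A ord_max ord0.
Proof.
rewrite (expand_det_row _ ord0) !big_ord_recl big_ord0 addr0 /cofactor !det_mx11 !mxE.
rewrite /= /bump /= !addn0 expr0 mul1r expr1 mulN1r mulrN.
by congr (A _ _ * A _ _ - A _ _ * A _ _); apply/val_inj.
Qed.

Lemma tr_mx22 (R : comPzRingType) (A : 'M[R]_2) :
  \tr A = A ord0 ord0 + A ord_max ord_max.
Proof.
rewrite /mxtrace !big_ord_recl big_ord0 addr0.
by congr (_ + A _ _); apply/val_inj.
Qed.

Lemma mulmx22E (R : comPzRingType) (n : nat) (A : 'M[R]_2) (B : 'M[R]_(2, n)) i j :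
  (A *m B) i j = A i ord0 * B ord0 j + A i ord_max * B ord_max j.
Proof.
rewrite mxE !big_ord_recl big_ord0 addr0.
by congr (_ + A _ _ * B _ _); apply/val_inj.
Qed.

Lemma ord2P (P : 'I_2 -> Prop) : P ord0 -> P ord_max -> forall i, P i.
Proof.
move=> P0 P1 [[|[|//]] lti].
  by rewrite (_ : Ordinal lti = ord0) //; apply/val_inj.
by rewrite (_ : Ordinal lti = ord_max) //; apply/val_inj.
Qed.

Lemma mx22P (R : Type) (A B : 'M[R]_2) :
  A ord0 ord0 = B ord0 ord0 -> A ord0 ord_max = B ord0 ord_max ->
  A ord_max ord0 = B ord_max ord0 -> A ord_max ord_max = B ord_max ord_max ->
  A = B.
Proof.
by move=> *; apply/matrixP; elim/ord2P; elim/ord2P.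
Qed.

(** The Cayley-Hamilton identity in size two. *)
Lemma sqr_mx22 (R : comNzRingType) (A : 'M[R]_2) :
  A *m A = \tr A *: A - (\det A)%:M.
Proof.
apply: mx22P; rewrite !mulmx22E !mxE tr_mx22 det_mx22 /=; ring.
Qed.

Lemma trace_recurrence (R : comNzRingType) (A C : 'M[R]_2) (n : nat) :
  \det A = 1 ->
  \tr (A ^+ n.+2 *m C) = \tr A * \tr (A ^+ n.+1 *m C) - \tr (A ^+ n *m C).
Proof.
move=> dA.
have -> : A ^+ n.+2 = \tr A *: A ^+ n.+1 - A ^+ n.
  rewrite !exprSr -mulrA; rewrite -[A * A]/(A *m A) sqr_mx22 dA.
  by rewrite mulrBr -scalerAr mulr1.
by rewrite mulmxBl -scalemxAl raddfB /= linearZ.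
Qed.

(** The denominator of a root divides the square of the numerator, to which it is coprime. *)
Lemma rat_root_monic (b c : int) (k : rat) :
  k ^+ 2 - b%:~R * k + c%:~R = 0 -> exists n : int, k = n%:~R.
Proof.
move=> root_k; exists (numq k).
have den0 : (denq k)%:~R != 0 :> rat by rewrite intr_eq0 denq_neq0.
have E : (numq k ^+ 2 = denq k * (b * numq k - c * denq k))%R.
  apply/eqP; rewrite -(eqr_int rat) !(intrM, intrB, rmorphXn) /= -subr_eq0; apply/eqP.
  have -> : (numq k)%:~R = k * (denq k)%:~R :> rat by rewrite numqE.
  by rewrite -[RHS](mulr0 ((denq k)%:~R ^+ 2 : rat)) -root_k; ring.
have : (denq k %| numq k ^+ 2)%Z by rewrite E dvdz_mulr.
rewrite expr2 Gauss_dvdzl; last by rewrite coprimez_sym; apply: coprime_num_den.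
have := coprime_num_den k; rewrite -[coprime _ _]/(coprimez (numq k) (denq k)).
rewrite /coprimez => cop /gcdz_idPl; rewrite gcdzC (eqP cop) => d1.
have {}d1 : denq k = 1 by have := denq_gt0 k; lia.
by rewrite -[LHS]divq_num_den d1 divr1.
Qed.

(** The eigenvalue is an integer [n], and [n * (\tr C - n) = d ^+ 2]. Both factors are nonzero, so
    their sum is bounded by their product; trace zero would give [- n ^+ 2 = d ^+ 2]. *)
Lemma trace_of_rat_eigen (C : 'M[int]_2) (d : int) (k : rat) (w : 'cV[rat]_2) :
  \det C = d ^+ 2 -> d != 0 -> w != 0 -> map_mx intr C *m w = k *: w ->
  \tr C != 0 /\ (`|\tr C| <= 2 * `|d| ^ 2)%N.
Proof.
move=> detC d0 w0 eig.
have E0 : (C ord0 ord0)%:~R * w ord0 0 + (C ord0 ord_max)%:~R * w ord_max 0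
   = k * w ord0 0.
  by move/matrixP: eig => /(_ ord0 0); rewrite mulmx22E !mxE.
have E1 : (C ord_max ord0)%:~R * w ord0 0 + (C ord_max ord_max)%:~R * w ord_max 0
   = k * w ord_max 0.
  by move/matrixP: eig => /(_ ord_max 0); rewrite mulmx22E !mxE.
(* If the characteristic polynomial did not vanish at [k], eliminating one coordinate from [E0] and
   [E1], that is, applying the adjugate of [C - k], would give [w = 0]. *)
have /eqP root_k : k ^+ 2 - (\tr C)%:~R * k + (\det C)%:~R = 0 :> rat.
  apply: contraNeq w0 => neq0; apply/eqP/matrixP; elim/ord2P => j; rewrite (ord1 j) mxE;
    apply: (mulfI neq0); rewrite mulr0 tr_mx22 det_mx22 !rmorphE /=.
    move: E0 E1; set a := _%:~R; set b := (C ord0 ord_max)%:~R; set a' := _%:~R; set b' := _%:~R.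
    by move=> E0 E1; have := congr1 ( *%R (k - b')) E0; have := congr1 ( *%R b) E1; lra.
  move: E0 E1; set a := _%:~R; set b := (C ord0 ord_max)%:~R; set a' := _%:~R; set b' := _%:~R.
  by move=> E0 E1; have := congr1 ( *%R (k - a)) E1; have := congr1 ( *%R a') E0; lra.
have [n kn] := rat_root_monic (eqP root_k).
have {root_k} E : n * (\tr C - n) = d ^+ 2.
  move: root_k; rewrite kn -rmorphXn -intrM -rmorphB -intrD intr_eq0 detC.
  by move=> /eqP; lia.
split; first by apply/eqP => tr0; move: E; rewrite tr0; nia.
have n0 : n != 0 by apply: contra_neq d0 => n0; move: E; rewrite n0; nia.
have m0 : \tr C - n != 0 by apply: contra_neq d0 => m0; move: E; rewrite m0; nia.
have E' : (`|n| * `|\tr C - n| = `|d| ^ 2)%N by rewrite -abszM E abszX.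
have -> : (`|\tr C| <= `|n| + `|\tr C - n|)%N -> (`|\tr C| <= 2 * `|d| ^ 2)%N.
  by rewrite -E'; nia.
  by [].
lia.
Qed.

Lemma clear_denominators (m n : nat) (P : 'M[rat]_(m, n)) :
  exists d : int, d != 0 /\ exists C : 'M[int]_(m, n), map_mx intr C = d%:~R *: P.
Proof.
pose d := \prod_(ij : 'I_m * 'I_n) denq (P ij.1 ij.2).
exists d; split; first by apply/prodf_neq0 => ij _; rewrite denq_neq0.
exists (\matrix_(i, j)
  (numq (P i j) * \prod_(ij : 'I_m * 'I_n | ij != (i, j)) denq (P ij.1 ij.2))).
apply/matrixP => i j; rewrite !mxE /d [in RHS](bigD1 (i, j)) //= !intrM numqE.
by ring.
Qed.

Lemma no_rational_eigenvector (A B : 'M[int]_2) (P : 'M[rat]_2) :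
  \det A = 1 -> 2 < `|\tr A| -> \det B = 1 -> \det P = 1 ->
  exists N : nat, forall n, (N <= n)%N -> forall (w : 'cV[rat]_2) (k : rat),
    w != 0 -> map_mx intr (A ^+ n *m B) *m P *m w <> k *: w.
Proof.
move=> dA tA dB dP; have [d [d0 [C PC]]] := clear_denominators P.
have detC : \det C = d ^+ 2.
  apply/eqP; rewrite -(eqr_int rat) -det_map_mx /= PC detZ dP mulr1.
  by rewrite rmorphXn.
(* The sequence is the trace of [A ^+ n *m (B *m C)], which is [d] times [A ^+ n *m B *m P]. Its
   determinant [d ^+ 2] is the origin of the bound [2 * d ^ 2]. *)
have [N NP] := lucas_growth tA (fun n => trace_recurrence (B *m C) n dA)
  (2 * `|d| ^ 2)%N.
exists N => n len w k w0 eig.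
have detAn : \det (A ^+ n *m (B *m C)) = d ^+ 2.
  rewrite !det_mulmx dB mul1r detC; suff -> : \det (A ^+ n) = 1 by rewrite mul1r.
  by elim: n {len eig} => [|n IHn];
    rewrite ?expr0 ?det1 // exprS -[A * _]/(A *m _) det_mulmx dA mul1r.
have eigC : map_mx intr (A ^+ n *m (B *m C)) *m w = (d%:~R * k) *: w.
  rewrite mulmxA map_mxM /= PC -scalemxAr -scalemxAl eig scalerA.
  by [].
have [tr0 trle] := trace_of_rat_eigen detAn d0 w0 eigC.
case: (NP n len) => [/eqP|]; first by rewrite (negPf tr0).
by rewrite ltnNge trle.
Qed.

(** * Slopes and homology classes *)

Lemma integer_valued_cst (R : realType) (f : R -> R) :
  {within `[0, 1], continuous f} ->
  (forall s, 0 <= s <= 1 -> exists z : int, f s = z%:~R) -> f 0 = f 1.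
Proof.
move=> cf fZ; apply: contrapT => /eqP f01.
have [z0 f0] : exists z : int, f 0 = z%:~R by apply: fZ; rewrite lexx ler01.
have [z1 f1] : exists z : int, f 1 = z%:~R by apply: fZ; rewrite lexx ler01.
have z01 : z0 != z1 by apply: contra_neq f01; rewrite f0 f1 => ->.
(* A half-integer strictly between the two integers; the intermediate value theorem makes it a value
   of [f]. *)
pose c : R := (Num.min z0 z1)%:~R + 2^-1.
have [s s01 fs] : exists2 s, s \in `[0, 1] & f s = c.
  apply: IVT => //; rewrite ?ler01 // f0 f1 /c.
  have h0 : 0 < 2^-1 :> R by rewrite invr_gt0 ltr0n.
  have h1 : 2^-1 < 1 :> R by rewrite invf_lt1 ?ltr0n // ltr1n.
  case: (ltgtP z0 z1) z01 => // lt01 _.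
    have : z0%:~R + 1 <= z1%:~R :> R by rewrite -(intrD _ z0 1) ler_int; lia.
    move=> le01; rewrite ge_min le_max.
    by apply/andP; split; apply/orP; [left|right]; lra.
  have : z1%:~R + 1 <= z0%:~R :> R by rewrite -(intrD _ z1 1) ler_int; lia.
  move=> le01; rewrite ge_min le_max.
  by apply/andP; split; apply/orP; [right|left]; lra.
have {s01} [z fz] : exists z : int, f s = z%:~R by apply: fZ; rewrite in_itv in s01.
have : (2 * (z - Num.min z0 z1))%:~R = 1%:~R :> R.
  by rewrite intrM rmorphB /= -fz fs /c; field.
by move=> /intr_inj; lia.
Qed.

(** Two lifts of one path differ by a continuous function with values in the deck group, hence by a
    constant, so they have the same displacement. *)
Lemma path_class_unique (R : realType) (M : topologicalType)
    (cov : 'cV[R]_2 -> M) (T : set M) (g : R -> M) (v v' : 'cV[int]_2) :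
  torus_covering cov T -> path_class cov g v -> path_class cov g v' -> v = v'.
Proof.
move=> [_ _ covE] [l [cl lg l01]] [l' [cl' lg' l01']].
apply/matrixP => i j; rewrite (ord1 j) {j}.
have cd : {within `[0, 1], continuous (fun s => l s i 0 - l' s i 0)}.
  move=> s; apply: (@cvgB _ R^o).
    exact: (cvg_comp _ _ (cl s) (@coord_continuous R 2 1 i 0 (l s))).
  exact: (cvg_comp _ _ (cl' s) (@coord_continuous R 2 1 i 0 (l' s))).
have : l 0 i 0 - l' 0 i 0 = l 1 i 0 - l' 1 i 0.
  apply: (integer_valued_cst cd) => s s01.
  have /covE[u lu] : cov (l s) = cov (l' s) by rewrite lg // lg'.
  by exists (u i 0); move/matrixP: lu => /(_ i 0); rewrite !mxE.
move/matrixP: l01 => /(_ i 0); move/matrixP: l01' => /(_ i 0); rewrite !mxE.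
by move=> e' e e01; apply: (@intr_inj R); rewrite -e -e'; lra.
Qed.

(** Identifies the matrix of trace larger than 2 with the matrix of determinant 1, which are
    provided separately for [sigma]. Straight paths from the origin realise every class [v]. *)
Lemma induces_unique (R : realType) (M : topologicalType)
    (cov cov' : 'cV[R]_2 -> M) (T' : set M) (f : M -> M) (A A' : 'M[int]_2) :
  torus_covering cov' T' -> induces cov cov' f A -> induces cov cov' f A' -> A = A'.
Proof.
move=> covT' fA fA'.
suff AE (v : 'cV_2) : A *m v = A' *m v.
  by apply/matrixP => i j; have /matrixP/(_ i 0) := AE (delta_mx j 0); rewrite -!colE !mxE.
pose l (s : R) := s *: intvec R v.
have lP : path_class cov (cov \o l) v.
  exists l; split => //; last by rewrite /l scale1r scale0r subr0.
  apply: continuous_subspaceT => s.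
  by apply: cvgZl; exact: cvg_id.
exact: path_class_unique covT' (fA _ _ lP) (fA' _ _ lP).
Qed.

Lemma induces_iter (R : realType) (M : topologicalType)
    (cov1 cov2 : 'cV[R]_2 -> M) (psi sigma : M -> M) (A B : 'M[int]_2) (n : nat) :
  induces cov1 cov2 psi B -> induces cov2 cov2 sigma A ->
  induces cov1 cov2 (iter n sigma \o psi) (A ^+ n *m B).
Proof.
move=> psiB sigmaA; elim: n => [|n IHn] g v gv; first by rewrite expr0 mul1mx; apply: psiB.
rewrite exprS -[A * _]/(A *m _) -!mulmxA.
by apply: (sigmaA (iter n sigma \o psi \o g)); rewrite mulmxA; apply: IHn.
Qed.

(** A slope determines a vector up to a scalar. As [P] is invertible, [P *m to_rat w] is nonzero and
    has a slope to compare with. *)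
Lemma mobius_slope (P : 'M[rat]_2) (v w : 'cV[int]_2) :
  \det P != 0 -> w != 0 -> mobius P (slope_of w) = slope_of v ->
  exists k : rat, to_rat v = k *: (P *m to_rat w).
Proof.
move=> dP w0; set y := P *m to_rat w.
have wr0 : to_rat w != 0.
  apply: contra_neq w0 => /matrixP wE; apply/matrixP => i j; have := wE i j.
  by rewrite !mxE => /eqP; rewrite intr_eq0 => /eqP.
have y0 : y != 0.
  apply: contra_neq wr0 => yE; rewrite -[LHS]mul1mx -(@mulVmx _ _ P) ?unitmxE ?unitfE //.
  by rewrite -mulmxA -/y yE mulmx0.
have cross : mobius P (slope_of w) =
    if y ord_max 0 == 0 then None else Some (y ord0 0 / y ord_max 0).
  rewrite /slope_of; have [w1|w1] := eqVneq (w ord_max 0) 0; rewrite /mobius /=.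
    have w00 : (w ord0 0)%:~R != 0 :> rat.
      rewrite intr_eq0; apply: contra_neq w0 => w00; apply/matrixP; elim/ord2P => j;
      by rewrite (ord1 j) mxE.
    rewrite /y !mulmx22E !mxE w1 !mulr0 !addr0 mulf_eq0 (negPf w00) orbF.
    by case: ifP => // /negbT p0; congr Some; field; rewrite p0 w00.
  have {}w1 : (w ord_max 0)%:~R != 0 :> rat by rewrite intr_eq0.
  rewrite /y !mulmx22E !mxE.
  set a := (w ord0 0)%:~R; set b := (w ord_max 0)%:~R in w1 *.
  have -> : P ord_max ord0 * (a / b) + P ord_max ord_max =
    (P ord_max ord0 * a + P ord_max ord_max * b) / b by field.
  rewrite mulf_eq0 invr_eq0 (negPf w1) orbF.
  by case: ifP => // /negbT p0; congr Some; field; rewrite p0 w1.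
rewrite cross /slope_of {cross}; clearbody y.
have [y1|y1] := eqVneq (y ord_max 0) 0; have [v1|v1] := eqVneq (v ord_max 0) 0 => // vE.
  have y00 : y ord0 0 != 0.
    apply: contra_neq y0 => y00; apply/matrixP; elim/ord2P => j; by rewrite (ord1 j) [RHS]mxE.
  exists ((v ord0 0)%:~R / y ord0 0); apply/matrixP; elim/ord2P => j; rewrite (ord1 j) !mxE.
    by rewrite divfK.
  by rewrite v1 y1 mulr0.
exists ((v ord_max 0)%:~R / y ord_max 0); apply/matrixP; elim/ord2P => j; rewrite (ord1 j) !mxE.
  have {}v1 : (v ord_max 0)%:~R != 0 :> rat by rewrite intr_eq0.
  by case: vE => vE; rewrite mulrAC -mulrA vE mulrC divfK.
by rewrite divfK.
Qed.

(** Distances are path lengths, and a path of length 0 joins a slope to itself. *)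
Lemma map_distance_ge1 (R : realType) (M : topologicalType) (K : finType)
    (T1 T2 : bd_torus R M K) (f : M -> M) (P : 'M[rat]_2) :
  (forall q, ~ slope_image (bt_cov T1) (bt_cov T2) f (mobius P q) q) ->
  (1%:E <= map_distance T1 T2 f P)%E.
Proof.
move=> nofix; apply: le_ereal_inf_tmp => _ [q [r [fqr ->]]].
apply: le_ereal_inf_tmp => _ [[|n] [p [p0 pn _]] ->]; last by rewrite lee_fin ler1n.
by case: (nofix q); rewrite -{2}p0 pn.
Qed.

Lemma eventually_no_fixed_slope (R : realType) (M : topologicalType)
    (cov1 cov2 : 'cV[R]_2 -> M) (T : set M) (psi sigma : M -> M)
    (A B : 'M[int]_2) (P : 'M[rat]_2) :
  torus_covering cov2 T -> induces cov1 cov2 psi B -> induces cov2 cov2 sigma A ->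
  \det A = 1 -> 2 < `|\tr A| -> \det B = 1 -> \det P = 1 ->
  exists N : nat, forall n, (N <= n)%N -> forall q,
    ~ slope_image cov1 cov2 (iter n sigma \o psi) (mobius P q) q.
Proof.
move=> cov2T psiB sigmaA dA tA dB dP.
have [N NP] := no_rational_eigenvector dA tA dB dP.
exists N => n len q [g [v [_ gv _] vE] [w [_ gw w0] wE]].
have wv : w = A ^+ n *m B *m v.
  exact: path_class_unique cov2T gw (induces_iter n psiB sigmaA gv).
have mE : mobius P (slope_of w) = slope_of v by rewrite wE vE.
have dP0 : \det P != 0 by rewrite dP oner_neq0.
have [k kE] := mobius_slope dP0 w0 mE.
have wr0 : to_rat w != 0.
  apply: contra_neq w0 => /matrixP wE'; apply/matrixP => i j; have := wE' i j.
  by rewrite !mxE => /eqP; rewrite intr_eq0 => /eqP.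
(* Substituting [v] turns the fixed slope into an eigenvector of [A ^+ n *m B *m P], with eigenvalue
   [k^-1]. *)
have wk : to_rat w = k *: (map_mx intr (A ^+ n *m B) *m P *m to_rat w).
  by rewrite {1}wv /to_rat map_mxM -/(to_rat v) kE -scalemxAr mulmxA.
have k0 : k != 0 by apply: contra_neq wr0 => k0; rewrite wk k0 scale0r.
apply: (NP n len (to_rat w) k^-1 wr0).
by rewrite {2}wk scalerA mulVf // scale1r.
Qed.

(** * Segments in the faces of the tetrahedron *)

Definition seg (R : realType) (p q : 'rV[R]_4) (t : R) : 'rV[R]_4 := p + t *: (q - p).

Definition face (R : realType) (i : 'I_4) : set 'rV[R]_4 :=
  [set x | simplex x /\ x 0 i = 0].
Arguments face {R}.

Lemma seg0 (R : realType) (p q : 'rV[R]_4) : seg p q 0 = p.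
Proof. by rewrite /seg scale0r addr0. Qed.

Lemma seg1 (R : realType) (p q : 'rV[R]_4) : seg p q 1 = q.
Proof. by rewrite /seg scale1r addrC subrK. Qed.

Lemma segE (R : realType) (p q : 'rV[R]_4) (t : R) (l : 'I_4) :
  seg p q t 0 l = (1 - t) * p 0 l + t * q 0 l.
Proof. by rewrite /seg !mxE; ring. Qed.

Lemma seg_sym (R : realType) (p q : 'rV[R]_4) (t : R) : seg p q t = seg q p (1 - t).
Proof. by apply/rowP => l; rewrite !segE; ring. Qed.

Lemma seg_inj (R : realType) (p q : 'rV[R]_4) (t u : R) :
  p != q -> seg p q t = seg p q u -> t = u.
Proof.
move=> pq /eqP; rewrite /seg (inj_eq (addrI _)) -subr_eq0 -scalerBl scaler_eq0.
by rewrite !subr_eq0 [q == p]eq_sym (negPf pq) orbF => /eqP.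
Qed.

Lemma seg_seg (R : realType) (p q : 'rV[R]_4) (a b t : R) :
  seg (seg p q a) (seg p q b) t = seg p q (a + t * (b - a)).
Proof. by apply/rowP => l; rewrite !segE; ring. Qed.

(** The last term is the exact defect of convexity; its sign makes the squared norm strictly convex
    along segments. *)
Lemma sqnorm_seg (R : realType) (p q : 'rV[R]_4) (t : R) :
  sqnorm (seg p q t) =
  (1 - t) * sqnorm p + t * sqnorm q - t * (1 - t) * sqnorm (q - p).
Proof.
by rewrite /sqnorm !big_ord_recl !big_ord0 !segE !mxE; ring.
Qed.

Lemma sqnorm_ge0 (R : realType) (n : nat) (p : 'rV[R]_n) : 0 <= sqnorm p.
Proof. by apply: sumr_ge0 => l _; apply: sqr_ge0. Qed.

Lemma sqnormB_gt0 (R : realType) (n : nat) (p q : 'rV[R]_n) : p != q -> 0 < sqnorm (q - p).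
Proof.
move=> pq; rewrite lt0r sqnorm_ge0 andbT; apply: contra_neq pq => /eqP.
rewrite psumr_eq0 => [/allP qp|l _]; last exact: sqr_ge0.
apply/esym/rowP => l; have := qp l (mem_index_enum _).
by rewrite !mxE sqrf_eq0 subr_eq0 => /eqP.
Qed.

Lemma sqnorm_seg_lt (R : realType) (p q : 'rV[R]_4) (t r : R) :
  p != q -> 0 < t < 1 -> sqnorm p <= r -> sqnorm q <= r -> sqnorm (seg p q t) < r.
Proof.
move=> /sqnormB_gt0 pq /andP[t0 t1] pr qr; rewrite sqnorm_seg.
have : 0 < t * (1 - t) * sqnorm (q - p) by rewrite !mulr_gt0 ?subr_gt0.
by nra.
Qed.

Lemma sqnorm_seg_le (R : realType) (p q : 'rV[R]_4) (t r : R) :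
  0 <= t <= 1 -> sqnorm p <= r -> sqnorm q <= r -> sqnorm (seg p q t) <= r.
Proof.
move=> /andP[t0 t1] pr qr; rewrite sqnorm_seg.
have : 0 <= t * (1 - t) * sqnorm (q - p).
  by rewrite !mulr_ge0 ?subr_ge0 // sqnorm_ge0.
by nra.
Qed.

Lemma simplex_le1 (R : realType) (x : 'rV[R]_4) (l : 'I_4) : simplex x -> x 0 l <= 1.
Proof.
move=> [x0 <-]; rewrite (bigD1 l) //= lerDl.
by apply: sumr_ge0 => k _.
Qed.

Lemma sqnorm_simplex (R : realType) (x : 'rV[R]_4) : simplex x -> sqnorm x <= 1.
Proof.
move=> sx; rewrite -(proj2 sx) /sqnorm; apply: ler_sum => l _.
have := simplex_le1 l sx; have := proj1 sx l; rewrite expr2; nra.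
Qed.

Lemma seg_simplex (R : realType) (p q : 'rV[R]_4) (t : R) :
  simplex p -> simplex q -> 0 <= t <= 1 -> simplex (seg p q t).
Proof.
move=> [p0 p1] [q0 q1] /andP[t0 t1]; split=> [l|].
  by rewrite segE addr_ge0 // mulr_ge0 // subr_ge0.
under eq_bigr do rewrite segE.
by rewrite big_split -!mulr_sumr /= p1 q1; ring.
Qed.

Lemma seg_face (R : realType) (i : 'I_4) (p q : 'rV[R]_4) (t : R) :
  face i p -> face i q -> 0 <= t <= 1 -> face i (seg p q t).
Proof.
move=> [sp pi] [sq qi] t01; split; first exact: seg_simplex.
by rewrite segE pi qi !mulr0 addr0.
Qed.

Lemma seg_eq0 (R : realType) (p q : 'rV[R]_4) (t : R) (l : 'I_4) :
  simplex p -> simplex q -> 0 < t < 1 -> seg p q t 0 l = 0 -> p 0 l = 0 /\ q 0 l = 0.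
Proof.
move=> [p0 _] [q0 _] /andP[t0 t1]; rewrite segE.
by have := p0 l; have := q0 l; nra.
Qed.

(* The area form of the plane of the face i, read on two of its barycentric
   coordinates. *)
Definition cr (R : realType) (i : 'I_4) (p q z : 'rV[R]_4) : R :=
  let j := lift i (ord0 : 'I_3) in let k := lift i (lift ord0 ord0 : 'I_3) in
  (q 0 j - p 0 j) * (z 0 k - p 0 k) - (q 0 k - p 0 k) * (z 0 j - p 0 j).

Lemma cr_seg (R : realType) (i : 'I_4) (p q z1 z2 : 'rV[R]_4) (t : R) :
  cr i p q (seg z1 z2 t) = (1 - t) * cr i p q z1 + t * cr i p q z2.
Proof. by rewrite /cr !segE; ring. Qed.

Lemma cr_left (R : realType) (i : 'I_4) (p q : 'rV[R]_4) : cr i p q p = 0.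
Proof. by rewrite /cr; ring. Qed.

Lemma cr_right (R : realType) (i : 'I_4) (p q : 'rV[R]_4) : cr i p q q = 0.
Proof. by rewrite /cr; ring. Qed.

Lemma cr_chord (R : realType) (i : 'I_4) (p q : 'rV[R]_4) (t : R) :
  cr i p q (seg p q t) = 0.
Proof. by rewrite cr_seg cr_left cr_right !mulr0 addr0. Qed.

Lemma cr_rot (R : realType) (i : 'I_4) (p q z : 'rV[R]_4) : cr i p q z = cr i q z p.
Proof. by rewrite /cr; ring. Qed.

Lemma cr_swap (R : realType) (i : 'I_4) (p q z : 'rV[R]_4) : cr i p q z = - cr i q p z.
Proof. by rewrite /cr; ring. Qed.

Lemma ord3P (P : 'I_3 -> Prop) :
  P ord0 -> P (lift ord0 ord0) -> P (lift ord0 (lift ord0 ord0)) -> forall m, P m.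
Proof.
move=> P0 P1 P2 m; case: (unliftP ord0 m) => [k ->|->//].
by case: (unliftP ord0 k) => [k' ->|->//]; rewrite (ord1 k').
Qed.

Lemma face_sum (R : realType) (i : 'I_4) (x : 'rV[R]_4) : face i x ->
  x 0 (lift i (lift ord0 (lift ord0 ord0) : 'I_3)) =
  1 - x 0 (lift i (ord0 : 'I_3)) - x 0 (lift i (lift ord0 ord0 : 'I_3)).
Proof.
move=> [[_ x1] xi]; rewrite -x1 (bigD1_ord i) //= !big_ord_recl big_ord0 xi.
by ring.
Qed.

Lemma face_eq (R : realType) (i : 'I_4) (x y : 'rV[R]_4) : x 0 i = y 0 i ->
  (forall m : 'I_3, x 0 (lift i m) = y 0 (lift i m)) -> x = y.
Proof.
by move=> xi xl; apply/rowP => l; case: (unliftP i l) => [m ->|->].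
Qed.

Lemma collinear (R : realType) (i : 'I_4) (p q z : 'rV[R]_4) :
  face i p -> face i q -> face i z -> p != q -> cr i p q z = 0 ->
  exists t, z = seg p q t.
Proof.
move=> fp fq fz pq; have := face_sum fp; have := face_sum fq.
have := face_sum fz; rewrite /cr; set m := lift i (lift ord0 (lift ord0 ord0)).
set j := lift i ord0; set k := lift i _ => zm qm pm crz.
have main t : z 0 j = seg p q t 0 j -> z 0 k = seg p q t 0 k -> exists t, z = seg p q t.
  move=> zj zk; exists t; apply: (face_eq (i := i)).
    by rewrite segE (proj2 fp) (proj2 fq) (proj2 fz) !mulr0 addr0.
  elim/ord3P => //; rewrite -/m zm zj zk !segE qm pm; ring.
have [qpj|qpj] := eqVneq (q 0 j - p 0 j) 0.
  have qpk : q 0 k - p 0 k != 0.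
    apply: contra_neq pq => qpk; apply: (face_eq (i := i));
      first by rewrite (proj2 fp) (proj2 fq).
    by elim/ord3P; rewrite -/j -/k -/m; lra.
  apply: (main ((z 0 k - p 0 k) / (q 0 k - p 0 k))); rewrite segE; last by field.
  have /eqP : (q 0 k - p 0 k) * (z 0 j - p 0 j) = 0 by move: crz; rewrite qpj; lra.
  rewrite mulf_eq0 (negPf qpk) /= => /eqP zj.
  have -> : q 0 j = p 0 j by lra.
  by lra.
apply: (main ((z 0 j - p 0 j) / (q 0 j - p 0 j))); rewrite segE; first by field.
set d := _ / _; have dE : d * (q 0 j - p 0 j) = z 0 j - p 0 j by rewrite divfK.
by apply: (mulfI qpj); have := congr1 ( *%R (q 0 k - p 0 k)) dE; lra.
Qed.

(** The boundary of the convex disc [sqnorm <= r] in the face [i]: its points are on the sphere or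
    on an edge of the face. *)
Definition bpt (R : realType) (i : 'I_4) (r : R) (z : 'rV[R]_4) : Prop :=
  [/\ face i z, sqnorm z <= r & sqnorm z = r \/ exists2 l, l != i & z 0 l = 0].

(** Excluding a common edge puts the open segment into the interior of the disc. *)
Definition chord (R : realType) (i : 'I_4) (r : R) (p q : 'rV[R]_4) : Prop :=
  [/\ bpt i r p, bpt i r q, p != q & forall l, l != i -> p 0 l = 0 -> q 0 l <> 0].

Lemma chord_sym (R : realType) (i : 'I_4) (r : R) (p q : 'rV[R]_4) :
  chord i r p q -> chord i r q p.
Proof.
move=> [bp bq pq pq0]; split=> //; first by rewrite eq_sym.
by move=> l li ql pl; apply: (pq0 l).
Qed.

(** Otherwise [q] would be strictly between [p] and [z]: then it is strictly inside the sphere, and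
    any edge containing it contains [p] as well. *)
Lemma chord_beyond (R : realType) (i : 'I_4) (r : R) (p q z : 'rV[R]_4) (t : R) :
  chord i r p q -> face i z -> sqnorm z <= r -> z = seg p q t -> t <= 1.
Proof.
move=> [[fp pr _] [fq qr qb] pq pq0] fz zr zE; rewrite leNgt; apply/negP => t1.
have t0 : t != 0 by lra.
have pz : p != z.
  by rewrite zE -{1}(seg0 p q); apply: contra_neq t0 => /(seg_inj pq) ->.
have qE : q = seg p z t^-1.
  by have := seg_seg p q 0 t t^-1; rewrite seg0 -zE subr0 add0r mulVf // seg1 => ->.
have t'01 : 0 < t^-1 < 1 by rewrite invr_gt0 invf_lt1; lra.
case: qb => [qr'|[l li ql]].
  by have := sqnorm_seg_lt pz t'01 pr zr; rewrite -qE qr' ltxx.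
rewrite qE in ql; have [pl _] := seg_eq0 (proj1 fp) (proj1 fz) t'01 ql.
by apply: (pq0 l li pl); rewrite qE.
Qed.

Lemma line_in_chord (R : realType) (i : 'I_4) (r : R) (p q z : 'rV[R]_4) :
  chord i r p q -> face i z -> sqnorm z <= r -> cr i p q z = 0 ->
  exists2 t, 0 <= t <= 1 & z = seg p q t.
Proof.
move=> pqc fz zr crz; have [[fp _ _] [fq _ _] pq _] := pqc.
have [t zE] := collinear fp fq fz pq crz; exists t => //.
rewrite (chord_beyond pqc fz zr zE) andbT.
rewrite seg_sym in zE.
by have := chord_beyond (chord_sym pqc) fz zr zE; lra.
Qed.

(** A line that does not run along an edge meets the boundary of the disc in at most two points. *)
Lemma cr_neq0 (R : realType) (i : 'I_4) (r : R) (p q z : 'rV[R]_4) :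
  chord i r p q -> bpt i r z -> z != p -> z != q -> cr i p q z != 0.
Proof.
move=> pqc [fz zr zb] zp zq; apply/eqP => crz.
have [t t01 zE] := line_in_chord pqc fz zr crz.
have [[fp pr _] [fq qr _] pq pq0] := pqc.
have {}t01 : 0 < t < 1.
  rewrite !lt_neqAle; case/andP: t01 => -> ->; rewrite !andbT; apply/andP; split.
    by apply: contra_neq zp => t0; rewrite zE -t0 seg0.
  by apply: contra_neq zq => t0; rewrite zE t0 seg1.
case: zb => [zr'|[l li zl]].
  by have := sqnorm_seg_lt pq t01 pr qr; rewrite -zE zr' ltxx.
rewrite zE in zl; have [pl] := seg_eq0 (proj1 fp) (proj1 fq) t01 zl.
exact: pq0.
Qed.

Lemma cross_chord (R : realType) (i : 'I_4) (r : R) (p q z1 z2 : 'rV[R]_4) :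
  chord i r p q -> face i z1 -> face i z2 -> sqnorm z1 <= r -> sqnorm z2 <= r ->
  cr i p q z1 * cr i p q z2 < 0 ->
  exists t u, [/\ 0 <= t <= 1, 0 < u < 1 & seg p q t = seg z1 z2 u].
Proof.
move=> pqc f1 f2 r1 r2; set c1 := cr _ _ _ z1; set c2 := cr _ _ _ z2 => c12.
have d0 : c1 - c2 != 0 by apply/eqP; nra.
pose u := c1 / (c1 - c2).
have u01 : 0 < u < 1.
  have uE : u * (c1 - c2) = c1 by rewrite divfK.
  by nra.
have u01' : 0 <= u <= 1 by lra.
have cru : cr i p q (seg z1 z2 u) = 0 by rewrite cr_seg -/c1 -/c2 /u; field.
have [t t01 tE] := line_in_chord pqc (seg_face f1 f2 u01') (sqnorm_seg_le u01' r1 r2) cru.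
by exists t, u; split.
Qed.

(** The determinant vanishes on the line of [p] and [q], but it is affine from [z1] to [z2] and has
    the same strict sign at both. *)
Lemma same_side_disjoint (R : realType) (i : 'I_4) (p q z1 z2 : 'rV[R]_4) (t u : R) :
  0 < cr i p q z1 * cr i p q z2 -> 0 <= u <= 1 -> seg p q t <> seg z1 z2 u.
Proof.
move=> c12 /andP[u0 u1] E; have := cr_chord i p q t; rewrite E cr_seg.
move: c12; set c1 := cr _ _ _ z1; set c2 := cr _ _ _ z2 => c12 c0.
have : 0 <= (1 - u) * (c1 * c1) by rewrite mulr_ge0 ?subr_ge0 // -expr2 sqr_ge0.
have : 0 <= u * (c1 * c2) by rewrite mulr_ge0 // ltW.
have := congr1 ( *%R c1) c0; have := congr1 ( *%R c2) c0.
have : 0 < c1 * c1 by rewrite -expr2 lt0r sqr_ge0 sqrf_eq0 andbT; apply/eqP; nra.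
by nra.
Qed.

(* Whether the segments [p, q] and [z1, z2] cross can only change when one of the
   determinants vanishes. *)
Lemma disjoint_chords_sign (R : realType) (i : 'I_4) (r : R) (p q z1 z2 : 'rV[R]_4) :
  chord i r p q -> bpt i r z1 -> bpt i r z2 ->
  z1 != p -> z1 != q -> z2 != p -> z2 != q ->
  (forall t u, 0 <= t <= 1 -> 0 < u < 1 -> seg p q t <> seg z1 z2 u) ->
  0 < cr i p q z1 * cr i p q z2.
Proof.
move=> pqc b1 b2 z1p z1q z2p z2q dis.
rewrite lt0r mulf_neq0 ?(cr_neq0 pqc) //=; apply: contrapT => /negP.
rewrite -ltNge => c12; case: b1 b2 => [f1 r1 _] [f2 r2 _].
have [t [u [t01 u01 E]]] := cross_chord pqc f1 f2 r1 r2 c12.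
exact: dis t01 u01 E.
Qed.

(** * Normal isotopies *)

Lemma cts_comp (T U V : topologicalType) (f : T -> U) (g : U -> V) :
  continuous f -> continuous g -> continuous (fun x => g (f x)).
Proof. by move=> cf cg x; apply: continuous_comp; [exact: cf | exact: cg]. Qed.

Lemma cts_pair (T U V : topologicalType) (f : T -> U) (g : T -> V) :
  continuous f -> continuous g -> continuous (fun x => (f x, g x)).
Proof. by move=> cf cg x; exact: (cvg_pair (cf x) (cg x)). Qed.

Lemma cts_fst (U V : topologicalType) : continuous (@fst U V).
Proof. by move=> x; exact: cvg_fst. Qed.

Lemma cts_snd (U V : topologicalType) : continuous (@snd U V).
Proof. by move=> x; exact: cvg_snd. Qed.

Lemma cts_cst (T U : topologicalType) (u : U) : continuous (fun _ : T => u).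
Proof. by move=> x; exact: cvg_cst. Qed.

Lemma cts_id (T : topologicalType) : continuous (fun x : T => x).
Proof. by move=> x; exact: cvg_id. Qed.

Section ContinuousOperations.
Variables (R : realType) (T : topologicalType).

Lemma cts_max (f g : T -> R) :
  continuous f -> continuous g -> continuous (fun x => Num.max (f x) (g x)).
Proof.
by move=> cf cg; exact: (cts_comp (cts_pair cf cg) (@max_continuous _ R)).
Qed.

Lemma cts_min (f g : T -> R) :
  continuous f -> continuous g -> continuous (fun x => Num.min (f x) (g x)).
Proof.
by move=> cf cg; exact: (cts_comp (cts_pair cf cg) (@min_continuous _ R)).
Qed.

Lemma cts_add (V : normedModType R) (f g : T -> V) :
  continuous f -> continuous g -> continuous (fun x => f x + g x).
Proof. by move=> cf cg x; exact: (cvgD (cf x) (cg x)). Qed.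

Lemma cts_sub (V : normedModType R) (f g : T -> V) :
  continuous f -> continuous g -> continuous (fun x => f x - g x).
Proof. by move=> cf cg x; exact: (cvgB (cf x) (cg x)). Qed.

Lemma cts_scale (V : normedModType R) (k : T -> R) (f : T -> V) :
  continuous k -> continuous f -> continuous (fun x => k x *: f x).
Proof. by move=> ck cf x; exact: (cvgZ (ck x) (cf x)). Qed.

Lemma cts_mul (f g : T -> R) :
  continuous f -> continuous g -> continuous (fun x => f x * g x).
Proof. by move=> cf cg x; exact: (cvgM (cf x) (cg x)). Qed.

Lemma cts_addR (f g : T -> R) :
  continuous f -> continuous g -> continuous (fun x => f x + g x).
Proof. by move=> cf cg x; exact: (@cvgD _ R^o _ _ _ _ _ _ _ (cf x) (cg x)). Qed.

Lemma cts_subR (f g : T -> R) :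
  continuous f -> continuous g -> continuous (fun x => f x - g x).
Proof. by move=> cf cg x; exact: (@cvgB _ R^o _ _ _ _ _ _ _ (cf x) (cg x)). Qed.

Lemma cts_coord (f : T -> 'rV[R]_4) (l : 'I_4) :
  continuous f -> continuous (fun x => f x 0 l).
Proof. by move=> cf; exact: (cts_comp cf (@coord_continuous R 1 4 0 l)). Qed.

Lemma cts_seg (f g : T -> 'rV[R]_4) (k : T -> R) :
  continuous f -> continuous g -> continuous k ->
  continuous (fun x => seg (f x) (g x) (k x)).
Proof.
move=> cf cg ck; apply: (@cts_add 'rV[R]_4) => //; apply: cts_scale => //.
exact: (@cts_sub 'rV[R]_4).
Qed.

Lemma cts_sqnorm (f : T -> 'rV[R]_4) : continuous f -> continuous (fun x => sqnorm (f x)).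
Proof.
move=> cf.
have -> : (fun x => sqnorm (f x)) = (fun x => f x 0 ord0 * f x 0 ord0 +
    (f x 0 (lift ord0 ord0) * f x 0 (lift ord0 ord0) +
    (f x 0 (lift ord0 (lift ord0 ord0)) * f x 0 (lift ord0 (lift ord0 ord0)) +
     f x 0 (lift ord0 (lift ord0 (lift ord0 ord0))) *
     f x 0 (lift ord0 (lift ord0 (lift ord0 ord0)))))).
  by apply/funext => x; rewrite /sqnorm !big_ord_recl big_ord0 addr0 -!expr2.
by do !apply: cts_addR; apply: cts_mul; apply: cts_coord.
Qed.

Lemma cts_cr (i : 'I_4) (f g h : T -> 'rV[R]_4) :
  continuous f -> continuous g -> continuous h ->
  continuous (fun x => cr i (f x) (g x) (h x)).
Proof.
move=> cf cg ch; apply: cts_subR; apply: cts_mul; apply: cts_subR; exact: cts_coord.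
Qed.

End ContinuousOperations.

Lemma within_comp (X Y Z : topologicalType) (A : set X) (B : set Y)
    (f : X -> Y) (g : Y -> Z) :
  {within A, continuous f} -> (forall x, A x -> B (f x)) ->
  {within B, continuous g} -> {within A, continuous (g \o f)}.
Proof.
move=> /subspace_continuousP cf AB /subspace_continuousP cg.
apply/subspace_continuousP => x Ax.
apply: (@cvg_comp _ _ _ f g _ (within B (nbhs (f x)))); last exact: cg (AB _ Ax).
move=> P; rewrite !nbhs_simpl /within /= => PB.
have := cf x Ax _ PB; rewrite nbhs_simpl /within /= => near_x.
apply: (@filterS _ (nbhs x) _ _ _ _ near_x) => y yP Ay.
by apply: yP => //; apply: AB.
Qed.

(** A pasting lemma: [A] is covered by finitely many images of a compact set, so the preimage of a
    closed set under [G] is, within [A], a finite union of compact images, which are closed. *)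
Lemma continuous_on_images (X Y Z : topologicalType) (I : finType) (J : {set I})
    (K : set X) (Q : I -> X -> Y) (G : Y -> Z) (H : I -> X -> Z) (A : set Y) :
  hausdorff_space Y -> compact K ->
  (forall i, i \in J -> {within K, continuous (Q i)}) ->
  (forall i, i \in J -> {within K, continuous (H i)}) ->
  (forall i x, i \in J -> K x -> A (Q i x) /\ G (Q i x) = H i x) ->
  (forall y, A y -> exists i x, [/\ i \in J, K x & Q i x = y]) ->
  {within A, continuous G}.
Proof.
move=> hY cK cQ cH QH AQ; apply/continuous_closedP => D cD.
apply/closed_subspaceP.
exists (\bigcup_(i in [set` J]) (Q i @` (K `&` H i @^-1` D))).
  apply: closed_bigcup => [|i iJ]; first exact: finite_finset.
  apply: compact_closed => //; apply: continuous_compact.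
    by apply: continuous_subspaceW (cQ i iJ) => x [].
  have [V cV VE] : exists2 V : set X, closed V & V `&` K = H i @^-1` D `&` K.
    by apply/closed_subspaceP; have /continuous_closedP := cH i iJ; apply.
  by rewrite setIC -VE setIC; apply: compact_closedI.
apply/seteqP; split => y [].
  move=> [i iJ [x [Kx Dx] <-]] Ay; split=> //.
  by have [_ E] := QH i x iJ Kx; rewrite /preimage /from_subspace /= E.
move=> Dy Ay; split=> //; have [i [x [iJ Kx xy]]] := AQ y Ay.
exists i => //; exists x => //; split=> //.
by have [_ E] := QH i x iJ Kx; rewrite /preimage /from_subspace /= -E xy.
Qed.

Definition iso (R : realType) (L L' : set 'rV[R]_4) : Prop :=
  exists2 h, normal_isotopy L h & h 1 @` L = L'.

(** Two loops are compared by going from one to a straight model and back from a straight model to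
    the other, so both directions are recorded. *)
Definition isoS (R : realType) (L L' : set 'rV[R]_4) : Prop := iso L L' /\ iso L' L.

Definition img (R : realType) (I : finType) (J : {set I}) (a : I -> R -> 'rV[R]_4) :
    set 'rV[R]_4 :=
  [set x | exists (i : I) (t : R), [/\ i \in J, 0 <= t <= 1 & a i t = x]].

(** Coincidences at time 0 persisting makes the motion of a point independent of the path and
    parameter chosen through it; the converse makes the motion injective. *)
Lemma iso_family (R : realType) (I : finType) (J : {set I})
    (H : R -> I -> R -> 'rV[R]_4) :
  (forall i, i \in J -> continuous (fun z : R * R => H z.1 i z.2)) ->
  (forall (s : R) (i j : I) (t u : R), 0 <= s <= 1 -> i \in J -> j \in J -> 0 <= t <= 1 ->
    0 <= u <= 1 ->
     H s i t = H s j u <-> H 0 i t = H 0 j u) ->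
  (forall (s : R) (i : I) (t : R), 0 <= s <= 1 -> i \in J -> 0 <= t <= 1 ->
     simplex (H s i t) /\ same_open_face (H 0 i t) (H s i t)) ->
  iso (img J (H 0)) (img J (H 1)).
Proof.
move=> cH pat Hface.
have r01 : 0 <= (0 : R) <= 1 by rewrite lexx ler01.
have r11 : 0 <= (1 : R) <= 1 by rewrite lexx ler01.
pose P x (w : I * R) := [/\ w.1 \in J, 0 <= w.2 <= 1 & H 0 w.1 w.2 = x].
pose h s x := if pselect (exists w, P x w) is left e
  then let w := projT1 (cid e) in H s w.1 w.2 else x.
have hE s i t : 0 <= s <= 1 -> i \in J -> 0 <= t <= 1 -> h s (H 0 i t) = H s i t.
  move=> s01 iJ t01; rewrite /h; case: pselect => [e|[]]; last by exists (i, t).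
  by case: (cid e) => -[j u] [/= jJ u01 E]; apply/pat.
exists h.
  split=> [|x [i [t [iJ t01 <-]]]|s x y s01 [i [t [iJ t01 <-]]] [j [u [jJ u01 <-]]]|
           s x s01 [i [t [iJ t01 <-]]]]; last 3 first.
  - by rewrite hE.
  - by rewrite !hE // => /pat; apply.
  - by rewrite hE //; apply: Hface.
  pose K : set (R * R) := `[0, 1]%classic `*` `[0, 1]%classic.
  apply: (@continuous_on_images (R * R)%type _ _ I J K
    (fun i z => (z.1, H 0 i z.2)) _ (fun i z => H z.1 i z.2)).
  - exact: (@norm_hausdorff _ (R * 'rV[R]_4)%type).
  - by apply: compact_setX; apply: segment_compact.
  - move=> i iJ; apply: continuous_subspaceT; apply: cts_pair; first exact: cts_fst.
    apply: (@cts_comp _ _ _ (fun z : R * R => ((0 : R), z.2))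
      (fun z : R * R => H z.1 i z.2)); last exact: cH.
    by apply: cts_pair; [exact: cts_cst | exact: cts_snd].
  - by move=> i iJ; apply: continuous_subspaceT; apply: cH.
  - move=> i [s t] iJ [/=]; rewrite !in_itv /= => s01 t01; split; last by rewrite hE.
    by split=> //; exists i, t.
  - move=> [s x] [/= s01 [i [t [iJ t01 <-]]]]; exists i, (s, t); split=> //.
apply/seteqP; split=> x.
  by move=> [_ [i [t [iJ t01 <-]]] <-]; exists i, t; split=> //; rewrite hE.
move=> [i [t [iJ t01 <-]]]; exists (H 0 i t); first by exists i, t.
by rewrite hE.
Qed.

Lemma isoS_family (R : realType) (I : finType) (J : {set I})
    (H : R -> I -> R -> 'rV[R]_4) :
  (forall i, i \in J -> continuous (fun z : R * R => H z.1 i z.2)) ->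
  (forall (s : R) (i j : I) (t u : R), 0 <= s <= 1 -> i \in J -> j \in J -> 0 <= t <= 1 ->
    0 <= u <= 1 ->
     H s i t = H s j u <-> H 0 i t = H 0 j u) ->
  (forall (s : R) (i : I) (t : R), 0 <= s <= 1 -> i \in J -> 0 <= t <= 1 ->
     simplex (H s i t) /\ same_open_face (H 0 i t) (H s i t)) ->
  isoS (img J (H 0)) (img J (H 1)).
Proof.
move=> cH pat Hface; split; first exact: iso_family.
have E0 : H 1 = (fun s => H (1 - s)) 0 by rewrite subr0.
have E1 : H 0 = (fun s => H (1 - s)) 1 by rewrite subrr.
have flip (s : R) : 0 <= s <= 1 -> 0 <= 1 - s <= 1 by lra.
rewrite E0 E1; apply: (@iso_family _ I J (fun s => H (1 - s)))
  => [i iJ|s i j t u s01 iJ jJ t01 u01|s i t s01 iJ t01].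
- apply: (@cts_comp _ _ _ (fun z : R * R => (1 - z.1, z.2))
    (fun z : R * R => H z.1 i z.2)); last exact: cH.
  apply: cts_pair; last exact: cts_snd.
  by apply: cts_subR; [exact: cts_cst | exact: cts_fst].
- by rewrite subr0 !pat ?flip ?lexx ?ler01 //; lra.
- have [k1 f1] := Hface (1 - s) i t (flip _ s01) iJ t01.
  have r11 : 0 <= (1 : R) <= 1 by rewrite lexx ler01.
  have [_ f2] := Hface 1 i t r11 iJ t01.
  by split=> // l; rewrite subr0 -f2 -f1.
Qed.

(** The two halves of the time interval are pasted along closed slabs, which is where [L] has to be
    closed. *)
Lemma normal_isotopy_trans (R : realType) (L : set 'rV[R]_4)
    (h k : R -> 'rV[R]_4 -> 'rV[R]_4) :
  closed L -> normal_isotopy L h -> normal_isotopy (h 1 @` L) k ->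
  exists2 e, normal_isotopy L e & e 1 @` L = k 1 @` (h 1 @` L).
Proof.
move=> cL [ch h0 hinj hface] [ck k0 kinj kface].
have r11 : 0 <= (1 : R) <= 1 by rewrite lexx ler01.
pose e (s : R) x := if s <= 2^-1 then h (2 * s) x else k (2 * s - 1) (h 1 x).
have e1 (s : R) x : s <= 2^-1 -> e s x = h (2 * s) x by rewrite /e => ->.
have e2 (s : R) x : L x -> 2^-1 <= s -> e s x = k (2 * s - 1) (h 1 x).
  rewrite le_eqVlt /e => Lx /predU1P[<-|lt_s]; last by rewrite leNgt lt_s.
  by rewrite lexx divff ?pnatr_eq0 // subrr k0 //; exists x.
have half : 0 < 2^-1 :> R by rewrite invr_gt0 ltr0n.
have half2 : 2 * 2^-1 = 1 :> R by rewrite divff ?pnatr_eq0.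
exists e; last first.
  rewrite image_comp; apply/seteqP; split=> _ [x Lx <-]; exists x => //=.
    by rewrite e2 //; [congr (k _ _); lra | lra].
  by rewrite e2 //; [congr (k _ _); lra | lra].
split=> [|x Lx|s x y|s x].
- pose A1 := [set z : R * 'rV[R]_4 | 0 <= z.1 <= 2^-1 /\ L z.2].
  pose A2 := [set z : R * 'rV[R]_4 | 2^-1 <= z.1 <= 1 /\ L z.2].
  have scale_cts (a b : R) : continuous (fun z : R * 'rV[R]_4 => a * z.1 + b).
    apply: cts_addR; last exact: cts_cst.
    by apply: cts_mul; [exact: cts_cst | exact: cts_fst].
  have ce1 : {within A1, continuous (fun z : R * 'rV[R]_4 => e z.1 z.2)}.
    apply: (@subspace_eq_continuous _ A1 _
      ((fun z => h z.1 z.2) \o (fun z : R * 'rV[R]_4 => (2 * z.1 + 0, z.2)))).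
      by move=> z /set_mem[/andP[_ z1] _]; rewrite /= /from_subspace /= e1 ?addr0.
    apply: (within_comp _ _ ch).
      apply: continuous_subspaceT; apply: cts_pair; last exact: cts_snd.
      exact: scale_cts.
    by move=> z [/andP[z0 z1] Lz]; split=> //=; lra.
  have ce2 : {within A2, continuous (fun z : R * 'rV[R]_4 => e z.1 z.2)}.
    apply: (@subspace_eq_continuous _ A2 _
      ((fun z => k z.1 z.2) \o (fun z : R * 'rV[R]_4 => (2 * z.1 + -1, h 1 z.2)))).
      by move=> z /set_mem[/andP[z0 _] Lz]; rewrite /= /from_subspace /= e2.
    apply: (within_comp _ _ ck).
      apply: (@cts_pair (subspace A2)).
        exact: (continuous_subspaceT (scale_cts 2 (-1))).
      have : {within A2, continuous ((fun z => h z.1 z.2) \o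
          (fun z : R * 'rV[R]_4 => ((1 : R), z.2)))}.
        apply: (within_comp _ _ ch).
          apply: continuous_subspaceT; apply: cts_pair; last exact: cts_snd.
          exact: cts_cst.
        by move=> w [_ Lw].
      exact.
    by move=> z [/andP[z0 z1] Lz]; split=> //=; [lra | exists z.2].
  have closed_slab (a b : R) : closed [set z : R * 'rV[R]_4 | a <= z.1 <= b /\ L z.2].
    have -> : [set z : R * 'rV[R]_4 | a <= z.1 <= b /\ L z.2] =
        (@fst R 'rV[R]_4) @^-1` `[a, b]%classic `&` (@snd R 'rV[R]_4) @^-1` L.
      by apply/seteqP; split=> z /=; rewrite in_itv.
    apply: closedI.
      have cab : closed `[a, b]%classic by exact: interval_closed.
      by have /continuous_closedP cf := @cts_fst R 'rV[R]_4; exact: cf.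
    by have /continuous_closedP cf := @cts_snd R 'rV[R]_4; exact: cf.
  have -> : [set z : R * 'rV[R]_4 | 0 <= z.1 <= 1 /\ L z.2] = A1 `|` A2.
    apply/seteqP; split=> z /=; last first.
      by move=> [] [/andP[z0 z1] Lz]; split=> //; lra.
    move=> [/andP[z0 z1] Lz]; have [z2|z2] := leP z.1 2^-1; [left|right];
    by split=> //; lra.
  by apply: withinU_continuous => //; apply: closed_slab.
- by rewrite e1 ?mulr0 ?h0 // ltW.
- move=> /andP[s0 s1] Lx Ly; have [s2|s2] := leP s 2^-1.
    by rewrite !e1 //; apply: hinj => //; lra.
  rewrite !e2 ?(ltW s2) // => /kinj E; apply: (hinj 1) => //.
  by apply: E; [lra | exists x | exists y].
- move=> /andP[s0 s1] Lx; have [s2|s2] := leP s 2^-1.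
    by rewrite !e1 //; apply: hface => //; lra.
  rewrite e2 ?(ltW s2) //; have s' : 0 <= 2 * s - 1 <= 1 by lra.
  have [] := kface _ (h 1 x) s'; first by exists x.
  move=> sk fk; split=> // l; rewrite -fk.
  by have [_] := hface 1 x r11 Lx; apply.
Qed.

(** [A r] is the inverse of [f] on [[0, b]] applied to [r] clamped between [f b] and [f 0]; clamping
    makes it continuous for all levels. *)
Lemma strictly_decreasing_levels (R : realType) (f : R -> R) (b : R) :
  continuous f -> 0 <= b ->
  (forall x y : R, 0 <= x -> x < y -> y <= b -> f y < f x) ->
  exists A : R -> R, continuous A /\ forall r,
  [/\ 0 <= A r <= b,
      forall t : R, 0 <= t -> t < A r -> r < f t,
      f b <= r -> forall t : R, A r <= t <= b -> f t <= r,
      f b <= r -> 0 < A r -> f (A r) = r &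
      (r <= f b -> A r = b) /\ (f b < r -> 0 < b -> A r < b)].
Proof.
move=> cf b0 fdec.
have fdecW x y : 0 <= x -> x <= y -> y <= b -> f y <= f x.
  by move=> x0; rewrite le_eqVlt => /predU1P[->//|xy] yb; apply/ltW/fdec.
have f_inj : {in `[0, b] &, injective f}.
  move=> x y; rewrite !in_itv /= => /andP[x0 xb] /andP[y0 yb] fxy.
  by apply/eqP; rewrite eq_le !leNgt; apply/andP; split; apply/negP => /fdec;
    [move/(_ y0 xb)|move/(_ x0 yb)]; rewrite fxy ltxx.
have surj y : f b <= y <= f 0 -> exists2 t, 0 <= t <= b & f t = y.
  move=> /andP[y0 y1]; have [t tb ft] : exists2 t, t \in `[0, b] & f t = y.
    apply: IVT => //; first exact: continuous_subspaceT.
    by rewrite min_r ?max_l ?y0 ?y1 // fdecW.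
  by exists t; rewrite // in_itv in tb.
have fb0 : f b <= f 0 by apply: fdecW.
pose g y := if pselect (exists2 t, 0 <= t <= b & f t = y) is left e
  then projT1 (cid2 e) else 0.
have gP y : f b <= y <= f 0 -> 0 <= g y <= b /\ f (g y) = y.
  move=> /surj e; rewrite /g; case: pselect => // e'.
  by case: (cid2 e').
have fK : {in `[0, b], cancel f g}.
  move=> t tb; have tb' : 0 <= t <= b by rewrite in_itv in tb.
  have [gb fg] : 0 <= g (f t) <= b /\ f (g (f t)) = f t.
    by apply: gP; case/andP: tb' => t0 t1; rewrite !fdecW.
  by apply: f_inj; rewrite ?in_itv.
pose c r := Num.max (f b) (Num.min r (f 0)).
have c_cont : continuous c.
  by apply: cts_max; [exact: cts_cst | apply: cts_min; [exact: cts_id | exact: cts_cst]].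
have cP r : f b <= c r <= f 0 by rewrite /c le_max ge_max lexx fb0 ge_min lexx orbT.
exists (g \o c); split.
  have : {within setT, continuous (g \o c)}.
    apply: (@within_comp _ _ _ _ (f @`[0, b])%classic).
    - exact: continuous_subspaceT.
    - move=> r _; rewrite /= in_itv /=; have /andP[c0 c1] := cP r.
      by rewrite min_r // max_l // c0.
    - by apply: segment_can_continuous => //; exact: continuous_subspaceT.
  by move=> cgc; apply/continuous_subspace_setT.
move=> r /=; have [gcb fgc] := gP _ (cP r); have /andP[g0 gb] := gcb.
have cr : f b <= r -> c r <= r by move=> br; rewrite /c ge_max br ge_min lexx.
split=> //.
- move=> t t0 tg; have : c r < f t by rewrite -fgc; apply: fdec.
  rewrite /c gt_max => /andP[_]; rewrite gt_min => /orP[//|].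
  by rewrite ltNge fdecW // (le_trans (ltW tg)).
- by move=> br t /andP[gt tb]; apply: le_trans (cr br); rewrite -fgc; apply: fdecW.
- move=> br gpos; rewrite fgc; apply/eqP; rewrite eq_le cr //= /c le_max; apply/orP; right.
  rewrite le_min lexx /= leNgt; apply/negP => lt0r.
  have : f (g (c r)) < f 0 by apply: fdec.
  by rewrite fgc /c min_r ?(ltW lt0r) // max_r // ltxx.
- split=> [rb|br bpos].
    have cb : c r = f b by rewrite /c max_l // ge_min rb.
    by apply: f_inj; rewrite ?in_itv /= ?g0 ?b0 ?lexx // fgc cb.
  rewrite lt_neqAle gb andbT; apply/eqP => gE; move: fgc; rewrite gE => /eqP.
  have f0b : f b < f 0 by apply: fdec.
  by apply/negP; rewrite lt_eqF // /c lt_max lt_min br f0b orbT.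
Qed.

(** * Systems of quasi-convex paths *)

(** Strict quasi-convexity: a continuous such function strictly decreases to a unique minimum and
    then strictly increases, so that its sublevel intervals vary continuously with the level. *)
Definition sqc (R : realType) (f : R -> R) : Prop :=
  forall x y z : R, 0 <= x -> x < y -> y < z -> z <= 1 -> f y < f x \/ f y < f z.

(* [A r, B r] is the sublevel interval {f <= r} of a function f with minimum at b;
   it degenerates to {b} for r below the minimum. *)
Record levels (R : realType) (f : R -> R) (b : R) (A B : R -> R) : Prop := Levels {
  lv_b : 0 <= b <= 1;
  lv_min : forall t : R, 0 <= t <= 1 -> f b <= f t;
  lv_ctsA : continuous A;
  lv_ctsB : continuous B;
  lv_A : forall r, 0 <= A r <= b;
  lv_B : forall r, b <= B r <= 1;
  lv_out : forall r t : R, 0 <= t <= 1 -> t < A r \/ B r < t -> r < f t;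
  lv_in : forall r t : R, f b <= r -> A r <= t <= B r -> f t <= r;
  lv_eqA : forall r, f b <= r -> 0 < A r -> f (A r) = r;
  lv_eqB : forall r, f b <= r -> B r < 1 -> f (B r) = r;
  lv_low : forall r : R, r <= f b -> A r = b /\ B r = b;
  lv_lt : forall r, f b < r -> A r < B r
}.

Lemma sqc_levels (R : realType) (f : R -> R) :
  continuous f -> sqc f -> exists b A B, levels f b A B.
Proof.
move=> cf fq.
have [b b01 bmin] : exists2 b : R, b \in `[0, 1] & forall t : R, t \in `[0, 1] -> f b <= f t.
  by apply: EVT_min; [exact: ler01 | exact: continuous_subspaceT].
have {}bmin (t : R) : 0 <= t <= 1 -> f b <= f t by move=> t01; apply: bmin; rewrite in_itv.
have {b01} /andP[b0 b1] : 0 <= b <= 1 by rewrite in_itv in b01.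
have bmin' (t : R) : 0 <= t <= 1 -> t != b -> f b < f t.
  move=> t01 tb; rewrite lt_neqAle bmin // andbT; apply/eqP => ftb.
  have /andP[t0 t1] := t01.
  case: (ltgtP t b) tb => // tb _.
    have m01 : 0 <= (t + b) / 2 <= 1 by lra.
    have := bmin _ m01; have := fq t ((t + b) / 2) b; lra.
  have m01 : 0 <= (t + b) / 2 <= 1 by lra.
  have := bmin _ m01; have := fq b ((t + b) / 2) t; lra.
have dec (x y : R) : 0 <= x -> x < y -> y <= b -> f y < f x.
  move=> x0 xy yb; have [yb'|yb'] := eqVneq y b.
    by rewrite yb' in xy *; apply: bmin'; [lra | rewrite lt_eqF].
  have {}yb : y < b by rewrite lt_neqAle yb'.
  have := bmin y; have := fq x y b; lra.
have inc (x y : R) : b <= x -> x < y -> y <= 1 -> f x < f y.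
  rewrite le_eqVlt => /predU1P[<-|bx] xy y1.
    by apply: bmin'; [lra | rewrite gt_eqF].
  have := bmin x; have := fq b x y; lra.
have [A [cA AP]] := strictly_decreasing_levels cf b0 dec.
(* The increasing half is treated as the decreasing half of the reversed function. *)
have cf' : continuous (fun t : R => f (1 - t)).
  by apply: cts_comp => //; apply: cts_subR; [exact: cts_cst | exact: cts_id].
have b0' : 0 <= 1 - b by lra.
have dec' (x y : R) : 0 <= x -> x < y -> y <= 1 - b -> f (1 - y) < f (1 - x).
  by move=> x0 xy yb; apply: inc; lra.
have [A' [cA' AP']] := strictly_decreasing_levels cf' b0' dec'.
have bb : 1 - (1 - b) = b by lra.
exists b, A, (fun r => 1 - A' r); split=> //; rewrite ?b0 ?b1 //.
- by apply: cts_subR => //; exact: cts_cst.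
- by move=> r; have [] := AP r.
- by move=> r; have [+ _ _ _ _] := AP' r; lra.
- move=> r t /andP[t0 t1] [tA|tB]; first by have [_ + _ _ _] := AP r; apply.
  have [_ + _ _ _] := AP' r => /(_ (1 - t)); have -> : 1 - (1 - t) = t by lra.
  by apply; lra.
- move=> r t br /andP[tA tB]; have [tb|tb] := leP t b.
    by have [_ _ /(_ br t) + _ _] := AP r; apply; rewrite tA.
  have [_ _ + _ _] := AP' r; rewrite bb => /(_ br (1 - t)).
  have -> : 1 - (1 - t) = t by lra.
  by apply; lra.
- by move=> r br; have [_ _ _ + _] := AP r; apply.
- by move=> r br B1; have [_ _ _ + _] := AP' r; rewrite bb; apply=> //; lra.
- move=> r rb; have [_ _ _ _ [/(_ rb) -> _]] := AP r.
  by have [_ _ _ _ [+ _]] := AP' r; rewrite bb => /(_ rb) ->; lra.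
- move=> r br; have [+ _ _ _ [_ +]] := AP r; have [+ _ _ _ [_ +]] := AP' r.
  by rewrite bb => h1 h2 h3 h4; have := h2 br; have := h4 br; lra.
Qed.

Lemma seg_sqc (R : realType) (p q : 'rV[R]_4) (x y z : R) : p != q -> x < y -> y < z ->
  sqnorm (seg p q y) < sqnorm (seg p q x) \/ sqnorm (seg p q y) < sqnorm (seg p q z).
Proof.
move=> pq xy yz; apply/orP; rewrite -lt_max.
have xz : x < z by apply: lt_trans yz.
have yE : y = x + (y - x) / (z - x) * (z - x) by field; lra.
rewrite {1}yE -seg_seg; apply: sqnorm_seg_lt; rewrite ?le_max ?lexx ?orbT //.
  by apply/eqP => /(seg_inj pq) E; rewrite E ltxx in xz.
by rewrite divr_gt0 ?subr_gt0 //= ltr_pdivrMr ?subr_gt0 // mul1r ltrD2r.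
Qed.

(* The pieces, indexed by J, of disjoint arcs in the faces: F i is the face, ar i the arc of the
   piece a i.  An endpoint that is not on an edge of the tetrahedron is a junction of
   two consecutive pieces; endpoints are numbered by st and en, increasingly along an arc. *)
Record sys (R : realType) (I : finType) (J : {set I}) (F : I -> 'I_4)
    (ar st en : I -> nat) (a : I -> R -> 'rV[R]_4) : Prop := Sys {
  sys_cts : forall i, i \in J -> continuous (a i);
  sys_face : forall (i : I) (t : R), i \in J -> 0 <= t <= 1 -> face (F i) (a i t);
  sys_int : forall (i : I) (t : R) (l : 'I_4), i \in J -> 0 < t < 1 -> l != F i -> a i t 0 l <> 0;
  sys_edge : forall i j l, i \in J -> j \in J -> ar i = ar j -> l != F i ->
    a i 0 0 l = 0 -> a j 1 0 l <> 0;
  sys_inj : forall (i j : I) (t u : R), i \in J -> j \in J -> F i = F j ->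
    0 <= t <= 1 -> 0 <= u <= 1 -> a i t = a j u ->
    [\/ i = j /\ t = u, [/\ t = 0, u = 1 & st i = en j] |
        [/\ t = 1, u = 0 & en i = st j]];
  sys_lt : forall i, i \in J -> (st i < en i)%N;
  sys_junc : forall i j, i \in J -> j \in J -> en i = st j ->
    [/\ F i = F j, ar i = ar j, a i 1 = a j 0 & forall l, l != F i -> a i 1 0 l <> 0];
  sys_start : forall i, i \in J -> (forall l, l != F i -> a i 0 0 l <> 0) ->
    exists2 j, j \in J & en j = st i;
  sys_end : forall i, i \in J -> (forall l, l != F i -> a i 1 0 l <> 0) ->
    exists2 j, j \in J & en i = st j;
  sys_sqc : forall i, i \in J -> sqc (fun t => sqnorm (a i t))
}.

(** If [A r = B r], the quotient is 0 by convention and the value is still [a t]. *)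
Definition swept (R : realType) (a : R -> 'rV[R]_4) (A B : R -> R) (r t : R) : 'rV[R]_4 :=
  if (A r <= t) && (t <= B r) then seg (a (A r)) (a (B r)) ((t - A r) / (B r - A r))
  else a t.

(** For the levels at which a chord degenerates to a point: the relative position along the chord
    need not converge there, but it is bounded and multiplies a vector tending to 0. *)
Lemma cvg_bounded_scale (R : realType) (T : topologicalType) (x : T)
    (k : T -> R) (v : T -> 'rV[R]_4) :
  (forall y, `|k y| <= 1) -> {for x, continuous v} -> v x = 0 ->
  {for x, continuous (fun y => k y *: v y)}.
Proof.
move=> k1 cv v0; rewrite /prop_for /continuous_at v0 scaler0.
apply/cvgr0Pnorm_lt => e e0.
have := cv; rewrite /prop_for /continuous_at v0 => /cvgr0Pnorm_lt/(_ e e0).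
apply: filterS => y; apply: le_lt_trans; rewrite normrZ.
by rewrite ler_piMl.
Qed.

Lemma swept_cts (R : realType) (a : R -> 'rV[R]_4) (A B : R -> R) :
  continuous a -> continuous A -> continuous B -> (forall r, A r <= B r) ->
  continuous (fun z : R * R => swept a A B z.1 z.2).
Proof.
move=> ca cA cB AB.
pose k (z : R * R) := Num.max (A z.1) (Num.min z.2 (B z.1)).
have ck : continuous k.
  apply: cts_max; first by apply: cts_comp cA; exact: cts_fst.
  by apply: cts_min; [exact: cts_snd | apply: cts_comp cB; exact: cts_fst].
have kAB z : A z.1 <= k z <= B z.1.
  by rewrite /k le_max lexx /= ge_max AB ge_min lexx orbT.
have cA' : continuous (fun z : R * R => A z.1) by apply: cts_comp cA; exact: cts_fst.
have cB' : continuous (fun z : R * R => B z.1) by apply: cts_comp cB; exact: cts_fst.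
have -> : (fun z : R * R => swept a A B z.1 z.2) = (fun z => (a z.2 - a (k z)) + (a (A z.1) +
    ((k z - A z.1) / (B z.1 - A z.1)) *: (a (B z.1) - a (A z.1)))).
  apply/funext => z; rewrite /swept /k; case: ifP => [/andP[zA zB]|].
    by rewrite min_l // max_r // /seg subrr add0r.
  move/negbT; rewrite negb_and -!ltNge => /orP[zA|zB].
    by rewrite min_l ?max_l ?(ltW zA) ?(le_trans (ltW zA)) // subrr mul0r scale0r addr0 subrK.
  rewrite (min_r (ltW zB)) max_r //; have [->|neq] := eqVneq (B z.1) (A z.1).
    by rewrite subrr mul0r scale0r addr0 subrK.
  by rewrite divff ?subr_eq0 // scale1r (addrC (a (A z.1))) !subrK.
apply: (@cts_add R (R * R)%type 'rV[R]_4).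
  apply: (@cts_sub R (R * R)%type 'rV[R]_4); first by apply: cts_comp ca; exact: cts_snd.
  exact: cts_comp ck ca.
apply: (@cts_add R (R * R)%type 'rV[R]_4); first exact: cts_comp cA' ca.
have cd : continuous (fun z : R * R => a (B z.1) - a (A z.1)).
  by apply: (@cts_sub R (R * R)%type 'rV[R]_4); [exact: cts_comp cB' ca | exact: cts_comp cA' ca].
move=> z; have [BA|BA] := eqVneq (B z.1) (A z.1).
  apply: (@cvg_bounded_scale R (R * R)%type z (fun x => (k x - A x.1) / (B x.1 - A x.1))
    (fun x => a (B x.1) - a (A x.1))); [|exact: cd|by rewrite BA subrr].
  move=> y; have /andP[k1 k2] := kAB y.
  have [->|BAy] := eqVneq (B y.1) (A y.1); first by rewrite subrr invr0 mulr0 normr0 ler01.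
  have BA0 : 0 < B y.1 - A y.1 by rewrite subr_gt0 lt_neqAle eq_sym BAy AB.
  rewrite ger0_norm ?divr_ge0 ?subr_ge0 //.
  by rewrite ler_pdivrMr // mul1r lerD2r.
apply: cvgZ; last exact: cd.
apply: cvgM; first exact: (cts_subR ck cA').
apply: cvgV; first by rewrite subr_eq0.
exact: (cts_subR cB' cA').
Qed.

Lemma img_ext (R : realType) (I : finType) (J : {set I}) (a b : I -> R -> 'rV[R]_4) :
  (forall (i : I) (t : R), i \in J -> 0 <= t <= 1 -> a i t = b i t) -> img J a = img J b.
Proof.
by move=> ab; apply/seteqP; split=> x [i [t [iJ t01 <-]]]; exists i, t; split=> //; rewrite ab.
Qed.

(** * Replacing sublevel parts by chords *)

Lemma lt1_absurd (R : realType) (x y : R) : x = 1 -> x < y -> y <= 1 -> False.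
Proof. by move=> -> lt1 /(lt_le_trans lt1); rewrite ltxx. Qed.

Lemma lt0_absurd (R : realType) (x y : R) : y = 0 -> 0 <= x -> x < y -> False.
Proof. by move=> -> x0 /(le_lt_trans x0); rewrite ltxx. Qed.

(** The values are above [r] outside [[x0, x1]] and at most [r] inside, so triples that are not all
    on one side are compared through the level [r]. *)
Lemma sqc_glue (R : realType) (g h : R -> R) (x0 x1 r : R) :
  sqc g -> 0 <= x0 -> x1 <= 1 -> x0 <= x1 ->
  (forall w : R, 0 <= w <= 1 -> w < x0 \/ x1 < w -> r < g w /\ h w = g w) ->
  g x0 <= r -> g x1 <= r -> (forall w : R, x0 <= w <= x1 -> h w <= r) ->
  (forall x y z : R, x0 <= x -> x < y -> y < z -> z <= x1 -> h y < h x \/ h y < h z) ->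
  sqc h.
Proof.
move=> gq x00 x11 x01 out g0 g1 inn hq x y z xge xy yz z1.
have y01 : 0 <= y <= 1 by lra.
have x01' : 0 <= x <= 1 by lra.
have z01 : 0 <= z <= 1 by lra.
have [yA|Ay] := ltP y x0.
  have [ry ->] := out y y01 (or_introl yA).
  have [_ ->] := out x x01' (or_introl (lt_trans xy yA)).
  left; case: (gq x y x0 xge xy yA); [lra | by [] | move=> yA'].
  by have := lt_le_trans yA' g0; rewrite ltNge (ltW ry).
have [By|yB] := ltP x1 y.
  have [ry ->] := out y y01 (or_intror By).
  have [_ ->] := out z z01 (or_intror (lt_trans By yz)).
  right; case: (gq x1 y z _ By yz z1); [lra | move=> yB' | by []].
  by have := lt_le_trans yB' g1; rewrite ltNge (ltW ry).
have yr : h y <= r by apply: inn; rewrite Ay.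
have [xA|Ax] := ltP x x0.
  by left; have [rx ->] := out x x01' (or_introl xA); apply: le_lt_trans rx.
have [Bz|zB] := ltP x1 z.
  by right; have [rz ->] := out z z01 (or_intror Bz); apply: le_lt_trans rz.
exact: hq.
Qed.

Section Sweep.
Variables (R : realType) (I : finType) (J : {set I}) (F : I -> 'I_4).
Variables (ar st en : I -> nat) (a : I -> R -> 'rV[R]_4).
Hypothesis S : sys J F ar st en a.
Variables (b : I -> R) (A B : I -> R -> R).
Hypothesis L : forall i, i \in J -> levels (fun t => sqnorm (a i t)) (b i) (A i) (B i).
Variable r : R.
Hypothesis Hr : forall i j, i \in J -> j \in J -> en i = st j -> r <= sqnorm (a i 1).

Let f i t := sqnorm (a i t).
Let p i (s : R) := a i (A i s).
Let q i (s : R) := a i (B i s).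

Lemma lv01 i (s : R) : i \in J ->
  [/\ 0 <= A i s, A i s <= B i s, B i s <= 1, A i s <= 1 & 0 <= B i s].
Proof. by move=> iJ; have := lv_A (L iJ) s; have := lv_B (L iJ) s; split; lra. Qed.

Lemma face_p i s : i \in J -> face (F i) (p i s).
Proof. by move=> iJ; apply: (sys_face S) => //; have [] := lv01 s iJ; lra. Qed.

Lemma face_q i s : i \in J -> face (F i) (q i s).
Proof. by move=> iJ; apply: (sys_face S) => //; have [] := lv01 s iJ; lra. Qed.

(** An endpoint off the edges is a junction, and junctions are not lower than [r]. Hence sublevel
    chords have their ends on the boundary of the disc. *)
Lemma end_level0 i : i \in J -> r <= f i 0 \/ exists2 l, l != F i & a i 0 0 l = 0.
Proof.
move=> iJ; have [[l li l0]|no] := pselect (exists2 l, l != F i & a i 0 0 l = 0).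
  by right; exists l.
have [|j jJ ej] := sys_start S iJ; first by move=> l li l0; apply: no; exists l.
by left; have [_ _ E _] := sys_junc S jJ iJ ej; rewrite /f -E; apply: Hr ej.
Qed.

Lemma end_level1 i : i \in J -> r <= f i 1 \/ exists2 l, l != F i & a i 1 0 l = 0.
Proof.
move=> iJ; have [[l li l0]|no] := pselect (exists2 l, l != F i & a i 1 0 l = 0).
  by right; exists l.
have [|j jJ ej] := sys_end S iJ; first by move=> l li l0; apply: no; exists l.
by left; apply: Hr ej.
Qed.

Lemma bpt_p i s : i \in J -> s <= r -> f i (b i) <= s -> bpt (F i) s (p i s).
Proof.
move=> iJ sr bs; have [A0 AB B1 A1 B0] := lv01 s iJ.
have ps : f i (A i s) <= s by apply: (lv_in (L iJ)); rewrite // lexx.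
split=> //; first exact: face_p.
have [Apos|] := ltP 0 (A i s); first by left; apply: (lv_eqA (L iJ)).
move=> Ale; have AE : A i s = 0 by lra.
case: (end_level0 iJ) => [r0|]; last by rewrite /p AE; right.
by left; rewrite /p AE; apply/eqP; rewrite eq_le; move: ps r0;
  rewrite /f AE => -> /(le_trans sr) ->.
Qed.

Lemma bpt_q i s : i \in J -> s <= r -> f i (b i) <= s -> bpt (F i) s (q i s).
Proof.
move=> iJ sr bs; have [A0 AB B1 A1 B0] := lv01 s iJ.
have ps : f i (B i s) <= s by apply: (lv_in (L iJ)); rewrite // lexx andbT.
split=> //; first exact: face_q.
have [Bpos|] := ltP (B i s) 1; first by left; apply: (lv_eqB (L iJ)).
move=> Ble; have BE : B i s = 1 by lra.
case: (end_level1 iJ) => [r0|]; last by rewrite /q BE; right.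
by left; rewrite /q BE; apply/eqP; rewrite eq_le; move: ps r0;
  rewrite /f BE => -> /(le_trans sr) ->.
Qed.

Lemma coord0_end i (t : R) l : i \in J -> 0 <= t <= 1 -> l != F i -> a i t 0 l = 0 ->
  t = 0 \/ t = 1.
Proof.
move=> iJ /andP[t0 t1] li l0.
have [->|tn0] := eqVneq t 0; first by left.
have [->|tn1] := eqVneq t 1; first by right.
by case: (sys_int S (t := t) iJ _ li l0); rewrite !lt_neqAle eq_sym tn0 tn1 t0.
Qed.

Lemma self_inj i (t u : R) : i \in J -> 0 <= t <= 1 -> 0 <= u <= 1 -> a i t = a i u -> t = u.
Proof.
move=> iJ t01 u01 E; have lt_i := sys_lt S iJ.
by case: (sys_inj S iJ iJ erefl t01 u01 E) => [[]|[_ _ e]|[_ _ e]] //; move: lt_i; rewrite e ltnn.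
Qed.

Lemma sweep_chord i s : i \in J -> s <= r -> f i (b i) < s -> chord (F i) s (p i s) (q i s).
Proof.
move=> iJ sr bs; have [A0 AB B1 A1 B0] := lv01 s iJ.
have lt_AB := lv_lt (L iJ) bs.
have A01 : 0 <= A i s <= 1 by rewrite A0.
have B01 : 0 <= B i s <= 1 by rewrite B0.
split; [exact: bpt_p (ltW bs) | exact: bpt_q (ltW bs) | |].
  by apply/eqP => /(self_inj iJ A01 B01) E; rewrite E ltxx in lt_AB.
move=> l li pl ql.
have [AE|AE] := coord0_end iJ A01 li pl; last by lra.
have [BE|BE] := coord0_end iJ B01 li ql; first by lra.
rewrite /p AE in pl; rewrite /q BE in ql.
exact: (sys_edge S iJ iJ erefl li pl ql).
Qed.

Lemma swept0 i s : i \in J -> swept (a i) (A i) (B i) s 0 = a i 0.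
Proof.
move=> iJ; have [A0 AB B1 A1 B0] := lv01 s iJ.
rewrite /swept; case: ifP => // /andP[A0' _].
have AE : A i s = 0 by lra.
by rewrite AE subrr mul0r seg0.
Qed.

Lemma swept1 i s : i \in J -> swept (a i) (A i) (B i) s 1 = a i 1.
Proof.
move=> iJ; have [A0 AB B1 A1 B0] := lv01 s iJ.
rewrite /swept; case: ifP => // /andP[_ B1'].
have BE : B i s = 1 by lra.
rewrite BE; have [->|neq] := eqVneq (A i s) 1; first by rewrite subrr mul0r seg0.
by rewrite divff ?seg1 // subr_eq0 eq_sym.
Qed.

Lemma swept_out i s t : i \in J -> ~~ (A i s < t < B i s) ->
  swept (a i) (A i) (B i) s t = a i t.
Proof.
move=> iJ; have [A0 AB B1 A1 B0] := lv01 s iJ.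
rewrite negb_and -!leNgt /swept => out; case: ifP => // /andP[At tB].
case/orP: out => [tA|Bt].
  have -> : t = A i s by lra.
  by rewrite subrr mul0r seg0.
have -> : t = B i s by lra.
have [->|neq] := eqVneq (A i s) (B i s); first by rewrite subrr mul0r seg0.
by rewrite divff ?seg1 // subr_eq0 eq_sym.
Qed.

Lemma swept_in i s t : i \in J -> A i s < t < B i s ->
  exists2 k, 0 < k < 1 & swept (a i) (A i) (B i) s t = seg (p i s) (q i s) k /\
    t = A i s + k * (B i s - A i s).
Proof.
move=> iJ /andP[At tB]; exists ((t - A i s) / (B i s - A i s)).
  rewrite divr_gt0 ?subr_gt0 //= ?(lt_trans At) //.
  by rewrite ltr_pdivrMr ?subr_gt0 ?(lt_trans At) // mul1r ltrD2r.
rewrite /swept (ltW At) (ltW tB); split=> //.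
by rewrite divfK ?subr_eq0 ?gt_eqF ?(lt_trans At) // addrC subrK.
Qed.

Lemma swept_low i s t : i \in J -> s <= f i (b i) -> swept (a i) (A i) (B i) s t = a i t.
Proof.
move=> iJ bs; apply: swept_out => //; have [-> ->] := lv_low (L iJ) bs.
by apply/negP => /andP[lt1 lt2]; have := lt_trans lt1 lt2; rewrite ltxx.
Qed.

Lemma in_low i s t : i \in J -> A i s < t < B i s -> f i (b i) < s.
Proof.
move=> iJ /andP[lt1 lt2]; rewrite ltNge; apply/negP => /(lv_low (L iJ))[AE BE].
by have := lt_trans lt1 lt2; rewrite AE BE ltxx.
Qed.

(** Two pieces in a face meet only at junctions, whose level is at least [r] and thus above [s]. *)
Lemma shared_level i j s : i \in J -> j \in J -> i <> j -> F i = F j -> s < r ->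
  f i (b i) <= s -> f j (b j) <= s ->
  [/\ p i s <> p j s, p i s <> q j s, q i s <> p j s & q i s <> q j s].
Proof.
move=> iJ jJ ij Fij sr bi bj.
have [A0 AB B1 A1 B0] := lv01 s iJ; have [A0' AB' B1' A1' B0'] := lv01 s jJ.
have key (t u : R) : 0 <= t <= 1 -> 0 <= u <= 1 -> f i t <= s -> f j u <= s -> a i t <> a j u.
  move=> t01 u01 ti uj E.
  have := sys_inj S iJ jJ Fij t01 u01 E.
  case=> [[]//|[t0 u1 e]|[t1 u0 e]].
    by have := Hr jJ iJ (esym e); rewrite leNgt => /negP; apply; rewrite -u1;
      apply: le_lt_trans sr.
  by have := Hr iJ jJ e; rewrite leNgt => /negP; apply; rewrite -t1; apply: le_lt_trans sr.
have Ai : f i (A i s) <= s by apply: (lv_in (L iJ)); rewrite // lexx.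
have Bi : f i (B i s) <= s by apply: (lv_in (L iJ)); rewrite // lexx andbT.
have Aj : f j (A j s) <= s by apply: (lv_in (L jJ)); rewrite // lexx.
have Bj : f j (B j s) <= s by apply: (lv_in (L jJ)); rewrite // lexx andbT.
by split; apply: key; rewrite ?A0 ?B0 ?A0' ?B0'.
Qed.

(** At the level [r] itself two chords may share a junction. Two common ends would make [i] and [j]
    succeed each other cyclically, against the increasing numbering. *)
Lemma shared_ends i j s : i \in J -> j \in J -> i <> j -> F i = F j -> s <= r ->
  f i (b i) < s -> f j (b j) < s ->
  [/\ p i s <> p j s, q i s <> q j s & ~ (p i s = q j s /\ q i s = p j s)].
Proof.
move=> iJ jJ ij Fij sr bi bj.
have [A0 AB B1 A1 B0] := lv01 s iJ; have [A0' AB' B1' A1' B0'] := lv01 s jJ.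
have AB1 := lv_lt (L iJ) bi; have AB2 := lv_lt (L jJ) bj.
have A01 : 0 <= A i s <= 1 by rewrite A0.
have B01 : 0 <= B i s <= 1 by rewrite B0.
have A01' : 0 <= A j s <= 1 by rewrite A0'.
have B01' : 0 <= B j s <= 1 by rewrite B0'.
split.
- move=> /(sys_inj S iJ jJ Fij A01 A01')[[/ij//]|[_ h _]|[h _ _]].
    exact: lt1_absurd h AB2 B1'.
  exact: lt1_absurd h AB1 B1.
- move=> /(sys_inj S iJ jJ Fij B01 B01')[[/ij//]|[h _ _]|[_ h _]].
    exact: lt0_absurd h A0 AB1.
  exact: lt0_absurd h A0' AB2.
- move=> [/(sys_inj S iJ jJ Fij A01 B01')[[/ij//]|[_ _ e1]|[h _ _]]]; last first.
    by case: (lt1_absurd h AB1 B1).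
  move=> /(sys_inj S iJ jJ Fij B01 A01')[[/ij//]|[h _ _]|[_ _ e2]].
    exact: lt0_absurd h A0 AB1.
  have lt_j := sys_lt S jJ; rewrite -e2 -e1 in lt_j.
  by have := ltn_trans (sys_lt S iJ) lt_j; rewrite ltnn.
Qed.

Lemma cts_p i : i \in J -> continuous (p i).
Proof. by move=> iJ; apply: cts_comp (sys_cts S iJ); apply: (lv_ctsA (L iJ)). Qed.

Lemma cts_q i : i \in J -> continuous (q i).
Proof. by move=> iJ; apply: cts_comp (sys_cts S iJ); apply: (lv_ctsB (L iJ)). Qed.

(* If the chords of two valleys crossed, then, lowering the level, they would still cross
   when the younger valley is reduced to a point. *)
Lemma chords_nocross i j (t u : R) : i \in J -> j \in J -> i <> j -> F i = F j ->
  f i (b i) <= f j (b j) -> f j (b j) < r -> 0 < t < 1 -> 0 < u < 1 ->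
  seg (p i r) (q i r) t <> seg (p j r) (q j r) u.
Proof.
move=> iJ jJ ij Fij bij bj t01 u01 E.
have bi : f i (b i) < r by apply: le_lt_trans bj.
have ci := sweep_chord iJ (lexx r) bi.
have cj := sweep_chord jJ (lexx r) bj; rewrite -Fij in cj.
have [npp nqq nshare] := shared_ends iJ jJ ij Fij (lexx r) bi bj.
(* Negative when, at the level [s], the ends of the chord of [j] are strictly on opposite sides of
   the line of the chord of [i]. *)
pose g s := cr (F i) (p i s) (q i s) (p j s) * cr (F i) (p i s) (q i s) (q j s).
have crE : (1 - u) * cr (F i) (p i r) (q i r) (p j r) + u * cr (F i) (p i r) (q i r) (q j r) = 0.
  by rewrite -cr_seg -E cr_chord.
have u0 : u != 0 by apply/eqP; case/andP: u01 => + _ u0; rewrite u0 ltxx.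
have u1 : 1 - u != 0 by rewrite subr_eq0; apply/eqP; case/andP: u01 => _ + u1; rewrite -u1 ltxx.
have [bpj bqj _ _] := cj.
have neq_pj : p j r != q i r.
  apply/eqP => pq; move/eqP: crE; rewrite pq cr_right mulr0 add0r mulf_eq0 (negPf u0) /=.
  apply/negP; apply: (cr_neq0 ci bqj); last by apply/eqP => qq; apply: nqq.
  by apply/eqP => qp; apply: nshare.
have neq_qj : q j r != p i r.
  apply/eqP => pq; move/eqP: crE; rewrite pq cr_left mulr0 addr0 mulf_eq0 (negPf u1) /=.
  by apply/negP; apply: (cr_neq0 ci bpj) => //; apply/eqP => qq; apply: npp.
have [c1 c2] : cr (F i) (p i r) (q i r) (p j r) != 0 /\ cr (F i) (p i r) (q i r) (q j r) != 0.
  by split; apply: (cr_neq0 ci) => //; apply/eqP => qq; [apply: npp | apply: nqq].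
have gr : g r < 0.
  rewrite /g; move: c1 c2 crE; set x := cr _ _ _ _; set y := cr _ _ _ (q j r).
  clear -u01 => x0 y0 E; have x2 : 0 < x * x by rewrite -expr2 lt0r sqrf_eq0 x0 sqr_ge0.
  have /andP[u0 u1] := u01; have := congr1 ( *%R x) E; rewrite mulr0 => E'.
  rewrite ltNge; apply/negP => xy.
  have h1 : 0 < (1 - u) * (x * x) by rewrite mulr_gt0 // subr_gt0.
  have h2 : 0 <= u * (x * y) by rewrite mulr_ge0 // ltW.
  by lra.
have g0 s : f i (b i) < s -> f j (b j) <= s -> s <= r -> g s != 0.
  move=> bis bjs; rewrite le_eqVlt => /predU1P[->|sr]; first by apply/eqP; move: gr; lra.
  have [n1 n2 n3 n4] := shared_level iJ jJ ij Fij sr (ltW bis) bjs.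
  have cis := sweep_chord iJ (ltW sr) bis.
  rewrite mulf_neq0 //; apply: (cr_neq0 cis); try by apply/eqP => // /esym.
    by rewrite Fij; apply: bpt_p => //; exact: ltW.
  by rewrite Fij; apply: bpt_q => //; exact: ltW.
have cg : continuous g.
  by apply: cts_mul; apply: cts_cr; do ?[exact: cts_p | exact: cts_q].
have gneg s : f i (b i) < s -> f j (b j) <= s -> s <= r -> g s < 0.
  move=> bis bjs sr; rewrite lt_neqAle g0 //= leNgt; apply/negP => gs.
  have [c crs gc] : exists2 c, c \in `[s, r] & g c = 0.
    apply: IVT => //; first exact: continuous_subspaceT.
    by rewrite min_r ?max_l ?(ltW gs) ?(ltW gr) // ltW // (lt_trans gr).
  move: crs; rewrite in_itv /= => /andP[sc cr].
  by have := g0 c; rewrite gc eqxx => /(_ (lt_le_trans bis sc) (le_trans bjs sc) cr).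
(* If the minimum of [i] is strictly lower, the chord of [j] is a point at the level of its own
   minimum, and [g] is a square there. If the minima are equal, both chords shrink to points at the
   same level and the sign says nothing; distances are used instead. *)
move: bij; rewrite le_eqVlt => /predU1P[bE|bij]; last first.
  have := gneg (f j (b j)) bij (lexx _) (ltW bj).
  rewrite /g /p /q; have [-> ->] := lv_low (L jJ) (lexx (f j (b j))).
  by rewrite -expr2 ltNge sqr_ge0.
set m := f j (b j) in bE bj bi gneg g0 *.
have mi : m <= f i (b i) by rewrite bE.
have im : f i (b i) <= m by rewrite bE.
pose D s := `|p i s - a i (b i)| + `|q i s - a i (b i)| +
  `|p j s - a j (b j)| + `|q j s - a j (b j)|.
have cD : continuous D.
  have cn (h : R -> 'rV[R]_4) (v : 'rV[R]_4) : continuous h -> continuous (fun s => `|h s - v|).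
    move=> ch; apply: (@cts_comp _ _ _ _ (fun x : 'rV[R]_4 => `|x|)); last exact: norm_continuous.
    by apply: (@cts_sub R _ 'rV[R]_4) => //; exact: cts_cst.
  by do !apply: cts_addR; apply: cn; do ?[exact: cts_p | exact: cts_q].
have Dm : D m = 0.
  have [Ai Bi] := lv_low (L iJ) mi.
  have [Aj Bj] := lv_low (L jJ) (lexx m).
  by rewrite /D /p /q Ai Bi Aj Bj !subrr normr0 !addr0.
(* Crossing chords keep the distance [e] of the two minima at most [D s], while the continuous
   function [D] vanishes at [m]. *)
pose e := `|a i (b i) - a j (b j)|.
have e0 : 0 < e.
  rewrite normr_gt0 subr_eq0; apply/eqP => ab.
  have [n1 _ _ _] := shared_level iJ jJ ij Fij bj im (lexx m).
  apply: n1; rewrite /p; have [-> _] := lv_low (L iJ) mi.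
  by have [-> _] := lv_low (L jJ) (lexx m).
have De s : m < s -> s <= r -> e <= D s.
  move=> ms sr; have bis : f i (b i) < s by rewrite bE.
  have cis := sweep_chord iJ sr bis.
  have fpj : face (F i) (p j s) by rewrite Fij; apply: face_p.
  have fqj : face (F i) (q j s) by rewrite Fij; apply: face_q.
  have [bpjs bqjs] : bpt (F i) s (p j s) /\ bpt (F i) s (q j s).
    by rewrite Fij; split; [apply: bpt_p => //; exact: ltW | apply: bpt_q => //; exact: ltW].
  have [_ lp _] := bpjs; have [_ lq _] := bqjs.
  have [t' [u' [/andP[t0 t1] /andP[u0' u1'] tu]]] :=
    cross_chord cis fpj fqj lp lq (gneg s bis (ltW ms) sr).
  have tri (x y v : 'rV[R]_4) (k : R) : 0 <= k -> k <= 1 ->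
    `|seg x y k - v| <= `|x - v| + `|y - v|.
    move=> k0 k1; have -> : seg x y k - v = (1 - k) *: (x - v) + k *: (y - v).
      by apply/rowP => l; rewrite !mxE; ring.
    apply: le_trans (ler_normD _ _) _; rewrite !normrZ !ger0_norm ?subr_ge0 //.
    by apply: lerD; rewrite ler_piMl ?normr_ge0 // gerBl.
  have := tri (p i s) (q i s) (a i (b i)) t' t0 t1.
  have := tri (p j s) (q j s) (a j (b j)) u' (ltW u0') (ltW u1').
  have := ler_distD (seg (p i s) (q i s) t') (a i (b i)) (a j (b j)).
  rewrite -/e [`|a i (b i) - _|]distrC tu /D.
  by lra.
have [c cmr Dc] : exists2 c, c \in `[m, r] & D c = e / 2.
  apply: IVT; [exact: ltW | exact: continuous_subspaceT |].
  have := De r bj (lexx r); rewrite Dm => er.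
  rewrite min_l ?max_r ?(le_trans (ltW e0) er) // divr_ge0 ?(ltW e0) //=.
  by apply: le_trans er; rewrite ler_pdivrMr // ler_peMr ?(ltW e0) // ler1n.
move: cmr; rewrite in_itv /= => /andP[]; rewrite le_eqVlt => /predU1P[mc|mc cr].
  by move: Dc; rewrite -mc Dm => /eqP; rewrite eq_sym mulf_eq0 gt_eqF //= invr_eq0 pnatr_eq0.
have := De c mc cr; rewrite Dc leNgt ltr_pdivrMr // => /negP; apply.
by rewrite ltr_pMr // ltr1n.
Qed.

(** Besides crossings, this excludes an end of one chord inside the other: interior points of chords
    are not boundary points of the disc. *)
Lemma chords_disjoint i j (t u : R) : i \in J -> j \in J -> i <> j -> F i = F j ->
  f i (b i) < r -> f j (b j) < r -> 0 < t < 1 -> 0 <= u <= 1 ->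
  seg (p i r) (q i r) t <> seg (p j r) (q j r) u.
Proof.
move=> iJ jJ ij Fij bi bj t01 u01.
have ci := sweep_chord iJ (lexx r) bi; have [_ _ pq _] := ci.
have bpj : bpt (F i) r (p j r) by rewrite Fij; apply: bpt_p => //; exact: ltW.
have bqj : bpt (F i) r (q j r) by rewrite Fij; apply: bpt_q => //; exact: ltW.
have t0 : t != 0 by rewrite gt_eqF //; case/andP: t01.
have t1 : t != 1 by rewrite lt_eqF //; case/andP: t01.
have endpt z : bpt (F i) r z -> seg (p i r) (q i r) t <> z.
  move=> bz E; have /eqP[] : cr (F i) (p i r) (q i r) z != 0; last by rewrite -E cr_chord.
  apply: (cr_neq0 ci bz); rewrite -E.
    by rewrite -[X in _ != X](seg0 _ (q i r)); apply: contra_neq t0; exact: seg_inj.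
  by rewrite -[X in _ != X](seg1 (p i r)); apply: contra_neq t1; exact: seg_inj.
have [->|u0] := eqVneq u 0; first by rewrite seg0; exact: endpt.
have [->|u1] := eqVneq u 1; first by rewrite seg1; exact: endpt.
have u01' : 0 < u < 1 by rewrite !lt_neqAle eq_sym u0 u1.
have [bij|bji] := leP (f i (b i)) (f j (b j)); first exact: chords_nocross.
move=> /esym; apply: chords_nocross => //; [|exact: ltW].
by move=> ji; apply: ij.
Qed.

Lemma chord_interior_lt i (k : R) : i \in J -> f i (b i) < r -> 0 < k < 1 ->
  sqnorm (seg (p i r) (q i r) k) < r.
Proof.
move=> iJ bi k01; have [[_ pr _] [_ qr _] pq _] := sweep_chord iJ (lexx r) bi.
exact: sqnorm_seg_lt.
Qed.

Lemma swept_inj i j (t u : R) : i \in J -> j \in J -> F i = F j ->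
  0 <= t <= 1 -> 0 <= u <= 1 ->
  swept (a i) (A i) (B i) r t = swept (a j) (A j) (B j) r u -> a i t = a j u.
Proof.
(* An interior point of a chord is strictly below [r]. An unswept point equal to it would be at the
   end of a sublevel interval, hence an end of a chord. *)
have half i' j' (t' u' : R) : i' \in J -> j' \in J -> F i' = F j' -> 0 <= u' <= 1 ->
    A i' r < t' < B i' r -> ~~ (A j' r < u' < B j' r) ->
    swept (a i') (A i') (B i') r t' <> a j' u'.
  move=> iJ jJ Fij u01 tin uout E.
  have bi := in_low iJ tin; have [k k01 [kE tE]] := swept_in iJ tin.
  have := chord_interior_lt iJ bi k01; rewrite -kE E => ju.
  have uAB : A j' r <= u' <= B j' r.
    rewrite !leNgt -negb_or; apply/negP => uo.
    have /(lv_out (L jJ) u01) : u' < A j' r \/ B j' r < u' by case/orP: uo; [left|right].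
    by rewrite ltNge (ltW ju).
  have uE : u' = A j' r \/ u' = B j' r.
    move: uAB uout; case/andP=> Au uB; rewrite negb_and -!leNgt.
    by case/orP=> h; [left|right]; apply/eqP; rewrite eq_le h ?Au ?uB.
  have [ij|/eqP ij] := eqVneq i' j'.
    subst j'; have [[_ pr _] [_ qr _] pq _] := sweep_chord iJ (lexx r) bi.
    move: E; rewrite kE; case: uE => ->; rewrite -/(p i' r) -/(q i' r).
      rewrite -[X in _ = X](seg0 _ (q i' r)) => /(seg_inj pq) k0.
      by move: k01; rewrite k0 ltxx.
    rewrite -[X in _ = X](seg1 (p i' r)) => /(seg_inj pq) k1.
    by move: k01; rewrite k1 ltxx andbF.
  have bj : f j' (b j') < r by apply: le_lt_trans ju; apply: (lv_min (L jJ)).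
  move: E; rewrite kE; case: uE => ->; rewrite -/(p j' r) -/(q j' r).
    by rewrite -[X in _ = X](seg0 _ (q j' r)); apply: chords_disjoint => //; rewrite lexx ler01.
  by rewrite -[X in _ = X](seg1 (p j' r)); apply: chords_disjoint => //; rewrite ler01 lexx.
move=> iJ jJ Fij t01 u01.
have [tin|tout] := boolP (A i r < t < B i r); have [uin|uout] := boolP (A j r < u < B j r).
- have [k k01 [kE tE]] := swept_in iJ tin; have [h h01 [hE uE]] := swept_in jJ uin.
  have bi := in_low iJ tin; have bj := in_low jJ uin.
  have [ij|/eqP ij] := eqVneq i j.
    subst j; have [_ _ pq _] := sweep_chord iJ (lexx r) bi.
    by rewrite kE hE => /(seg_inj pq) kh; rewrite tE uE kh.
  rewrite kE hE => /chords_disjoint; case=> //.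
  by case/andP: h01 => h0 h1; rewrite !ltW.
- by rewrite (swept_out jJ uout) => /half; case.
- by rewrite (swept_out iJ tout) => /esym /half; case.
- by rewrite (swept_out iJ tout) (swept_out jJ uout).
Qed.

Lemma swept_face i (t : R) : i \in J -> 0 <= t <= 1 ->
  face (F i) (swept (a i) (A i) (B i) r t) /\
  same_open_face (a i t) (swept (a i) (A i) (B i) r t).
Proof.
move=> iJ t01; have [tin|tout] := boolP (A i r < t < B i r); last first.
  by rewrite (swept_out iJ tout); split=> //; apply: (sys_face S).
have [k k01 [kE tE]] := swept_in iJ tin; have bi := in_low iJ tin.
have fp := face_p r iJ; have fq := face_q r iJ.
have k01' : 0 <= k <= 1 by case/andP: k01 => k0 k1; rewrite !ltW.
have fs : face (F i) (swept (a i) (A i) (B i) r t) by rewrite kE; apply: seg_face.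
split=> // l; have [li|li] := eqVneq l (F i).
  by rewrite li (proj2 fs) (proj2 (sys_face S iJ t01)).
have [_ _ _ pq0] := sweep_chord iJ (lexx r) bi.
have tin' : 0 < t < 1.
  by case/andP: tin => tA tB; have [A0 _ B1 _ _] := lv01 r iJ;
    rewrite (le_lt_trans A0) // (lt_le_trans tB).
have /eqP/negPf -> := sys_int S iJ tin' li.
apply/esym/negbTE/eqP; rewrite kE => /(seg_eq0 (proj1 fp) (proj1 fq) k01)[pl ql].
exact: pq0 li pl ql.
Qed.

Lemma swept_sqc i : i \in J -> sqc (fun t => sqnorm (swept (a i) (A i) (B i) r t)).
Proof.
move=> iJ.
have [rb|br] := leP r (f i (b i)).
  by move=> x y z x0 xy yz z1; rewrite !(swept_low _ iJ) //; exact: (sys_sqc S iJ).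
have [A0 AB B1 A1 B0] := lv01 r iJ.
have lt_AB := lv_lt (L iJ) br.
have [[_ pr _] [_ qr _] pq _] := sweep_chord iJ (lexx r) br.
have inn (w : R) : A i r <= w <= B i r ->
    swept (a i) (A i) (B i) r w = seg (p i r) (q i r) ((w - A i r) / (B i r - A i r)).
  by move=> wAB; rewrite /swept wAB.
apply: (@sqc_glue _ (f i) _ (A i r) (B i r) r) => //.
- exact: (sys_sqc S iJ).
- move=> w w01 wo; split; first exact: (lv_out (L iJ)).
  rewrite swept_out // negb_and -!leNgt.
  by case: wo => /ltW ->; rewrite ?orbT.
- move=> w wAB; rewrite inn //; case/andP: wAB => Aw wB; apply: sqnorm_seg_le => //.
  by rewrite divr_ge0 ?subr_ge0 //= ler_pdivrMr ?subr_gt0 // mul1r lerD2r.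
- move=> x y z Ax xy yz zB; rewrite !inn ?Ax ?(le_trans Ax (ltW xy)) ?zB ?(le_trans (ltW yz)) //=.
  + by apply: seg_sqc => //; rewrite ltr_pM2r ?invr_gt0 ?subr_gt0 // ltrD2r.
  + by rewrite (le_trans Ax) // ltW // (lt_trans xy).
  + by rewrite ltW // (lt_le_trans xy) // (le_trans (ltW yz)).
Qed.

Lemma swept_sys : sys J F ar st en (fun i => swept (a i) (A i) (B i) r).
Proof.
have pat i j (t u : R) := @swept_inj i j t u.
split.
- move=> i iJ; have AB s : A i s <= B i s by have [] := lv01 s iJ.
  have := swept_cts (sys_cts S iJ) (lv_ctsA (L iJ)) (lv_ctsB (L iJ)) AB.
  apply: (@cts_comp _ _ _ (fun t : R => (r, t))).
  by apply: cts_pair; [exact: cts_cst | exact: cts_id].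
- by move=> i t iJ t01; have [] := swept_face iJ t01.
- move=> i t l iJ t01 li; have t01' : 0 <= t <= 1 by case/andP: t01 => t0 t1; rewrite !ltW.
  have [_ /(_ l) E] := swept_face iJ t01'; have /eqP := sys_int S iJ t01 li.
  by rewrite E => /eqP.
- by move=> i j l iJ jJ; rewrite swept0 // swept1 //; exact: (sys_edge S).
- by move=> i j t u iJ jJ Fij t01 u01 /(pat _ _ _ _ iJ jJ Fij t01 u01); exact: (sys_inj S).
- exact: (sys_lt S).
- by move=> i j iJ jJ ij; rewrite swept0 // !swept1 //; exact: (sys_junc S).
- by move=> i iJ; rewrite swept0 //; exact: (sys_start S).
- by move=> i iJ; rewrite swept1 //; exact: (sys_end S).
- exact: swept_sqc.
Qed.

End Sweep.

(* In different faces, equal points lie on an edge, where the paths are fixed. *)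
Lemma family_pattern (R : realType) (I : finType) (J : {set I}) (F : I -> 'I_4)
    (ar st en : I -> nat) (a b : I -> R -> 'rV[R]_4) :
  sys J F ar st en a ->
  (forall (i : I) (t : R), i \in J -> 0 <= t <= 1 ->
    face (F i) (b i t) /\ same_open_face (a i t) (b i t)) ->
  (forall (i : I) (t : R) l, i \in J -> 0 <= t <= 1 -> l != F i -> a i t 0 l = 0 ->
    b i t = a i t) ->
  (forall i j, i \in J -> j \in J -> en i = st j -> b i 1 = b j 0) ->
  (forall (i j : I) (t u : R), i \in J -> j \in J -> F i = F j -> 0 <= t <= 1 -> 0 <= u <= 1 ->
     b i t = b j u -> a i t = a j u) ->
  forall (i j : I) (t u : R), i \in J -> j \in J -> 0 <= t <= 1 -> 0 <= u <= 1 ->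
    b i t = b j u <-> a i t = a j u.
Proof.
move=> S bface bedge bjunc binj i j t u iJ jJ t01 u01.
have [bi fi] := bface i t iJ t01; have [bj fj] := bface j u jJ u01.
have ai := sys_face S iJ t01; have aj := sys_face S jJ u01.
have [Fij|Fij] := eqVneq (F i) (F j).
  split; first exact: binj.
  case/(sys_inj S iJ jJ Fij t01 u01) => [[-> ->]//|[-> -> e]|[-> -> e]].
    by apply/esym/bjunc.
  exact: bjunc.
split=> E.
  have ai0 : a i t 0 (F j) = 0 by apply/eqP; rewrite fi E; apply/eqP; exact: (proj2 bj).
  have aj0 : a j u 0 (F i) = 0 by apply/eqP; rewrite fj -E; apply/eqP; exact: (proj2 bi).
  rewrite -(bedge i t (F j)) //; last by rewrite eq_sym.
  by rewrite -(bedge j u (F i)).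
rewrite (bedge i t (F j)) //; [|by rewrite eq_sym|by rewrite E; exact: (proj2 aj)].
by rewrite (bedge j u (F i)) // -E; exact: (proj2 ai).
Qed.

Lemma swept_iso (R : realType) (I : finType) (J : {set I}) (F : I -> 'I_4)
    (ar st en : I -> nat) (a : I -> R -> 'rV[R]_4) (b : I -> R) (A B : I -> R -> R) (r : R) :
  sys J F ar st en a ->
  (forall i, i \in J -> levels (fun t => sqnorm (a i t)) (b i) (A i) (B i)) ->
  (forall i j, i \in J -> j \in J -> en i = st j -> r <= sqnorm (a i 1)) ->
  0 <= r ->
  isoS (img J a) (img J (fun i => swept (a i) (A i) (B i) r)).
Proof.
move=> S L Hr r0.
pose lev (s : R) := -1 + s * (r + 1).
pose H (s : R) i t := swept (a i) (A i) (B i) (lev s) t.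
have lev_le (s : R) : 0 <= s <= 1 -> lev s <= r.
  by move=> /andP[s0 s1]; rewrite /lev; nra.
have Hlev (s : R) : 0 <= s <= 1 -> forall i j, i \in J -> j \in J -> en i = st j ->
    lev s <= sqnorm (a i 1).
  by move=> s01 i j iJ jJ ij; apply: le_trans (lev_le _ s01) (Hr _ _ iJ jJ ij).
have H0 i (t : R) : i \in J -> 0 <= t <= 1 -> H 0 i t = a i t.
  move=> iJ t01; apply: (swept_low L) => //; rewrite /lev mul0r addr0.
  by apply: le_trans (sqnorm_ge0 _); rewrite lerN10.
have pat (s : R) (i j : I) (t u : R) : 0 <= s <= 1 -> i \in J -> j \in J ->
    0 <= t <= 1 -> 0 <= u <= 1 -> H s i t = H s j u <-> a i t = a j u.
  move=> s01; apply: (family_pattern (b := H s) S).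
  - by move=> i' t' iJ t01; exact: (swept_face S L (Hlev s s01)).
  - move=> i' t' l iJ t01 li l0.
    by case: (coord0_end S iJ t01 li l0) => ->; [exact: (swept0 L) | exact: (swept1 L)].
  - move=> i' j' iJ jJ e; have [_ _ E _] := sys_junc S iJ jJ e.
    by rewrite /H (swept1 L) // (swept0 L).
  - by move=> i' j' t' u'; exact: (swept_inj S L (Hlev s s01)).
have r01 : 0 <= (0 : R) <= 1 by rewrite lexx ler01.
have -> : img J a = img J (H 0) by apply: img_ext => i t iJ t01; rewrite H0.
have -> : img J (fun i => swept (a i) (A i) (B i) r) = img J (H 1).
  by apply: img_ext => i t _ _; rewrite /H /lev mul1r addrC addrK.
apply: isoS_family.
- move=> i iJ; have AB s : A i s <= B i s by have [] := lv01 L s iJ.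
  have := swept_cts (sys_cts S iJ) (lv_ctsA (L i iJ)) (lv_ctsB (L i iJ)) AB.
  apply: (@cts_comp _ _ _ (fun z : R * R => (lev z.1, z.2))).
  apply: cts_pair; last exact: cts_snd.
  apply: cts_addR; first exact: cts_cst.
  by apply: cts_mul; [exact: cts_fst | exact: cts_cst].
- by move=> s i j t u s01 iJ jJ t01 u01; rewrite !H0 //; exact: pat.
- move=> s i t s01 iJ t01; rewrite H0 //.
  by have [[sx _] fx] := swept_face S L (Hlev s s01) iJ t01.
Qed.

(** * Merging consecutive paths *)

Definition glue (R : realType) (V : Type) (f g : R -> V) (t : R) : V :=
  if t <= 2^-1 then f (2 * t) else g (2 * t - 1).

Lemma half_facts (R : realType) : [/\ (0 : R) < 2^-1, (2^-1 : R) < 1,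
  (2 * 2^-1 : R) = 1 & (2 * 2^-1 - 1 : R) = 0].
Proof.
have h : (2 * 2^-1 : R) = 1 by rewrite divff ?pnatr_eq0.
by split; rewrite ?h ?subrr // ?invr_gt0 ?ltr0n // invf_lt1 ?ltr0n ?ltr1n.
Qed.

(** A function with its minimum at the junction is monotone, and it goes up when moving away from
    the junction; it only prolongs one flank of the other function or starts at its end. *)
Lemma glue_sqc (R : realType) (f g : R -> R) : sqc f -> sqc g -> f 1 = g 0 ->
  (forall t : R, 0 <= t <= 1 -> f 1 <= f t) \/ (forall t : R, 0 <= t <= 1 -> g 0 <= g t) ->
  sqc (glue f g).
Proof.
move=> fq gq fg min x y z x0 xy yz z1; have [h0 h1 h2 h3] := half_facts R.
have f_dec : (forall t : R, 0 <= t <= 1 -> f 1 <= f t) ->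
    forall t u : R, 0 <= t -> t < u -> u <= 1 -> f u < f t.
  move=> fmin t u t0 tu; rewrite le_eqVlt => /predU1P[u1|u1].
    rewrite u1 in tu *.
    have m01 : 0 <= (t + 1) / 2 <= 1 by lra.
    have m1 := fmin _ m01; case: (fq t ((t + 1) / 2) 1); lra.
  have u01 : 0 <= u <= 1 by lra.
  by have := fmin u u01; case: (fq t u 1 t0 tu u1); lra.
have g_inc : (forall t : R, 0 <= t <= 1 -> g 0 <= g t) ->
    forall t u : R, 0 <= t -> t < u -> u <= 1 -> g t < g u.
  move=> gmin t u; rewrite le_eqVlt => /predU1P[<-|t0] tu u1.
    have m01 : 0 <= u / 2 <= 1 by lra.
    have m1 := gmin _ m01; case: (gq 0 (u / 2) u); lra.
  have t01 : 0 <= t <= 1 by lra.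
  by have := gmin t t01; case: (gq 0 t u); lra.
rewrite /glue; case: (leP y 2^-1) => yh; case: (leP z 2^-1) => zh; case: (leP x 2^-1) => xh;
  try lra.
- by apply: fq; lra.
- have [y1|y1] : y = 2^-1 \/ y < 2^-1 by lra.
    rewrite y1 h2; case: min => [/f_dec fd|/g_inc gi].
      by left; apply: fd; lra.
    by right; rewrite fg; apply: gi; lra.
  have : f (2 * y) < f (2 * x) \/ f (2 * y) < f 1 by apply: fq; lra.
  case: min => [/f_dec fd|/g_inc gi]; first by left; apply: fd; lra.
  case; first by left.
  by move=> lt1; right; apply: lt_trans lt1 _; rewrite fg; apply: gi; lra.
- have : g (2 * y - 1) < g 0 \/ g (2 * y - 1) < g (2 * z - 1) by apply: gq; lra.
  case: min => [fmin|/g_inc gi]; last by right; apply: gi; lra.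
  case; last by right.
  by move=> lt1; left; apply: lt_le_trans lt1 _; rewrite -fg; apply: fmin; lra.
- by apply: gq; lra.
Qed.

Lemma glue_cts (R : realType) (f g : R -> 'rV[R]_4) :
  continuous f -> continuous g -> f 1 = g 0 -> continuous (glue f g).
Proof.
move=> cf cg fg; have [h0 h1 h2 h3] := half_facts R.
have -> : glue f g = (fun t => f (Num.min (2 * t) 1) + (g (Num.max (2 * t - 1) 0) - g 0)).
  apply/funext => t; rewrite /glue; case: leP => th.
    by rewrite min_l ?max_r ?subrr ?addr0 //; lra.
  have e1 : 1 <= 2 * t by lra.
  have e2 : 0 <= 2 * t - 1 by lra.
  by rewrite (min_r e1) (max_l e2) fg [RHS]addrC subrK.
have c2 : continuous (fun t : R => 2 * t).
  by apply: cts_mul; [exact: cts_cst | exact: cts_id].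
apply: (@cts_add R _ 'rV[R]_4); first by apply: cts_comp cf; apply: cts_min => //; exact: cts_cst.
apply: (@cts_sub R _ 'rV[R]_4); last exact: cts_cst.
apply: cts_comp cg; apply: cts_max; last exact: cts_cst.
by apply: cts_subR => //; exact: cts_cst.
Qed.

Section Merge.
Variables (R : realType) (I : finType) (J : {set I}) (F : I -> 'I_4).
Variables (ar st en : I -> nat) (a : I -> R -> 'rV[R]_4).
Hypothesis S : sys J F ar st en a.
Variables i j : I.
Hypotheses (iJ : i \in J) (jJ : j \in J) (ij : en i = st j).
Hypothesis nopeak :
  (forall t : R, 0 <= t <= 1 -> sqnorm (a i 1) <= sqnorm (a i t)) \/
  (forall t : R, 0 <= t <= 1 -> sqnorm (a j 0) <= sqnorm (a j t)).

Let c k := if k == i then glue (a i) (a j) else a k.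
Let en' k := if k == i then en j else en k.

Lemma r01 : 0 <= (0 : R) <= 1. Proof. by rewrite lexx ler01. Qed.
Lemma r11 : 0 <= (1 : R) <= 1. Proof. by rewrite lexx ler01. Qed.

(** Both pieces start at the end of [i], and by [sys_inj] distinct pieces never share a start. *)
Lemma junction_next k : k \in J -> st k = st j -> k = j.
Proof.
move=> kJ kj; have [Fij _ E1 _] := sys_junc S iJ jJ ij.
have [Fik _ E2 _] := sys_junc S iJ kJ (etrans ij (esym kj)).
have E : a k 0 = a j 0 by rewrite -E2.
have Fkj : F k = F j by rewrite -Fik.
case: (sys_inj S kJ jJ Fkj r01 r01 E) => [[]//|[_ /esym/eqP]|[/esym/eqP]];
by rewrite oner_eq0.
Qed.

Lemma junction_prev k : k \in J -> en k = en i -> k = i.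
Proof.
move=> kJ ki; have [Fij _ E1 _] := sys_junc S iJ jJ ij.
have [Fkj _ E2 _] := sys_junc S kJ jJ (etrans ki ij).
have E : a k 1 = a i 1 by rewrite E2.
have Fki : F k = F i by rewrite Fkj.
by case: (sys_inj S kJ iJ Fki r11 r11 E) => [[]//|[/eqP]|[_ /eqP]]; rewrite oner_eq0.
Qed.

Lemma neq_ij : i <> j.
Proof. by move=> E; have := sys_lt S iJ; rewrite ij E ltnn. Qed.

Lemma glue_part (t : R) : 0 <= t <= 1 ->
  exists k u, [/\ k = i \/ k = j, 0 <= u <= 1, glue (a i) (a j) t = a k u &
    (k = i /\ u = 2 * t /\ t <= 2^-1) \/ (k = j /\ u = 2 * t - 1 /\ 2^-1 < t)].
Proof.
move=> /andP[t0 t1]; rewrite /glue; case: leP => th.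
  by exists i, (2 * t); split; [left | lra | | left].
by exists j, (2 * t - 1); split; [right | lra | | right].
Qed.

Lemma glue0 : glue (a i) (a j) 0 = a i 0.
Proof. by rewrite /glue invr_ge0 ler0n mulr0. Qed.

Lemma glue1 : glue (a i) (a j) 1 = a j 1.
Proof.
have [h0 h1 h2 h3] := half_facts R.
by rewrite /glue leNgt h1 /=; congr (a j _); lra.
Qed.

Lemma c0 k : c k 0 = a k 0.
Proof. by rewrite /c; case: eqP => [->|//]; rewrite glue0. Qed.

Lemma c1 k : k <> i -> c k 1 = a k 1.
Proof. by rewrite /c; case: eqP. Qed.

Lemma inI k : k \in J :\ j -> k \in J /\ k <> j.
Proof. by rewrite !inE => /andP[/eqP kj kJ]. Qed.

Lemma merge_inj_aux k (t u : R) : k \in J :\ j -> k <> i -> F i = F k -> 0 <= t <= 1 ->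
  0 <= u <= 1 ->
  glue (a i) (a j) t = a k u ->
  [/\ t = 0, u = 1 & st i = en k] \/ [/\ t = 1, u = 0 & en j = st k].
Proof.
move=> /inI[kJ kj] ki Fik t01 u01; have [Fij _ E1 _] := sys_junc S iJ jJ ij.
have [h0 h1 h2 h3] := half_facts R.
have [k' [u' [_ u'01 -> part]]] := glue_part t01.
case: part => [[-> [-> th]]|[-> [-> th]]] in u'01 *.
  case/(sys_inj S iJ kJ Fik u'01 u01) => [[/esym//]|[t0 u1 e]|[t1 u0 e]].
    by left; split=> //; lra.
  by case: kj; apply: junction_next => //; rewrite -e ij.
have Fjk : F j = F k by rewrite -Fij.
case/(sys_inj S jJ kJ Fjk u'01 u01) => [[/esym//]|[t0 u1 e]|[t1 u0 e]].
  by case: ki; apply: junction_prev => //; rewrite -e ij.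
by right; split=> //; lra.
Qed.

(** The merged piece keeps the index and start number of [i] and takes the end number of [j], so
    numbers still increase along the arc. *)
Lemma merge_sys : sys (J :\ j) F ar st en' c.
Proof.
have [Fij arij Eij nz] := sys_junc S iJ jJ ij.
have [h0 h1 h2 h3] := half_facts R.
have iJ' : i \in J :\ j by rewrite !inE iJ andbT; apply/eqP; exact: neq_ij.
split.
- move=> k /inI[kJ _]; rewrite /c; case: (k =P i) => _; last exact: (sys_cts S).
  by apply: glue_cts => //; apply: (sys_cts S).
- move=> k t /inI[kJ _] t01; rewrite /c; case: (k =P i) => [->|_]; last exact: (sys_face S).
  have [k' [u [[->|->] u01 -> _]]] := glue_part t01; first exact: (sys_face S).
  by rewrite Fij; apply: (sys_face S).
- move=> k t l /inI[kJ _] t01; rewrite /c; case: (k =P i) => [->|_];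
    last exact: (sys_int S kJ t01).
  move=> li; have t01' : 0 <= t <= 1 by case/andP: t01 => t0 t1; rewrite !ltW.
  have [k' [u [_ u01 -> part]]] := glue_part t01'.
  case: part => [[-> [uE th]]|[-> [uE th]]].
    have [u1|u1] : u = 1 \/ 0 < u < 1 by lra.
      by rewrite u1; exact: nz.
    exact: (sys_int S iJ u1 li).
  have u1 : 0 < u < 1 by lra.
  by apply: (sys_int S jJ u1); rewrite -Fij.
- move=> k k' l /inI[kJ kj] /inI[kJ' kj'] ark li; rewrite c0 => l0.
  have [ki|/eqP ki] := eqVneq k' i; last by rewrite c1 //; exact: (sys_edge S kJ kJ' ark li).
  rewrite /c ki eqxx glue1; apply: (sys_edge S kJ jJ _ li l0).
  by rewrite ark ki.
- move=> k k' t u kJ' kJ'' Fkk t01 u01; have [kJ kj] := inI kJ'; have [kJ2 kj2] := inI kJ''.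
  rewrite /c /en'; case: (k =P i) => [ki|ki]; case: (k' =P i) => [ki'|ki'].
  + subst k k'; have [k1 [u1 [_ u101 -> part1]]] := glue_part t01.
    have [k2 [u2 [_ u201 -> part2]]] := glue_part u01.
    have lti := sys_lt S iJ; have ltj := sys_lt S jJ.
    case: part1 => [[? [? th]]|[? [? th]]]; subst k1 u1;
    case: part2 => [[? [? uh]]|[? [? uh]]]; subst k2 u2.
    * case/(sys_inj S iJ iJ erefl u101 u201) => [[_ E]|[_ _ e]|[_ _ e]].
      - by constructor 1; split=> //; lra.
      - by rewrite e ltnn in lti.
      - by rewrite e ltnn in lti.
    * case/(sys_inj S iJ jJ Fij u101 u201) => [[/neq_ij//]|[_ _ e]|[t1 u0 _]].
      - by rewrite -e -ij ltnNge (ltnW lti) in ltj.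
      - by constructor 1; split=> //; lra.
    * case/(sys_inj S jJ iJ (esym Fij) u101 u201) => [[/esym/neq_ij//]|[t0 u1' _]|[_ _ e]].
      - by constructor 1; split=> //; lra.
      - by rewrite e -ij ltnNge (ltnW lti) in ltj.
    * case/(sys_inj S jJ jJ erefl u101 u201) => [[_ E]|[_ _ e]|[_ _ e]].
      - by constructor 1; split=> //; lra.
      - by rewrite e ltnn in ltj.
      - by rewrite e ltnn in ltj.
  + subst k; move/(merge_inj_aux kJ'' ki' Fkk t01 u01) => [[? ? ?]|[? ? ?]];
    by [constructor 2 | constructor 3].
  + subst k'; move/esym/(merge_inj_aux kJ' ki (esym Fkk) u01 t01) => [[? ? ?]|[? ? ?]];
    by [constructor 3 | constructor 2].
  + exact: (sys_inj S).
- move=> k /inI[kJ _]; rewrite /en'; case: (k =P i) => [->|_]; last exact: (sys_lt S).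
  by apply: ltn_trans (sys_lt S iJ) _; rewrite ij; apply: (sys_lt S).
- move=> k k' /inI[kJ kj] /inI[kJ' kj']; rewrite /en' c0; case: (k =P i) => [->|ki] e.
    rewrite /c eqxx glue1; have [Fjk arjk Ejk nz'] := sys_junc S jJ kJ' e.
    by split; rewrite ?Fij ?arij.
  by rewrite c1 //; exact: (sys_junc S).
- move=> k /inI[kJ kj]; rewrite c0 => /(sys_start S kJ)[k' kJ' e].
  have [k'j|/eqP k'j] := eqVneq k' j.
    by exists i => //; rewrite /en' eqxx -k'j.
  exists k'; first by rewrite !inE kJ' andbT; apply/eqP.
  rewrite /en'; case: (k' =P i) => // k'i; case: kj; apply: junction_next => //.
  by rewrite -e k'i.
- move=> k /inI[kJ kj]; rewrite /c /en'; case: (k =P i) => [->|ki].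
    rewrite glue1 Fij => /(sys_end S jJ)[k' kJ' e]; exists k' => //.
    rewrite !inE kJ' andbT; apply/eqP => k'j.
    by have := sys_lt S jJ; rewrite e k'j ltnn.
  move=> /(sys_end S kJ)[k' kJ' e]; exists k' => //.
  rewrite !inE kJ' andbT; apply/eqP => k'j; apply: ki; apply: junction_prev => //.
  by rewrite e k'j.
- move=> k /inI[kJ kj]; rewrite /c; case: (k =P i) => [_|_]; last exact: (sys_sqc S).
  have -> : (fun t => sqnorm (glue (a i) (a j) t)) =
      glue (fun t => sqnorm (a i t)) (fun t => sqnorm (a j t)).
    by apply/funext => t; rewrite /glue; case: ifP.
  by apply: glue_sqc; [exact: (sys_sqc S) | exact: (sys_sqc S) | rewrite Eij |].
Qed.

Lemma merge_img : img (J :\ j) c = img J a.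
Proof.
have [_ _ Eij _] := sys_junc S iJ jJ ij.
have [h0 h1 h2 h3] := half_facts R.
have iJ' : i \in J :\ j by rewrite !inE iJ andbT; apply/eqP; exact: neq_ij.
apply/seteqP; split=> x [k [t [kJ /andP[t0 t1] <-]]].
  have [kJ' kj] := inI kJ; rewrite /c; case: (k =P i) => [ki|ki]; last by exists k, t;
    rewrite t0 t1.
  have t01 : 0 <= t <= 1 by rewrite t0.
  have [k' [u [k'ij u01 -> _]]] := glue_part t01.
  by exists k', u; split=> //; case: k'ij => ->.
have [kj|kj] := eqVneq k j.
  exists i, ((t + 1) / 2); split=> //; first by lra.
  rewrite /c eqxx /glue; case: leP => th; last by rewrite kj; congr (a j _); field.
  have t0' : t = 0 by lra.
  by rewrite kj t0' add0r mul1r h2 Eij.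
have kJ' : k \in J :\ j by rewrite !inE kj.
have [ki|ki] := eqVneq k i; last by exists k, t; rewrite /c (negPf ki) t0 t1.
exists i, (t / 2); split=> //; first by lra.
have th : t / 2 <= 2^-1 by lra.
rewrite /c eqxx /glue th.
by rewrite ki; congr (a i _); field.
Qed.

End Merge.

(** * Pushing a peak across a triangle *)

Lemma seg_eq_left (R : realType) (x y v : 'rV[R]_4) (k : R) : k != 1 ->
  seg x v k = seg y v k -> x = y.
Proof.
move=> k1 /rowP E; apply/rowP => l; have := E l; rewrite !segE => /addIr.
by apply: mulfI; rewrite subr_eq0 eq_sym.
Qed.

(* At a peak v of minimal level r, the sublevel chords [p, v] and [v, q] span a triangle
   avoiding all other paths; v is pushed across it to the midpoint of [p, q]. *)
Section Triangle.
Variables (R : realType) (I : finType) (J : {set I}) (F : I -> 'I_4).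
Variables (ar st en : I -> nat) (a : I -> R -> 'rV[R]_4).
Hypothesis S : sys J F ar st en a.
Variables (b : I -> R) (A B : I -> R -> R).
Hypothesis L : forall i, i \in J -> levels (fun t => sqnorm (a i t)) (b i) (A i) (B i).
Variable r : R.
Hypothesis Hr : forall i j, i \in J -> j \in J -> en i = st j -> r <= sqnorm (a i 1).
Variables i j : I.
Hypotheses (iJ : i \in J) (jJ : j \in J) (ij : en i = st j).
Hypothesis vr : sqnorm (a i 1) = r.
Hypotheses (ilow : sqnorm (a i (b i)) < r) (jlow : sqnorm (a j (b j)) < r).

Let a' k := swept (a k) (A k) (B k) r.
Let p := a i (A i r).
Let q := a j (B j r).
Let v := a i 1.
Let m := seg p q 2^-1.
(** Affine on each of the two chords, 1 at [v] and 0 at [p] and [q]; it vanishes on everything that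
    stays fixed during the push. *)
Let lam k t : R := if k == i then Num.max 0 ((t - A i r) / (1 - A i r))
  else if k == j then Num.max 0 ((B j r - t) / B j r) else 0.
Let H s k t := a' k t + (s * lam k t) *: (m - v).

Lemma tri_junc : [/\ F i = F j, ar i = ar j, v = a j 0 & forall l, l != F i -> v 0 l <> 0].
Proof. exact: (sys_junc S iJ jJ ij). Qed.

Lemma tri_Bi : B i r = 1.
Proof.
have [A0 AB B1 A1 B0] := lv01 L r iJ; apply/eqP; rewrite eq_le B1 leNgt; apply/negP => Blt.
by have := lv_out (L iJ) (r11 R) (or_intror Blt); rewrite vr ltxx.
Qed.

Lemma tri_Aj : A j r = 0.
Proof.
have [A0 AB B1 A1 B0] := lv01 L r jJ; apply/eqP; rewrite eq_le A0 andbT leNgt; apply/negP => Alt.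
have := lv_out (L jJ) (r01 R) (or_introl Alt); have [_ _ <- _] := tri_junc.
by rewrite vr ltxx.
Qed.

Lemma tri_Ai : 0 <= A i r < 1.
Proof.
have [A0 _ _ _ _] := lv01 L r iJ; have := lv_lt (L iJ) ilow.
by rewrite tri_Bi A0.
Qed.

Lemma tri_Bj : 0 < B j r <= 1.
Proof.
have [_ _ B1 _ _] := lv01 L r jJ; have := lv_lt (L jJ) jlow.
by rewrite tri_Aj B1 => ->.
Qed.

Lemma tri_ci : chord (F i) r p v.
Proof. by have := sweep_chord S L Hr iJ (lexx r) ilow; rewrite tri_Bi. Qed.

Lemma tri_cj : chord (F i) r v q.
Proof.
have := sweep_chord S L Hr jJ (lexx r) jlow; rewrite tri_Aj.
by have [-> _ -> _] := tri_junc.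
Qed.

Lemma tri_neq : i <> j. Proof. exact: (neq_ij S iJ ij). Qed.

Lemma tri_pq : chord (F i) r p q.
Proof.
have [Fij arij vE nz] := tri_junc.
have /andP[A0 A1] := tri_Ai; have /andP[B0 B1] := tri_Bj.
have A01 : 0 <= A i r <= 1 by rewrite A0 ltW.
have B01 : 0 <= B j r <= 1 by rewrite B1 ltW.
have [bp _ _ _] := tri_ci; have [_ bq _ _] := tri_cj.
split=> //.
  apply/eqP => /(sys_inj S iJ jJ Fij A01 B01)[[/tri_neq//]|[_ _ e]|[h _ _]].
    have lt_j := sys_lt S jJ; rewrite -ij -e ltnNge in lt_j.
    by rewrite (ltnW (sys_lt S iJ)) in lt_j.
  by move: A1; rewrite h ltxx.
move=> l li pl ql.
have [h|h] := coord0_end S iJ A01 li pl; last by move: A1; rewrite h ltxx.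
have lj : l != F j by rewrite -Fij.
have [h'|h'] := coord0_end S jJ B01 lj ql; first by move: B0; rewrite h' ltxx.
by move: pl ql; rewrite /p /q h h'; exact: (sys_edge S iJ jJ arij li).
Qed.

Lemma tri_v : cr (F i) p q v != 0.
Proof.
have [_ bv pv _] := tri_ci; have [_ _ vq _] := tri_cj.
by apply: (cr_neq0 tri_pq bv) => //; rewrite eq_sym.
Qed.

Lemma lam_i (t : R) : lam i t = Num.max 0 ((t - A i r) / (1 - A i r)).
Proof. by rewrite /lam eqxx. Qed.

Lemma lam_j (t : R) : lam j t = Num.max 0 ((B j r - t) / B j r).
Proof. by rewrite /lam eq_sym (introF eqP tri_neq) eqxx. Qed.

Lemma lam_ge0 k (t : R) : 0 <= lam k t.
Proof. by rewrite /lam; do 2?case: ifP => _; rewrite ?le_max lexx. Qed.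

(** Barycentric coordinates in the triangle: [h] is the weight of [v] and [g * (1 - h)] that of [q].
    Both are functions of [s] and of [e = lam k t], so that injectivity becomes a comparison of
    weights. *)
Lemma moved k (t s : R) : 0 <= t <= 1 -> lam k t != 0 -> 0 < s <= 1 ->
  exists2 e, 0 < e <= 1 & exists g h, [/\ 0 < g < 1, 0 <= h < 1,
    H s k t = seg (seg p q g) v h, h = e * (1 - s) &
    [/\ k = i, g * (1 - h) = s * e / 2 & t = A i r + e * (1 - A i r)] \/
    [/\ k = j, g * (1 - h) = 1 - e + s * e / 2 & t = (1 - e) * B j r]].
Proof.
move=> /andP[t0 t1] l0 /andP[s0 s1].
have /andP[A0 A1] := tri_Ai; have /andP[B0 B1] := tri_Bj.
have e0 : 0 < lam k t by rewrite lt0r l0 lam_ge0.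
have A1' : 0 < 1 - A i r by rewrite subr_gt0.
have e1 : lam k t <= 1.
  rewrite /lam; case: ifP => _; [|case: ifP => _; last exact: ler01]; rewrite ge_max ler01 /=.
    by rewrite ler_pdivrMr // mul1r lerD2r.
  by rewrite ler_pdivrMr // mul1r gerBl.
exists (lam k t); first by rewrite e0.
set e := lam k t in e0 e1 l0 *.
have h1 : 0 < 1 - e * (1 - s) by nra.
have es : 0 < s * e by rewrite mulr_gt0.
have es1 : s * e <= e by rewrite ler_piMl // ltW.
have main (g' : R) : 0 < g' < 1 - e * (1 - s) ->
  H s k t = g' *: q + (1 - e * (1 - s) - g') *: p + (e * (1 - s)) *: v ->
    exists g h, [/\ 0 < g < 1, 0 <= h < 1, H s k t = seg (seg p q g) v h,
      h = e * (1 - s) & g * (1 - h) = g'].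
  move=> /andP[g0 g1] E; exists (g' / (1 - e * (1 - s))), (e * (1 - s)); split=> //.
  - by rewrite divr_gt0 //= ltr_pdivrMr // mul1r.
  - by rewrite mulr_ge0 ?subr_ge0 ?(ltW e0) //= -subr_gt0.
  - rewrite E; apply/rowP => l; rewrite !segE !mxE; field.
    by rewrite gt_eqF.
  - by rewrite divfK // gt_eqF.
have [ki|ki] := eqVneq k i.
  have eE : e = (t - A i r) / (1 - A i r).
    move: e0; rewrite /e ki lam_i lt_max ltxx /= => pos.
    by rewrite max_r // ltW.
  have At : A i r <= t.
    by rewrite -subr_ge0; move: e0; rewrite eE pmulr_lgt0 ?invr_gt0 // => /ltW.
  have tE : t = A i r + e * (1 - A i r) by rewrite eE divfK ?gt_eqF // addrC subrK.
  have HE : H s k t = seg p v e + (s * e) *: (m - v).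
    by rewrite /H -/e /a' /swept ki tri_Bi At t1 eE.
  have [||g [h [g01 h01 E hE ghE]]] := main (s * e / 2).
  - by apply/andP; split; [rewrite divr_gt0 | lra].
  - by rewrite HE /m /seg; apply/rowP => l; rewrite !mxE; field.
  - by exists g, h; split=> //; left.
have [kj|kj] := eqVneq k j; last by move: l0; rewrite /e /lam (negPf ki) (negPf kj) eqxx.
have eE : e = (B j r - t) / B j r.
  move: e0; rewrite /e kj lam_j lt_max ltxx /= => pos.
  by rewrite max_r // ltW.
have tB : t <= B j r.
  by rewrite -subr_ge0; move: e0; rewrite eE pmulr_lgt0 ?invr_gt0 // => /ltW.
have tE : t = (1 - e) * B j r by rewrite eE; field; rewrite gt_eqF.
have [_ _ vE _] := tri_junc.
have HE : H s k t = seg v q (1 - e) + (s * e) *: (m - v).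
  rewrite /H -/e /a' /swept kj tri_Aj t0 tB subr0 vE; congr (seg _ _ _ + _).
  by rewrite eE; field; rewrite gt_eqF.
have [||g [h [g01 h01 E hE ghE]]] := main (1 - e + s * e / 2).
- by apply/andP; split; lra.
- by rewrite HE /m /seg; apply/rowP => l; rewrite !mxE; field.
- by exists g, h; split=> //; right.
Qed.

Lemma tri_faces : [/\ face (F i) p, face (F i) q & face (F i) v].
Proof. by have [[fp _ _] [fq _ _] _ _] := tri_pq; have [_ [fv _ _] _ _] := tri_ci. Qed.

Lemma tri_inside (g h : R) : 0 < g < 1 -> 0 <= h < 1 ->
  [/\ face (F i) (seg (seg p q g) v h), sqnorm (seg (seg p q g) v h) < r &
      forall l, l != F i -> seg (seg p q g) v h 0 l <> 0].
Proof.
move=> g01 /andP[h0 h1]; have [fp fq fv] := tri_faces.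
have [[_ pr _] [_ qr _] pq pq0] := tri_pq.
have g01' : 0 <= g <= 1 by case/andP: g01 => g0 g1; rewrite !ltW.
have fx := seg_face fp fq g01'.
have xr := sqnorm_seg_lt pq g01 pr qr.
have x0 l : l != F i -> seg p q g 0 l <> 0.
  move=> li /(seg_eq0 (proj1 fp) (proj1 fq) g01)[pl ql]; exact: pq0 li pl ql.
have [->|hn0] := eqVneq h 0; first by rewrite seg0.
have h01 : 0 < h < 1 by rewrite lt0r hn0 h0.
have h01' : 0 <= h <= 1 by rewrite h0 ltW.
split; first exact: seg_face.
- apply: sqnorm_seg_lt => //; [|exact: ltW|by rewrite vr].
  by apply/eqP => xv; move: xr; rewrite xv vr ltxx.
- by move=> l li /(seg_eq0 (proj1 fx) (proj1 fv) h01)[xl _]; exact: x0 li xl.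
Qed.

Lemma tri_not_vertex (g h : R) : 0 < g < 1 -> 0 <= h < 1 ->
  seg (seg p q g) v h <> p /\ seg (seg p q g) v h <> q.
Proof.
move=> g01 h01; have [_ _ pq _] := tri_pq.
have key z : cr (F i) p q z = 0 -> seg (seg p q g) v h = z -> seg p q g = z.
  move=> crz E; move: crz; rewrite -E cr_seg cr_chord mulr0 add0r => /eqP.
  by rewrite mulf_eq0 (negPf tri_v) orbF => /eqP h0; rewrite h0 seg0.
split=> /key E.
  have := E (cr_left _ _ _); rewrite -[X in _ = X](seg0 p q) => /(seg_inj pq) g0.
  by move: g01; rewrite g0 ltxx.
have := E (cr_right _ _ _); rewrite -[X in _ = X](seg1 p q) => /(seg_inj pq) g0.
by move: g01; rewrite g0 ltxx andbF.
Qed.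

(** Below the level [r], another piece consists of its chord [[x, y]]. This chord crosses neither
    [[p, v]] nor [[v, q]], so [p] and [q] are weakly on the side of [v], which is off the line of
    the chord; one of them is strictly so, and the line misses the point considered. *)
Lemma tri_free k (u g h : R) : k \in J -> F k = F i -> 0 <= u <= 1 -> lam k u = 0 ->
  0 < g < 1 -> 0 <= h < 1 -> seg (seg p q g) v h <> a' k u.
Proof.
move=> kJ Fki u01 l0 g01 h01 E; have [fz zr _] := tri_inside g01 h01.
have [Fij arij vE nz] := tri_junc.
have /andP[A0 A1] := tri_Ai; have /andP[B0 B1] := tri_Bj.
have /andP[u0 u1] := u01.
have A1' : 0 < 1 - A i r by rewrite subr_gt0.
have AB k' (w : R) : k' \in J -> 0 <= w <= 1 -> sqnorm (a' k' w) < r -> A k' r <= w <= B k' r.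
  move=> kJ' w01; apply: contraTT; rewrite negb_and -!ltNge -leNgt => /orP wo.
  rewrite /a' (swept_out L) //; first by apply/ltW/(lv_out (L kJ') w01).
  by rewrite negb_and -!leNgt; case: wo => /ltW ->; rewrite ?orbT.
have uAB := AB k u kJ u01; rewrite -E in uAB; have {uAB} /andP[Au uB] := uAB zr.
have [np nq] := tri_not_vertex g01 h01.
have [ki|ki] := eqVneq k i.
  have uA : u = A i r.
    apply/eqP; rewrite eq_le; rewrite ki in Au; rewrite Au andbT -subr_le0.
    have : Num.max 0 ((u - A i r) / (1 - A i r)) <= 0 by rewrite -lam_i -ki l0.
    by rewrite ge_max lexx /= pmulr_lle0 ?invr_gt0.
  by apply: np; rewrite E ki uA /a' (swept_out L) // ltxx.
have [kj|kj] := eqVneq k j.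
  have uB' : u = B j r.
    apply/eqP; rewrite eq_le; rewrite kj in uB; rewrite uB /= -subr_le0.
    have : Num.max 0 ((B j r - u) / B j r) <= 0 by rewrite -lam_j -kj l0.
    by rewrite ge_max lexx /= pmulr_lle0 ?invr_gt0.
  by apply: nq; rewrite E kj uB' /a' (swept_out L) // ltxx andbF.
move/eqP: ki => ki; move/eqP: kj => kj.
have klow : sqnorm (a k (b k)) < r.
  rewrite ltNge; apply/negP => rk; have := lv_min (L kJ) u01.
  by move: zr; rewrite E /a' (swept_low L) // => zr /(le_trans rk); rewrite leNgt zr.
have ck := sweep_chord S L Hr kJ (lexx r) klow; rewrite Fki in ck.
set x := a k (A k r) in ck; set y := a k (B k r) in ck.
have crz : cr (F i) x y (seg (seg p q g) v h) = 0.
  by rewrite E /a' /swept Au uB /= cr_chord.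
have [Ak0 ABk Bk1 Ak1 Bk0] := lv01 L r kJ.
have Ak01 : 0 <= A k r <= 1 by rewrite Ak0.
have Bk01 : 0 <= B k r <= 1 by rewrite Bk0.
have A01 : 0 <= A i r <= 1 by rewrite A0 ltW.
have B01 : 0 <= B j r <= 1 by rewrite B1 ltW.
have Fik : F i = F k by [].
have Fjk : F j = F k by rewrite -Fij.
have [bp bv pv _] := tri_ci; have [_ bq vq _] := tri_cj.
have ABk' := lv_lt (L kJ) klow.
have vx : v != x.
  apply/eqP => /(sys_inj S iJ kJ Fik (r11 R) Ak01)[[/esym//]|[/eqP]|[_ _ e]].
    by rewrite oner_eq0.
  by apply: kj; apply: (junction_next S iJ jJ ij) => //; rewrite -e.
have vy : v != y.
  rewrite vE; apply/eqP => /(sys_inj S jJ kJ Fjk (r01 R) Bk01)[[/esym//]|[_ _ e]|[/esym/eqP]].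
    by apply: ki; apply: (junction_prev S iJ jJ ij) => //; rewrite -e.
  by rewrite oner_eq0.
have cv := cr_neq0 ck bv vx vy.
have side w : face (F i) w -> sqnorm w <= r ->
    (forall t u : R, 0 <= t <= 1 -> 0 < u < 1 -> seg x y t <> seg w v u) ->
    0 <= cr (F i) x y w * cr (F i) x y v.
  move=> fw wr dis; rewrite leNgt; apply/negP => neg; have [fv vr' _] := bv.
  have [t' [u' [t01 u01' E']]] := cross_chord ck fw fv wr vr' neg.
  exact: dis E'.
have Ai1 : B i r = 1 := tri_Bi.
have sp : 0 <= cr (F i) x y p * cr (F i) x y v.
  have [fp pr _] := bp; apply: side => // t' u' t01 u01' E'.
  have := @chords_disjoint R I J F ar st en a S b A B L r Hr i k u' t' iJ kJ
    (fun e => ki (esym e)) Fik ilow klow u01' t01.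
  by rewrite Ai1; apply.
have sq : 0 <= cr (F i) x y q * cr (F i) x y v.
  have [fq qr _] := bq; apply: side => // t' u' t01 u01' E'.
  have u01'' : 0 < 1 - u' < 1 by lra.
  have := @chords_disjoint R I J F ar st en a S b A B L r Hr j k (1 - u') t' jJ kJ
    (fun e => kj (esym e)) Fjk jlow klow u01'' t01.
  by rewrite tri_Aj -vE; apply; rewrite -/x -/y E' (seg_sym q v).
(* If both were on the line, they would be ends of the chord of [k]: then [k] would follow [j] and
   precede [i], against the numbering. *)
have cpq : cr (F i) x y p != 0 \/ cr (F i) x y q != 0.
  have [px|px] := eqVneq p x.
    case/(sys_inj S iJ kJ Fik A01 Ak01): (px) => [[/esym//]|[_ h1 _]|[h1 _ _]].
      by case: (lt1_absurd h1 ABk' Bk1).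
    by case: (lt1_absurd h1 A1 (lexx 1)).
  have [py|py] := eqVneq p y; last by left; exact: (cr_neq0 ck bp).
  right; apply: (cr_neq0 ck bq).
    apply/eqP => /(sys_inj S jJ kJ Fjk B01 Ak01)[[/esym//]|[h1 _ _]|[_ _ e2]].
      by move: B0; rewrite h1 ltxx.
    case/(sys_inj S iJ kJ Fik A01 Bk01): (py) => [[/esym//]|[_ _ e1]|[h1 _ _]].
      have := ltn_trans (sys_lt S iJ) _; rewrite ij => /(_ _ (sys_lt S jJ)).
      by rewrite e2 e1 ltnNge (ltnW (sys_lt S kJ)).
    by case: (lt1_absurd h1 A1 (lexx 1)).
  apply/eqP => /(sys_inj S jJ kJ Fjk B01 Bk01)[[/esym//]|[h1 _ _]|[_ h1 _]].
    by move: B0; rewrite h1 ltxx.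
  by case: (lt0_absurd h1 Ak0 ABk').
move: crz; rewrite !cr_seg; move: sp sq cpq cv.
set c1 := cr _ _ _ p; set c2 := cr _ _ _ q; set c3 := cr _ _ _ v.
move=> sp sq cpq cv /(congr1 ( *%R c3)); rewrite mulr0 => Z.
have /andP[g0 g1] := g01; have /andP[h0 h1] := h01.
have Z' : (1 - h) * ((1 - g) * (c1 * c3) + g * (c2 * c3)) + h * (c3 * c3) = 0.
  by rewrite -[RHS]Z; ring.
have c33 : 0 < c3 * c3 by rewrite -expr2 lt0r sqrf_eq0 cv sqr_ge0.
have t1 : 0 <= (1 - g) * (c1 * c3) by rewrite mulr_ge0 // subr_ge0 ltW.
have t2 : 0 <= g * (c2 * c3) by rewrite mulr_ge0 // ltW.
have pos : 0 < (1 - g) * (c1 * c3) + g * (c2 * c3).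
  case: cpq => cn0.
    rewrite ltr_pwDl // mulr_gt0 ?subr_gt0 // lt0r sp mulf_neq0 //.
  by rewrite ltr_wpDl // mulr_gt0 // lt0r sq mulf_neq0.
have : 0 < (1 - h) * ((1 - g) * (c1 * c3) + g * (c2 * c3)) + h * (c3 * c3).
  by rewrite ltr_pwDl ?mulr_gt0 ?subr_gt0 // mulr_ge0 // ltW.
by rewrite Z' ltxx.
Qed.

Let S' : sys J F ar st en a' := swept_sys S L Hr.

Lemma lam_edge k (t : R) l : k \in J -> 0 <= t <= 1 -> l != F k -> a' k t 0 l = 0 -> lam k t = 0.
Proof.
have [Fij _ vE nz] := tri_junc; have /andP[A0 A1] := tri_Ai; have /andP[B0 B1] := tri_Bj.
move=> kJ t01 lk l0; have [k_i|ki] := eqVneq k i.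
  subst k; rewrite lam_i; case: (coord0_end S' kJ t01 lk l0) => tE; subst t.
    by rewrite max_l // pmulr_lle0 ?invr_gt0 ?subr_gt0 // sub0r oppr_le0.
  by case: (nz l lk); move: l0; rewrite /a' (swept1 L).
have [k_j|kj] := eqVneq k j; last by rewrite /lam (negPf ki) (negPf kj).
subst k; rewrite lam_j; case: (coord0_end S' kJ t01 lk l0) => tE; subst t.
  rewrite -Fij in lk.
  by case: (nz l lk); move: l0; rewrite /a' (swept0 L) // -vE.
by rewrite max_l // pmulr_lle0 ?invr_gt0 // subr_le0.
Qed.

Lemma H_fixed s k (t : R) : lam k t = 0 -> H s k t = a' k t.
Proof. by rewrite /H => ->; rewrite mulr0 scale0r addr0. Qed.

Lemma H_face (s : R) k (t : R) : 0 <= s <= 1 -> k \in J -> 0 <= t <= 1 ->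
  face (F k) (H s k t) /\ same_open_face (a' k t) (H s k t).
Proof.
move=> s01 kJ t01; have fa := sys_face S' kJ t01.
have [sE|sn0] := eqVneq s 0; first by rewrite /H sE mul0r scale0r addr0.
have [l0|l0] := eqVneq (lam k t) 0; first by rewrite H_fixed.
have {}s01 : 0 < s <= 1 by rewrite lt0r sn0.
have [e e01 [g [h [g01 h01 E _ cases]]]] := moved t01 l0 s01.
have [Fij _ _ _] := tri_junc.
have Fk : F k = F i by case: cases => [[-> _ _]|[-> _ _]].
have [fz _ nz] := tri_inside g01 h01.
rewrite E Fk; split=> // l; have [li|li] := eqVneq l (F i).
  by rewrite li (proj2 fz) -Fk (proj2 fa).
rewrite (introF eqP (nz l li)); apply/negbTE/eqP => al0.
by move/eqP: l0; apply; apply: (lam_edge kJ t01 _ al0); rewrite Fk.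
Qed.

Lemma lam_ends : [/\ lam i 0 = 0, lam i 1 = 1, lam j 0 = 1 & lam j 1 = 0].
Proof.
have /andP[A0 A1] := tri_Ai; have /andP[B0 B1] := tri_Bj; split.
- by rewrite lam_i max_l // pmulr_lle0 ?invr_gt0 ?subr_gt0 // sub0r oppr_le0.
- by rewrite lam_i divff ?max_r ?ler01 // subr_eq0 gt_eqF.
- by rewrite lam_j subr0 divff ?max_r ?ler01 // gt_eqF.
- by rewrite lam_j max_l // pmulr_lle0 ?invr_gt0 // subr_le0.
Qed.

Lemma lam_other k (t : R) : k <> i -> k <> j -> lam k t = 0.
Proof. by move=> /eqP/negPf ki /eqP/negPf kj; rewrite /lam ki kj. Qed.

Lemma H_junc (s : R) k k' : k \in J -> k' \in J -> en k = st k' -> H s k 1 = H s k' 0.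
Proof.
move=> kJ kJ' e; have [_ _ E _] := sys_junc S' kJ kJ' e.
have [i0 i1 j0 j1] := lam_ends.
suff l_eq : lam k 1 = lam k' 0 by rewrite /H E l_eq.
have [k_i|/eqP ki] := eqVneq k i.
  subst k; have -> : k' = j by apply: (junction_next S iJ jJ ij) => //; rewrite -e ij.
  by rewrite i1 j0.
have kj : k' <> j by move=> k'j; apply: ki; apply: (junction_prev S iJ jJ ij) => //;
  rewrite e k'j ij.
have -> : lam k 1 = 0.
  by have [->//|/eqP k_j] := eqVneq k j; rewrite lam_other.
by have [->//|/eqP k_i] := eqVneq k' i; rewrite lam_other.
Qed.

(** The weights of [v] and [q] determine the point of the pair of chords. At [s = 1] the weight of
    [v] is 0 and that of [q] decides: it is at most 1/2 on the piece [i] and at least 1/2 on [j],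
    with equality at the junction only. *)
Lemma H_inj (s : R) k k' (t u : R) : 0 <= s <= 1 -> k \in J -> k' \in J -> F k = F k' ->
  0 <= t <= 1 -> 0 <= u <= 1 -> H s k t = H s k' u -> a' k t = a' k' u.
Proof.
move=> s01 kJ kJ' Fkk t01 u01.
have [sE|sn0] := eqVneq s 0; first by rewrite /H sE !mul0r !scale0r !addr0.
have {}s01 : 0 < s <= 1 by rewrite lt0r sn0.
have [Fij _ vE _] := tri_junc.
have /andP[A0 A1] := tri_Ai; have /andP[B0 B1] := tri_Bj.
have [lt0|lt0] := eqVneq (lam k t) 0; have [lu0|lu0] := eqVneq (lam k' u) 0.
- by rewrite !H_fixed.
- have [e e01 [g [h [g01 h01 E _ cases]]]] := moved u01 lu0 s01.
  have Fk : F k = F i by rewrite Fkk; case: cases => [[-> _ _]|[-> _ _]].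
  by rewrite E (H_fixed _ lt0) => /esym /(tri_free kJ Fk t01 lt0 g01 h01).
- have [e e01 [g [h [g01 h01 E _ cases]]]] := moved t01 lt0 s01.
  have Fk : F k' = F i by rewrite -Fkk; case: cases => [[-> _ _]|[-> _ _]].
  by rewrite E (H_fixed _ lu0) => /(tri_free kJ' Fk u01 lu0 g01 h01).
have [e e01 [g [h [g01 h01 E hE cases]]]] := moved t01 lt0 s01.
have [e' e01' [g' [h' [g01' h01' E' hE' cases']]]] := moved u01 lu0 s01.
rewrite E E' => Z.
have hh : h = h'.
  have := congr1 (cr (F i) p q) Z; rewrite !(cr_seg _ _ _ (seg p q _)) !cr_chord !mulr0 !add0r.
  by apply: mulIf; exact: tri_v.
have gg : g = g'.
  have [_ _ pq _] := tri_pq; apply: (seg_inj pq); rewrite -hh in Z; apply: seg_eq_left Z.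
  by rewrite lt_eqF //; case/andP: h01.
have heq : e * (1 - s) = e' * (1 - s) by rewrite -hE -hE' hh.
have gheq : g * (1 - h) = g' * (1 - h') by rewrite gg hh.
have /andP[s0 s1] := s01; have /andP[e0 e1] := e01; have /andP[e0' e1'] := e01'.
case: cases cases' => [[ki gh tE]|[kj gh tE]] [[ki' gh' uE]|[kj' gh' uE]].
- have ee : e = e'.
    by apply: (mulfI (x := s)); rewrite ?gt_eqF //; lra.
  by rewrite ki ki' tE uE ee.
- have es : s * e / 2 = 1 - e' + s * e' / 2 by rewrite -gh -gh'.
  have [e_1 e'_1] : e = 1 /\ e' = 1.
    have [s_1|s_1] := eqVneq s 1; first by rewrite s_1 in es; split; lra.
    have ee : e = e' by apply: (mulIf (x := 1 - s)); rewrite // subr_eq0 eq_sym.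
    by rewrite ee in es *; split; lra.
  rewrite ki kj' tE uE e_1 e'_1 mul1r addrC subrK subrr mul0r.
  by have [_ _ -> _] := sys_junc S' iJ jJ ij.
- have es : s * e' / 2 = 1 - e + s * e / 2 by rewrite -gh -gh'.
  have [e_1 e'_1] : e = 1 /\ e' = 1.
    have [s_1|s_1] := eqVneq s 1; first by rewrite s_1 in es; split; lra.
    have ee : e = e' by apply: (mulIf (x := 1 - s)); rewrite // subr_eq0 eq_sym.
    by rewrite -ee in es *; split; lra.
  rewrite kj ki' tE uE e_1 e'_1 mul1r [A i r + _]addrC subrK subrr mul0r.
  by have [_ _ -> _] := sys_junc S' iJ jJ ij.
- have ee : e = e'.
    have [s_1|s_1] := eqVneq s 1; first by rewrite s_1 in gh gh'; lra.
    by apply: (mulIf (x := 1 - s)); rewrite // subr_eq0 eq_sym.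
  by rewrite kj kj' tE uE ee.
Qed.

Lemma H_pattern (s : R) k k' (t u : R) : 0 <= s <= 1 -> k \in J -> k' \in J ->
  0 <= t <= 1 -> 0 <= u <= 1 -> H s k t = H s k' u <-> a' k t = a' k' u.
Proof.
move=> s01; apply: (family_pattern (b := H s) S').
- by move=> x w xJ w01; exact: H_face.
- by move=> x w l xJ w01 lx l0; rewrite H_fixed // (lam_edge xJ w01 lx l0).
- by move=> x y xJ yJ; exact: H_junc.
- by move=> x y w z; exact: H_inj.
Qed.

Lemma cts_lam k : continuous (lam k).
Proof.
have c0 : continuous (fun _ : R => 0 : R) by exact: cts_cst.
have [k_i|ki] := eqVneq k i.
  have -> : lam k = (fun t => Num.max 0 ((t - A i r) / (1 - A i r))).
    by apply/funext => t; rewrite k_i lam_i.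
  apply: cts_max => //; apply: cts_mul; last exact: cts_cst.
  by apply: cts_subR; [exact: cts_id | exact: cts_cst].
have [k_j|kj] := eqVneq k j.
  have -> : lam k = (fun t => Num.max 0 ((B j r - t) / B j r)).
    by apply/funext => t; rewrite k_j lam_j.
  apply: cts_max => //; apply: cts_mul; last exact: cts_cst.
  by apply: cts_subR; [exact: cts_cst | exact: cts_id].
have -> : lam k = (fun _ => 0) by apply/funext => t; rewrite lam_other //; apply/eqP.
by [].
Qed.

Lemma cts_H k : k \in J -> continuous (fun z : R * R => H z.1 k z.2).
Proof.
move=> kJ; apply: (@cts_add R _ 'rV[R]_4).
  by apply: cts_comp (sys_cts S' kJ); exact: cts_snd.
apply: (@cts_scale R _ 'rV[R]_4); last exact: cts_cst.
apply: cts_mul; first exact: cts_fst.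
by apply: (cts_comp (@cts_snd R R)); exact: cts_lam.
Qed.

(** At the end of the push the two chords are the two halves of [[p, q]]. *)
Lemma H1_i (t : R) : A i r <= t <= 1 -> H 1 i t = seg p q (2^-1 * ((t - A i r) / (1 - A i r))).
Proof.
have /andP[A0 A1] := tri_Ai; move=> /andP[At t1].
have nn : 0 <= (t - A i r) / (1 - A i r) by rewrite divr_ge0 ?subr_ge0 // ltW.
rewrite /H lam_i max_r // /a' /swept tri_Bi At t1 mul1r /m -/p -/v.
by apply/rowP => l; rewrite /seg !mxE; field; rewrite subr_eq0 gt_eqF.
Qed.

Lemma H1_j (t : R) : 0 <= t <= B j r -> H 1 j t = seg p q (2^-1 + 2^-1 * (t / B j r)).
Proof.
have /andP[B0 B1] := tri_Bj; have [_ _ vE _] := tri_junc; move=> /andP[t0 tB].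
have nn : 0 <= (B j r - t) / B j r by rewrite divr_ge0 ?subr_ge0 // ltW.
rewrite /H lam_j max_r // /a' /swept tri_Aj t0 tB mul1r /m !subr0 -vE -/q.
by apply/rowP => l; rewrite /seg !mxE; field; rewrite gt_eqF.
Qed.

Lemma H1_out k (t : R) : k \in J -> (k = i /\ t < A i r) \/ (k = j /\ B j r < t) -> 0 <= t <= 1 ->
  r < sqnorm (a' k t) /\ H 1 k t = a' k t.
Proof.
have /andP[A0 A1] := tri_Ai; have /andP[B0 B1] := tri_Bj.
move=> kJ cases t01; split.
  have out : t < A k r \/ B k r < t by case: cases => [[->]|[->]]; [left|right].
  rewrite /a' (swept_out L) //; first exact: (lv_out (L kJ)).
  by rewrite negb_and -!leNgt; case: out => /ltW ->; rewrite ?orbT.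
apply: H_fixed; case: cases => [[-> tA]|[-> tB]].
  by rewrite lam_i max_l // pmulr_lle0 ?invr_gt0 ?subr_gt0 // subr_le0 ltW.
by rewrite lam_j max_l // pmulr_lle0 ?invr_gt0 // subr_le0 ltW.
Qed.

Lemma seg_pq_le (k : R) : 0 <= k <= 1 -> sqnorm (seg p q k) <= r.
Proof. by move=> k01; have [[_ pr _] [_ qr _] _ _] := tri_pq; exact: sqnorm_seg_le. Qed.

Lemma H1_sqc k : k \in J -> sqc (fun t => sqnorm (H 1 k t)).
Proof.
have /andP[A0 A1] := tri_Ai; have /andP[B0 B1] := tri_Bj; have [_ _ vE _] := tri_junc.
have [[_ pr _] [_ qr _] pq _] := tri_pq.
have [h0 h1 h2 h3] := half_facts R.
move=> kJ; have sq := sys_sqc S' kJ; have [k_i|ki] := eqVneq k i.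
  subst k; have A1' : 0 < 1 - A i r by rewrite subr_gt0.
  have frac (w : R) : A i r <= w <= 1 -> 0 <= (w - A i r) / (1 - A i r) <= 1.
    move=> /andP[Aw w1]; rewrite divr_ge0 ?subr_ge0 ?(ltW A1) //=.
    by rewrite ler_pdivrMr // mul1r lerD2r.
  apply: (sqc_glue (x0 := A i r) (x1 := 1) (r := r) sq) => //; rewrite ?(ltW A1) //.
  - move=> w w01 [wA|w1]; last by case/andP: w01 => _; rewrite leNgt w1.
    by have [lt_o ->] := H1_out kJ (or_introl (conj erefl wA)) w01.
  - by rewrite /a' (swept_out L) // ltxx.
  - by rewrite /a' (swept1 L) // vr.
  - by move=> w wA; rewrite H1_i //; apply: seg_pq_le; have := frac w wA; lra.
  - move=> x y z Ax xy yz z1; rewrite !H1_i; try (by apply/andP; split; lra).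
    by apply: seg_sqc => //; rewrite ltr_pM2l // ltr_pM2r ?invr_gt0 // ltrD2r.
have [k_j|kj] := eqVneq k j; last first.
  have E : (fun t => sqnorm (H 1 k t)) = (fun t => sqnorm (a' k t)).
    by apply/funext => t; rewrite H_fixed // lam_other //; apply/eqP.
  by rewrite E.
subst k; have frac (w : R) : 0 <= w <= B j r -> 0 <= w / B j r <= 1.
  move=> /andP[w0 wB]; rewrite divr_ge0 ?(ltW B0) //=.
  by rewrite ler_pdivrMr // mul1r.
apply: (sqc_glue (x0 := 0) (x1 := B j r) (r := r) sq) => //; rewrite ?(ltW B0) //.
- move=> w w01 [w0|wB]; first by case/andP: w01; rewrite leNgt w0.
  by have [lt_o ->] := H1_out kJ (or_intror (conj erefl wB)) w01.
- by rewrite /a' (swept0 L) // -vE vr.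
- by rewrite /a' (swept_out L) // ltxx andbF.
- by move=> w wA; rewrite H1_j //; apply: seg_pq_le; have := frac w wA; lra.
- move=> x y z Ax xy yz z1; rewrite !H1_j; try (by apply/andP; split; lra).
  by apply: seg_sqc => //; rewrite ltrD2l ltr_pM2l // ltr_pM2r ?invr_gt0.
Qed.

Lemma tri_sys : sys J F ar st en (H 1).
Proof.
have r1 := r11 R.
have coord0 k (t : R) l : k \in J -> 0 <= t <= 1 -> H 1 k t 0 l = 0 <-> a' k t 0 l = 0.
  move=> kJ t01; have [_ /(_ l) E] := H_face r1 kJ t01.
  by split=> /eqP h; apply/eqP; rewrite ?E // -E.
split.
- move=> k kJ; have := cts_H kJ; apply: (@cts_comp _ _ _ (fun t : R => ((1 : R), t))).
  by apply: cts_pair; [exact: cts_cst | exact: cts_id].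
- by move=> k t kJ t01; have [] := H_face r1 kJ t01.
- move=> k t l kJ t01 lk; have t01' : 0 <= t <= 1 by case/andP: t01 => t0 t1; rewrite !ltW.
  by move/(coord0 _ _ _ kJ t01'); exact: (sys_int S' kJ t01 lk).
- move=> k k' l kJ kJ' ark lk /(coord0 _ _ _ kJ (r01 R)) l0 /(coord0 _ _ _ kJ' r1).
  exact: (sys_edge S' kJ kJ' ark lk l0).
- by move=> k k' t u kJ kJ' Fkk t01 u01 /(H_pattern r1 kJ kJ' t01 u01); exact: (sys_inj S').
- exact: (sys_lt S').
- move=> k k' kJ kJ' e; have [Fkk ark E nz] := sys_junc S' kJ kJ' e; split=> //.
    exact: H_junc.
  by move=> l lk /(coord0 _ _ _ kJ r1); exact: nz.
- move=> k kJ nz; apply: (sys_start S' kJ) => l lk l0; apply: (nz l lk).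
  by apply/(coord0 _ _ _ kJ (r01 R)).
- move=> k kJ nz; apply: (sys_end S' kJ) => l lk l0; apply: (nz l lk).
  by apply/(coord0 _ _ _ kJ r1).
- exact: H1_sqc.
Qed.

Lemma tri_iso : isoS (img J a') (img J (H 1)).
Proof.
have H0 : img J a' = img J (H 0) by apply: img_ext => k t _ _; rewrite /H mul0r scale0r addr0.
have E0 k (t : R) : H 0 k t = a' k t by rewrite /H mul0r scale0r addr0.
rewrite H0; apply: isoS_family.
- exact: cts_H.
- by move=> s k k' t u s01 kJ kJ' t01 u01; rewrite !E0; exact: H_pattern.
- by move=> s k t s01 kJ t01; rewrite E0; have [[sx _] fx] := H_face s01 kJ t01.
Qed.

(** The squared norm is strictly quasi-convex along [[p, q]], so if [m] is not lowest on the half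
    towards [p], it is lowest on the half towards [q]. Outside the chords the two pieces are above
    [r]. *)
Lemma tri_nopeak :
  (forall t : R, 0 <= t <= 1 -> sqnorm (H 1 i 1) <= sqnorm (H 1 i t)) \/
  (forall t : R, 0 <= t <= 1 -> sqnorm (H 1 j 0) <= sqnorm (H 1 j t)).
Proof.
have /andP[A0 A1] := tri_Ai; have /andP[B0 B1] := tri_Bj.
have [[_ pr _] [_ qr _] pq _] := tri_pq.
have [h0 h1 h2 h3] := half_facts R.
have A1' : 0 < 1 - A i r by rewrite subr_gt0.
have mi : H 1 i 1 = m by rewrite H1_i ?(ltW A1) ?lexx // divff ?mulr1 // gt_eqF.
have mj : H 1 j 0 = m by rewrite H1_j ?(ltW B0) ?lexx // mul0r mulr0 addr0.
have mr : sqnorm m <= r by apply: seg_pq_le; lra.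
have [mini|] := pselect (forall k : R, 0 <= k < 2^-1 -> sqnorm m <= sqnorm (seg p q k)).
  left=> t t01; rewrite mi; have [tA|At] := ltP t (A i r).
    have [lt_o ->] := H1_out iJ (or_introl (conj erefl tA)) t01.
    by apply: le_trans mr (ltW lt_o).
  have /andP[_ t1] := t01; rewrite H1_i ?At //.
  have f0 : 0 <= (t - A i r) / (1 - A i r) by rewrite divr_ge0 ?subr_ge0 // ltW.
  have f1 : (t - A i r) / (1 - A i r) <= 1 by rewrite ler_pdivrMr // mul1r lerD2r.
  have [fE|fE] := eqVneq ((t - A i r) / (1 - A i r)) 1; first by rewrite fE mulr1.
  apply: mini; rewrite mulr_ge0 ?(ltW h0) //= gtr_pMr //.
  by rewrite lt_neqAle fE.
move=> /existsNP[k1 /not_implyP[k1h /negP]]; rewrite -ltNge => k1m.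
right=> t t01; rewrite mj; have [Bt|tB] := ltP (B j r) t.
  have [lt_o ->] := H1_out jJ (or_intror (conj erefl Bt)) t01.
  by apply: le_trans mr (ltW lt_o).
have /andP[t0 _] := t01; rewrite H1_j ?t0 //.
have [->|tn0] := eqVneq t 0; first by rewrite mul0r mulr0 addr0.
have f0 : 0 < t / B j r by rewrite divr_gt0 // lt0r tn0.
have lt1 : k1 < 2^-1 by case/andP: k1h.
have lt2 : 2^-1 < 2^-1 + 2^-1 * (t / B j r) by rewrite ltrDl mulr_gt0.
case: (seg_sqc pq lt1 lt2) => [|/ltW//].
by rewrite ltNge (ltW k1m).
Qed.

End Triangle.

(** * Straight arcs *)

Lemma iso_trans (R : realType) (L L' L'' : set 'rV[R]_4) :
  closed L -> iso L L' -> iso L' L'' -> iso L L''.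
Proof.
move=> cL [h hiso <-] [k kiso <-].
by have [e eiso eE] := normal_isotopy_trans cL hiso kiso; exists e.
Qed.

Lemma isoS_trans (R : realType) (L L' L'' : set 'rV[R]_4) :
  closed L -> closed L'' -> isoS L L' -> isoS L' L'' -> isoS L L''.
Proof.
move=> cL cL'' [h1 h2] [k1 k2]; split; first exact: iso_trans cL h1 k1.
exact: iso_trans cL'' k2 h2.
Qed.

Lemma img_closed (R : realType) (I : finType) (J : {set I}) (a : I -> R -> 'rV[R]_4) :
  (forall i, i \in J -> continuous (a i)) -> closed (img J a).
Proof.
move=> ca.
have -> : img J a = \bigcup_(i in [set` J]) (a i @` `[0, 1]%classic).
  apply/seteqP; split=> x.
    by move=> [i [t [iJ t01 <-]]]; exists i => //; exists t => //=; rewrite in_itv.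
  by move=> [i iJ [t]] /=; rewrite in_itv /= => t01 <-; exists i, t.
apply: closed_bigcup => [|i iJ]; first exact: finite_finset.
apply: compact_closed; first exact: norm_hausdorff.
by apply: continuous_compact; [apply: continuous_subspaceT; apply: ca | exact: segment_compact].
Qed.

Lemma ex_minimizer (R : realType) (T : finType) (P : pred T) (g : T -> R) (x0 : T) :
  P x0 -> exists x, P x /\ forall y, P y -> g x <= g y.
Proof. by move=> Px0; case: (arg_minP g Px0) => x Px xmin; exists x. Qed.

(** The junction is taken of minimal level, so that sweeping up to this level passes no other
    junction. In either case one piece disappears. *)
Lemma reduce_step (R : realType) (I : finType) (J : {set I}) (F : I -> 'I_4)
    (ar st en : I -> nat) (a : I -> R -> 'rV[R]_4) (i0 j0 : I) :
  sys J F ar st en a -> i0 \in J -> j0 \in J -> en i0 = st j0 ->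
  exists (J' : {set I}) (en' : I -> nat) (a' : I -> R -> 'rV[R]_4),
    [/\ (#|J'| < #|J|)%N, sys J' F ar st en' a' &
    isoS (img J a) (img J' a')].
Proof.
move=> S i0J j0J ij0.
pose P (w : I * I) := [&& w.1 \in J, w.2 \in J & en w.1 == st w.2].
have Pw0 : P (i0, j0) by rewrite /P /= i0J j0J ij0 eqxx.
have [[i j] [/and3P[/= iJ jJ /eqP ij] ijmin]] := ex_minimizer (fun w => sqnorm (a w.1 1)) Pw0.
have Hr k l : k \in J -> l \in J -> en k = st l -> sqnorm (a i 1) <= sqnorm (a k 1).
  by move=> kJ lJ kl; apply: (ijmin (k, l)); rewrite /P /= kJ lJ kl eqxx.
have card : (#|J :\ j| < #|J|)%N by rewrite (cardsD1 j J) jJ.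
have [nopeak|peak] := pselect
    ((forall t : R, 0 <= t <= 1 -> sqnorm (a i 1) <= sqnorm (a i t)) \/
     (forall t : R, 0 <= t <= 1 -> sqnorm (a j 0) <= sqnorm (a j t))).
  do 3?eexists; split; [exact: card | exact: (merge_sys S iJ jJ ij nopeak) |].
  rewrite (merge_img S iJ jJ ij).
  have aE : img J a = img J (fun i => (fun s i t => a i t) (0 : R) i) by [].
  rewrite {1}aE; apply: (@isoS_family R I J (fun _ : R => a)) => //.
    by move=> k kJ; apply: (cts_comp (@cts_snd R R)); exact: (sys_cts S).
  by move=> s k t _ kJ t01; split=> //; have [] := sys_face S kJ t01.
have lev k : exists bAB : R * (R -> R) * (R -> R),
    k \in J -> levels (fun t => sqnorm (a k t)) bAB.1.1 bAB.1.2 bAB.2.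
  have [kJ|kJ] := boolP (k \in J); last by exists (0, id, id).
  have [|b [A [B lv]]] := sqc_levels _ (sys_sqc S kJ); last by exists (b, A, B).
  exact: cts_sqnorm (sys_cts S kJ).
have [bAB L] := boolp.choice lev.
have [_ _ E _] := sys_junc S iJ jJ ij.
have ilow : sqnorm (a i (bAB i).1.1) < sqnorm (a i 1).
  rewrite ltNge; apply/negP => low; apply: peak; left=> t t01.
  by apply: le_trans low _; apply: (lv_min (L i iJ)).
have jlow : sqnorm (a j (bAB j).1.1) < sqnorm (a i 1).
  rewrite ltNge; apply/negP => low; apply: peak; right=> t t01.
  by rewrite -E; apply: le_trans low _; apply: (lv_min (L j jJ)).
have S2 := tri_sys S L Hr iJ jJ ij erefl ilow jlow.
have np := tri_nopeak S L Hr iJ jJ ij erefl ilow jlow.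
do 3?eexists; split; [exact: card | exact: (merge_sys S2 iJ jJ ij np) |].
rewrite (merge_img S2 iJ jJ ij).
have S1 := swept_sys S L Hr.
apply: (isoS_trans (L' := img J (fun k => swept (a k) (bAB k).1.2 (bAB k).2 (sqnorm (a i 1))))).
- by apply: img_closed; exact: (sys_cts S).
- by apply: img_closed; exact: (sys_cts S2).
- by apply: (swept_iso S L Hr); exact: sqnorm_ge0.
- exact: (tri_iso S L Hr iJ jJ ij erefl ilow jlow).
Qed.

Lemma reduce_all (R : realType) (I : finType) (J : {set I}) (F : I -> 'I_4)
    (ar st en : I -> nat) (a : I -> R -> 'rV[R]_4) :
  sys J F ar st en a ->
  exists J' en' a', [/\ sys J' F ar st en' a', isoS (img J a) (img J' a') &
    forall i j, i \in J' -> j \in J' -> en' i <> st j].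
Proof.
have [n] := ubnP #|J|; elim: n J en a => // n IHn J en a ltn S.
have [[i [j [iJ jJ ij]]]|no] := pselect (exists i j, [/\ i \in J, j \in J & en i = st j]).
  have [J1 [en1 [a1 [lt1 S1 iso1]]]] := reduce_step S iJ jJ ij.
  have [J2 [en2 [a2 [S2 iso2 no2]]]] := IHn J1 en1 a1 (leq_trans lt1 ltn) S1.
  exists J2, en2, a2; split=> //; apply: isoS_trans iso1 iso2.
    by apply: img_closed; exact: (sys_cts S).
  by apply: img_closed; exact: (sys_cts S2).
exists J, en, a; split=> // [|i j iJ jJ ij]; last by apply: no; exists i, j.
apply: (@isoS_family R I J (fun _ : R => a)) => //.
  by move=> k kJ; apply: (cts_comp (@cts_snd R R)); exact: (sys_cts S).
by move=> s k t _ kJ t01; split=> //; have [] := sys_face S kJ t01.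
Qed.

(** Segments of different faces may share an end on an edge, so injectivity is imposed within each
    face only. *)
Record straight (R : realType) (I : finType) (J : {set I}) (F : I -> 'I_4)
    (P Q : I -> 'rV[R]_4) : Prop := Straight {
  str_P : forall i, i \in J -> face (F i) (P i) /\ exists2 l, l != F i & P i 0 l = 0;
  str_Q : forall i, i \in J -> face (F i) (Q i) /\ exists2 l, l != F i & Q i 0 l = 0;
  str_edge : forall i l, i \in J -> l != F i -> P i 0 l = 0 -> Q i 0 l <> 0;
  str_inj : forall (i j : I) (t u : R), i \in J -> j \in J -> F i = F j ->
    0 <= t <= 1 -> 0 <= u <= 1 -> seg (P i) (Q i) t = seg (P j) (Q j) u -> i = j /\ t = u
}.

(** Squared norms on the simplex are at most 1: once no junction is left, raising the level to 1
    turns each piece into the segment between its ends. *)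
Lemma sys_straight (R : realType) (I : finType) (J : {set I}) (F : I -> 'I_4)
    (ar st en : I -> nat) (a : I -> R -> 'rV[R]_4) :
  sys J F ar st en a ->
  exists (J' : {set I}) P Q, straight J' F P Q /\
    isoS (img J a) (img J' (fun i => seg (P i) (Q i))).
Proof.
move=> S0; have [J' [en' [c [S iso1 no]]]] := reduce_all S0.
have lev k : exists bAB : R * (R -> R) * (R -> R),
    k \in J' -> levels (fun t => sqnorm (c k t)) bAB.1.1 bAB.1.2 bAB.2.
  have [kJ|kJ] := boolP (k \in J'); last by exists (0, id, id).
  have [|b [A [B lv]]] := sqc_levels _ (sys_sqc S kJ); last by exists (b, A, B).
  exact: cts_sqnorm (sys_cts S kJ).
have [bAB L] := boolp.choice lev.
have Hr k l : k \in J' -> l \in J' -> en' k = st l -> 1 <= sqnorm (c k 1).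
  by move=> kJ lJ kl; case: (no k l).
pose d k := swept (c k) (bAB k).1.2 (bAB k).2 1.
have dE k (t : R) : k \in J' -> 0 <= t <= 1 -> d k t = seg (c k 0) (c k 1) t.
  move=> kJ t01; have [A0 AB B1 A1 B0] := lv01 L 1 kJ.
  have le1 (w : R) : 0 <= w <= 1 -> ~ 1 < sqnorm (c k w).
    move=> w01; apply/negP; rewrite -leNgt; apply: sqnorm_simplex.
    by have [] := sys_face S kJ w01.
  have AE : (bAB k).1.2 1 = 0.
    apply/eqP; rewrite eq_le A0 andbT leNgt; apply/negP => Apos.
    exact: le1 (r01 R) (lv_out (L k kJ) (r01 R) (or_introl Apos)).
  have BE : (bAB k).2 1 = 1.
    apply/eqP; rewrite eq_le B1 /= leNgt; apply/negP => Blt.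
    exact: le1 (r11 R) (lv_out (L k kJ) (r11 R) (or_intror Blt)).
  by rewrite /d /swept AE BE t01 !subr0 divr1.
have S2 := swept_sys S L Hr.
have ends k : k \in J' -> (exists2 l, l != F k & c k 0 0 l = 0) /\
    (exists2 l, l != F k & c k 1 0 l = 0).
  move=> kJ; split; apply: contrapT => nz.
    have [|l lJ e] := sys_start S kJ; last exact: (no l k).
    by move=> l lk l0; apply: nz; exists l.
  have [|l lJ e] := sys_end S kJ; last exact: (no k l).
  by move=> l lk l0; apply: nz; exists l.
exists J', (fun k => c k 0), (fun k => c k 1); split.
  split.
  - by move=> k kJ; split; [exact: (sys_face S kJ (r01 R)) | have [] := ends k kJ].
  - by move=> k kJ; split; [exact: (sys_face S kJ (r11 R)) | have [] := ends k kJ].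
  - by move=> k l kJ lk; exact: (sys_edge S kJ kJ erefl lk).
  - move=> k l t u kJ lJ Fkl t01 u01; rewrite -!dE // => E.
    case: (sys_inj S2 kJ lJ Fkl t01 u01 E) => [//|[_ _ e]|[_ _ e]].
      by case: (no l k).
    by case: (no k l).
have -> : img J' (fun i => seg (c i 0) (c i 1)) = img J' d.
  by apply: img_ext => k t kJ t01; rewrite dE.
apply: isoS_trans iso1 _; first by apply: img_closed; exact: (sys_cts S0).
  by apply: img_closed; exact: (sys_cts S2).
by apply: (swept_iso S L Hr); exact: ler01.
Qed.

(** * Linear interpolation between straight systems *)

Lemma nonvanishing_pos (R : realType) (f : R -> R) (s : R) :
  continuous f -> (forall t : R, 0 <= t <= s -> f t != 0) -> 0 <= s -> 0 < f 0 -> 0 < f s.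
Proof.
move=> cf nz s0 f0; rewrite ltNge; apply/negP => fs.
have [||t] := @IVT R f 0 s 0 s0; first exact: continuous_subspaceT.
  by rewrite ge_min fs orbT le_max (ltW f0).
by rewrite in_itv /= => /nz/negP + /eqP.
Qed.

Lemma seg_coord_eq0 (R : realType) (p q : 'rV[R]_4) (t : R) (l : 'I_4) :
  simplex p -> simplex q -> 0 <= t <= 1 ->
  (seg p q t 0 l == 0) = ((t == 1) || (p 0 l == 0)) && ((t == 0) || (q 0 l == 0)).
Proof.
move=> sp sq t01; have [->|t0] := eqVneq t 0.
  by rewrite seg0 [(0 : R) == 1]eq_sym oner_eq0 /= andbT.
have [->|t1] := eqVneq t 1; first by rewrite seg1.
have {}t01 : 0 < t < 1 by case/andP: t01 => t0' t1'; rewrite !lt_neqAle t1 eq_sym t0 t0'.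
apply/idP/idP => [/eqP/(seg_eq0 sp sq t01)[-> ->]|/andP[/eqP p0 /eqP q0]]; first by rewrite eqxx.
by rewrite segE p0 q0 !mulr0 addr0.
Qed.

Lemma interp_lt (R : realType) (s a b a' b' : R) : 0 <= s <= 1 -> a < b -> a' < b' ->
  (1 - s) * a + s * a' < (1 - s) * b + s * b'.
Proof.
move=> /andP[s0 s1] ab ab'; have [->|s1'] := eqVneq s 1; first by lra.
have {}s1 : s < 1 by rewrite lt_neqAle s1'.
by nra.
Qed.

(** Vanishing coordinates tell the edge of a node; comparisons tell its place among the nodes of
    that edge, including which nodes are equal. *)
Definition same_order (R : realType) (n : nat) (q q' : 'I_n -> 'rV[R]_4) : Prop :=
  (forall k r l, (q k 0 l <= q r 0 l) = (q' k 0 l <= q' r 0 l)) /\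
  (forall k l, (q k 0 l == 0) = (q' k 0 l == 0)).

Section Interpolation.
Variables (R : realType) (n : nat) (q q' : 'I_n -> 'rV[R]_4).
Variable G : {set 'I_n * 'I_n * 'I_4}.
Let P (q : 'I_n -> 'rV[R]_4) (g : 'I_n * 'I_n * 'I_4) := q g.1.1.
Let Q (q : 'I_n -> 'rV[R]_4) (g : 'I_n * 'I_n * 'I_4) := q g.1.2.
Let F (g : 'I_n * 'I_n * 'I_4) := g.2.
Hypotheses (qS : straight G F (P q) (Q q)) (q'S : straight G F (P q') (Q q')).
Hypothesis qq' : same_order q q'.

Let qs (s : R) k := seg (q k) (q' k) s.

Lemma interp_eq (s : R) k r : 0 <= s <= 1 -> qs s k = qs s r <-> q k = q r.
Proof.
move=> s01; have [cmp _] := qq'; split=> [E|E].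
  apply/rowP => l; have := congr1 (fun x : 'rV[R]_4 => x 0 l) E; rewrite /qs !segE.
  have := cmp k r l; have := cmp r k l.
  case: (ltgtP (q k 0 l) (q r 0 l)) => // lt_q;
    case: (ltgtP (q' k 0 l) (q' r 0 l)) => // lt_q' _ _.
    by move=> E0; have := interp_lt s01 lt_q lt_q'; rewrite E0 ltxx.
  by move=> E0; have := interp_lt s01 lt_q lt_q'; rewrite E0 ltxx.
have E' : q' k = q' r.
  by apply/rowP => l; apply/eqP; rewrite eq_le -!cmp E lexx.
by rewrite /qs E E'.
Qed.

Lemma interp_zero (s : R) k l : 0 <= s <= 1 -> simplex (q k) -> simplex (q' k) ->
  (qs s k 0 l == 0) = (q k 0 l == 0).
Proof.
move=> s01 sk sk'; have [_ z] := qq'; rewrite seg_coord_eq0 // -z.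
have [->|_] := eqVneq s 1; first by rewrite oner_eq0.
by case: eqP => //= _; rewrite ?andbT // orbT.
Qed.

Lemma interp_ends (s : R) g : 0 <= s <= 1 -> g \in G ->
  [/\ chord (F g) 1 (P (qs s) g) (Q (qs s) g),
      forall l, (P (qs s) g 0 l == 0) = (P q g 0 l == 0) &
      forall l, (Q (qs s) g 0 l == 0) = (Q q g 0 l == 0)].
Proof.
move=> s01 gG; have [fP [lP lPF P0]] := str_P qS gG; have [fQ [lQ lQF Q0]] := str_Q qS gG.
have [fP' _] := str_P q'S gG; have [fQ' _] := str_Q q'S gG.
have zP l : (P (qs s) g 0 l == 0) = (P q g 0 l == 0).
  by apply: interp_zero => //; [case: fP | case: fP'].
have zQ l : (Q (qs s) g 0 l == 0) = (Q q g 0 l == 0).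
  by apply: interp_zero => //; [case: fQ | case: fQ'].
have fPs : face (F g) (P (qs s) g) by apply: seg_face.
have fQs : face (F g) (Q (qs s) g) by apply: seg_face.
have edge l : l != F g -> P (qs s) g 0 l = 0 -> Q (qs s) g 0 l <> 0.
  move=> lF /eqP; rewrite zP => /eqP e /eqP; rewrite zQ => /eqP.
  exact: (str_edge qS gG lF e).
split=> //; split=> //.
- by split=> //; [apply: sqnorm_simplex; case: fPs | right; exists lP => //; apply/eqP;
    rewrite zP P0].
- by split=> //; [apply: sqnorm_simplex; case: fQs | right; exists lQ => //; apply/eqP;
    rewrite zQ Q0].
- apply/eqP => E; apply: (edge lP lPF); first by apply/eqP; rewrite zP P0.
  by rewrite -E; apply/eqP; rewrite zP P0.
Qed.

Lemma interp_cr_cts g x : continuous (fun s : R => cr (F g) (P (qs s) g) (Q (qs s) g) (qs s x)).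
Proof.
by apply: cts_cr; apply: cts_seg; do 1?[exact: cts_cst | exact: cts_id].
Qed.

(** At the level 1 the disc is the whole face. The moving ends remain distinct points of its edges,
    so the determinants never vanish; their product is positive at time 0 because the segments are
    disjoint. *)
Lemma interp_disjoint (s : R) g h (t u : R) : 0 <= s <= 1 -> g \in G -> h \in G -> F g = F h ->
  g != h -> 0 <= u <= 1 -> seg (P (qs s) g) (Q (qs s) g) t <> seg (P (qs s) h) (Q (qs s) h) u.
Proof.
move=> s01 gG hG Fgh gh u01.
have z0 := r01 R; have z1 := r11 R.
have inj (v w : R) : 0 <= v <= 1 -> 0 <= w <= 1 ->
    seg (P q g) (Q q g) v <> seg (P q h) (Q q h) w.
  by move=> v01 w01 /(str_inj qS gG hG Fgh v01 w01)[E]; rewrite E eqxx in gh.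
have nPP : P q h != P q g by apply/eqP => E; apply: (inj 0 0) => //; rewrite !seg0.
have nPQ : P q h != Q q g by apply/eqP => E; apply: (inj 1 0) => //; rewrite seg1 seg0.
have nQP : Q q h != P q g by apply/eqP => E; apply: (inj 0 1) => //; rewrite seg1 seg0.
have nQQ : Q q h != Q q g by apply/eqP => E; apply: (inj 1 1) => //; rewrite !seg1.
have ne (v : R) k r : 0 <= v <= 1 -> q k != q r -> qs v k != qs v r.
  by move=> v01; apply: contra_neq => /(interp_eq k r v01).
have chords (v : R) : 0 <= v <= 1 ->
    chord (F g) 1 (P (qs v) g) (Q (qs v) g) /\ chord (F g) 1 (P (qs v) h) (Q (qs v) h).
  by move=> v01; have [? _ _] := interp_ends v01 gG; have [? _ _] := interp_ends v01 hG;
    rewrite {2}Fgh.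
apply: same_side_disjoint => //.
pose f v := cr (F g) (P (qs v) g) (Q (qs v) g) (qs v h.1.1) *
  cr (F g) (P (qs v) g) (Q (qs v) g) (qs v h.1.2).
have cf : continuous f by apply: cts_mul; exact: interp_cr_cts.
apply: (nonvanishing_pos cf) => [v v0s||]; last 2 first.
- by case/andP: s01.
- have [c1 [b1 b2 _ _]] := chords 0 z0.
  have q0 k : qs 0 k = q k by rewrite /qs seg0.
  apply: (disjoint_chords_sign c1 b1 b2); rewrite /P /Q ?q0 //.
  move=> v w v01 /andP[w0 w1]; apply: inj => //; by rewrite !ltW.
have v01 : 0 <= v <= 1 by move: v0s s01; lra.
have [c1 [b1 b2 _ _]] := chords v v01.
by rewrite mulf_neq0 // (cr_neq0 c1) //; apply: ne.
Qed.

Lemma interp_straight (s : R) : 0 <= s <= 1 -> straight G F (P (qs s)) (Q (qs s)).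
Proof.
move=> s01; split.
- by move=> g gG; have [[[f _ [/eqP|]] _ _ _] _ _] := interp_ends s01 gG; split=> //;
    have [_ [l lF l0]] := str_P qS gG; exists l => //; have [_ /(_ l) E _] := interp_ends s01 gG;
      apply/eqP; rewrite E l0.
- by move=> g gG; have [[_ [f _ _] _ _] _ _] := interp_ends s01 gG; split=> //;
    have [_ [l lF l0]] := str_Q qS gG; exists l => //; have [_ _ /(_ l) E] := interp_ends s01 gG;
      apply/eqP; rewrite E l0.
- by move=> g l gG; have [[_ _ _ e] _ _] := interp_ends s01 gG; exact: e.
- move=> g h t u gG hG Fgh t01 u01 E; have [gh|gh] := eqVneq g h; last first.
    by case: (interp_disjoint s01 gG hG Fgh gh u01 E).
  split=> //; rewrite -gh in E; have [[_ _ ne _] _ _] := interp_ends s01 gG.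
  exact: seg_inj ne E.
Qed.

Lemma straight_face_ends (p : 'I_n -> 'rV[R]_4) g h (t : R) : straight G F (P p) (Q p) ->
  g \in G -> h \in G -> F g != F h -> 0 <= t <= 1 -> seg (P p g) (Q p g) t 0 (F h) = 0 ->
  t = 0 \/ t = 1.
Proof.
move=> S gG hG Fgh t01 E; have [fP _] := str_P S gG; have [fQ _] := str_Q S gG.
have [|t0] := eqVneq t 0; first by left.
have [|t1] := eqVneq t 1; first by right.
have t01' : 0 < t < 1 by case/andP: t01 => t0' t1'; rewrite !lt_neqAle t1 eq_sym t0 t0'.
have [P0 Q0] := seg_eq0 (proj1 fP) (proj1 fQ) t01' E.
have hF : F h != F g by rewrite eq_sym.
by case: (str_edge S gG hF P0 Q0).
Qed.

(** Segments in different faces meet only at their ends, and equality of nodes does not change with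
    time. *)
Lemma interp_pattern (s : R) g h (t u : R) : 0 <= s <= 1 -> g \in G -> h \in G ->
  0 <= t <= 1 -> 0 <= u <= 1 ->
  seg (P (qs s) g) (Q (qs s) g) t = seg (P (qs s) h) (Q (qs s) h) u <->
  seg (P q g) (Q q g) t = seg (P q h) (Q q h) u.
Proof.
move=> s01 gG hG t01 u01; have Ss := interp_straight s01.
have [Fgh|Fgh] := eqVneq (F g) (F h).
  split=> [/(str_inj Ss gG hG Fgh t01 u01)[-> ->]|/(str_inj qS gG hG Fgh t01 u01)[-> ->]] //.
have other p : straight G F (P p) (Q p) ->
    seg (P p g) (Q p g) t = seg (P p h) (Q p h) u -> (t = 0 \/ t = 1) /\ (u = 0 \/ u = 1).
  move=> S E.
  have [fgP _] := str_P S gG; have [fgQ _] := str_Q S gG.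
  have [fhP _] := str_P S hG; have [fhQ _] := str_Q S hG.
  split; [apply: (straight_face_ends S gG hG Fgh t01)|apply: (straight_face_ends S hG gG _ u01)].
  - by rewrite E; have [] := seg_face fhP fhQ u01.
  - by rewrite eq_sym.
  - by rewrite -E; have [] := seg_face fgP fgQ t01.
by split=> [/[dup]/(other _ Ss)|/[dup]/(other _ qS)] [[->|->] [->|->]]; rewrite ?seg0 ?seg1;
  move/(interp_eq _ _ s01).
Qed.

Lemma interp_iso :
  isoS (img G (fun g => seg (P q g) (Q q g))) (img G (fun g => seg (P q' g) (Q q' g))).
Proof.
pose H s g t := seg (P (qs s) g) (Q (qs s) g) t.
have H0 g t : H 0 g t = seg (P q g) (Q q g) t by rewrite /H /qs /P /Q !seg0.
have H1 g t : H 1 g t = seg (P q' g) (Q q' g) t by rewrite /H /qs /P /Q !seg1.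
have -> : img G (fun g => seg (P q g) (Q q g)) = img G (H 0)
  by apply: img_ext => g t _ _; rewrite H0.
have -> : img G (fun g => seg (P q' g) (Q q' g)) = img G (H 1)
  by apply: img_ext => g t _ _; rewrite H1.
apply: isoS_family.
- move=> g gG; apply: cts_seg; last exact: cts_snd.
    by apply: cts_seg; [exact: cts_cst | exact: cts_cst | exact: cts_fst].
  by apply: cts_seg; [exact: cts_cst | exact: cts_cst | exact: cts_fst].
- move=> s g h t u s01 gG hG t01 u01; rewrite !H0; exact: interp_pattern.
- move=> s g t s01 gG t01.
  have [[[[fP _] _ _] [[fQ _] _ _] _ _] zP zQ] := interp_ends s01 gG.
  have [[gP _] _] := str_P qS gG; have [[gQ _] _] := str_Q qS gG.
  split; first exact: seg_simplex.
  by move=> l; rewrite H0 /H (seg_coord_eq0 l fP fQ t01) (seg_coord_eq0 l gP gQ t01) zP zQ.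
Qed.

End Interpolation.

(* The segments with their faces, the comparisons between the coordinates of the nodes, and
   the vanishing coordinates. *)
Definition pattern (n : nat) : finType :=
  ({set 'I_n * 'I_n * 'I_4} * {ffun 'I_n * 'I_n * 'I_4 -> bool} *
   {ffun 'I_n * 'I_4 -> bool})%type.

(** [q] need not be injective: a point may bear several numbers, and the comparisons remember it. *)
Definition has_pattern (R : realType) (n : nat) (L : set 'rV[R]_4) (d : pattern n) : Prop :=
  exists q : 'I_n -> 'rV[R]_4,
    [/\ straight d.1.1 (fun g => g.2) (fun g => q g.1.1) (fun g => q g.1.2),
        isoS L (img d.1.1 (fun g => seg (q g.1.1) (q g.1.2))),
        forall z, d.1.2 z = (q z.1.1 0 z.2 <= q z.1.2 0 z.2) &
        forall z, d.2 z = (q z.1 0 z.2 == 0)].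

Lemma seg_cts (R : realType) (p q : 'rV[R]_4) : continuous (seg p q).
Proof. by apply: cts_seg; [exact: cts_cst | exact: cts_cst | exact: cts_id]. Qed.

Lemma same_pattern_iso (R : realType) (n : nat) (L L' : set 'rV[R]_4) (d : pattern n) :
  closed L -> closed L' -> has_pattern L d -> has_pattern L' d -> iso L L'.
Proof.
move=> cL cL' [q [qS [qL _] qc qz]] [q' [q'S [_ q'L] q'c q'z]].
apply: iso_trans cL qL _; apply: iso_trans q'L.
  by apply: img_closed => g _; exact: seg_cts.
have qq' : same_order q q'.
  by split=> [k r l|k l]; [have := qc (k, r, l); rewrite q'c | have := qz (k, l); rewrite q'z].
by have [] := interp_iso qS q'S qq'.
Qed.

Definition on_edge (R : realType) (x : 'rV[R]_4) : Prop :=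
  exists i l, [/\ i != l, x 0 i = 0 & x 0 l = 0].

(** A normal isotopy preserves open faces, so the ends of the segments are the final positions of
    the points of [L] on edges, all listed by [q0]. This bounds the number of nodes whatever the
    number of pieces was. *)
Lemma straight_pattern (R : realType) (I : finType) (J : {set I}) (F : I -> 'I_4)
    (P Q : I -> 'rV[R]_4) (n : nat) (q0 : 'I_n -> 'rV[R]_4) (L : set 'rV[R]_4) :
  straight J F P Q -> isoS L (img J (fun i => seg (P i) (Q i))) ->
  (forall x, L x -> on_edge x -> exists k, x = q0 k) ->
  exists d : pattern n, has_pattern L d.
Proof.
move=> S isoL edges; have [[h [_ _ _ hface] hE] _] := isoL.
have r01 := r01 R; have r11 := r11 R.
have ends x i : i \in J -> img J (fun i => seg (P i) (Q i)) x -> face (F i) x ->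
    (exists2 l, l != F i & x 0 l = 0) -> exists k, x = h 1 (q0 k).
  move=> iJ; rewrite -hE => -[y Ly yx] [_ xF] [l lF xl].
  have [_ e] := hface 1 y r11 Ly; rewrite yx in e.
  have [|k yk] := edges y Ly; last by exists k; rewrite -yk.
  by exists l, (F i); split=> //; apply/eqP; rewrite e ?xl ?xF.
have idx (X : I -> 'rV[R]_4) : (forall i, i \in J -> exists k, X i = h 1 (q0 k)) ->
    exists k : I -> option 'I_n, forall i, i \in J -> exists2 m, k i = Some m & X i = h 1 (q0 m).
  move=> XJ; have ex i : exists k : option 'I_n, i \in J ->
    exists2 m, k = Some m & X i = h 1 (q0 m).
    have [iJ|iJ] := boolP (i \in J); last by exists None.
    by have [k Xk] := XJ i iJ; exists (Some k) => _; exists k.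
  by have [k kE] := boolp.choice ex; exists k.
have [i iJ|kP kPE] := idx P.
  have [fP eP] := str_P S iJ; apply: (ends _ i) => //.
  by exists i, 0; rewrite seg0.
have [i iJ|kQ kQE] := idx Q.
  have [fQ eQ] := str_Q S iJ; apply: (ends _ i) => //.
  by exists i, 1; rewrite seg1.
pose q k := h 1 (q0 k).
pose G := [set g : 'I_n * 'I_n * 'I_4 |
  [exists i in J, [&& kP i == Some g.1.1, kQ i == Some g.1.2 & F i == g.2]]]%SET.
have GP g : g \in G -> exists i, [/\ i \in J, P i = q g.1.1, Q i = q g.1.2, F i = g.2 &
    kP i = Some g.1.1 /\ kQ i = Some g.1.2].
  rewrite inE => /existsP[i /and4P[iJ /eqP iP /eqP iQ /eqP iF]]; exists i; split=> //.
    by have [m + ->] := kPE i iJ; rewrite iP => -[->].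
  by have [m + ->] := kQE i iJ; rewrite iQ => -[->].
have GI i : i \in J -> exists g, [/\ g \in G, P i = q g.1.1, Q i = q g.1.2 & F i = g.2].
  move=> iJ; have [m mP mPE] := kPE i iJ; have [m' mQ mQE] := kQE i iJ.
  exists (m, m', F i); split=> //; rewrite inE; apply/existsP; exists i.
  by rewrite iJ mP mQ !eqxx.
exists (G, [ffun z : 'I_n * 'I_n * 'I_4 => q z.1.1 0 z.2 <= q z.1.2 0 z.2],
  [ffun z : 'I_n * 'I_4 => q z.1 0 z.2 == 0]).
exists q; split=> [||z|z]; rewrite /= ?ffunE //.
  split.
  - by move=> g /GP[i [iJ <- _ <- _]]; exact: str_P S _ iJ.
  - by move=> g /GP[i [iJ _ <- <- _]]; exact: str_Q S _ iJ.
  - by move=> g l /GP[i [iJ <- <- <- _]]; exact: str_edge S _ _ iJ.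
  - move=> [[m m'] f] [[l l'] f'] t u /GP[i [iJ /= <- <- Ff [gP gQ]]].
    move=> /GP[j [jJ /= <- <- Ff' [gP' gQ']]] ff' t01 u01 E.
    have Fij : F i = F j by rewrite Ff Ff'.
    have [ij tu] := str_inj S iJ jJ Fij t01 u01 E; split=> //.
    rewrite -ij in gP' gQ'; move: gP' gQ'; rewrite gP gQ => -[<-] [<-].
    by rewrite ff'.
suff -> : img G (fun g => seg (q g.1.1) (q g.1.2)) = img J (fun i => seg (P i) (Q i)) by [].
apply/seteqP; split=> x.
  by move=> [g [t [/GP[i [iJ <- <- _ _]] t01 <-]]]; exists i, t.
by move=> [i [t [/GI[g [gG -> -> _]] t01 <-]]]; exists g, t.
Qed.

(** * Arcs contained in polyhedra *)

(** Connectedness of [[0, 1]]: without a common point, [A] would be open and closed in it. *)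
Lemma closed_cover_meet (R : realType) (A B : set R) :
  closed A -> closed B -> (forall t : R, 0 <= t <= 1 -> A t \/ B t) -> A 0 -> B 1 ->
  exists t : R, [/\ 0 <= t <= 1, A t & B t].
Proof.
move=> cA cB AB A0 B1; apply: contrapT => no.
have E (t : R) : 0 <= t <= 1 -> A t <-> ~ B t.
  move=> t01; split=> [At Bt|nB]; first by apply: no; exists t.
  by case: (AB t t01).
have := @segment_connected R 0 1; move=> /(_ (`[0, 1]%classic `&` A)) conn.
have E1 : `[0, 1]%classic `&` A = `[0, 1]%classic.
  apply: conn.
  - by exists 0; split=> //=; rewrite in_itv /= lexx ler01.
  - exists (~` B); first exact: closed_openC.
    by apply/seteqP; split=> t /= [t01 h]; split=> //; apply/E => //; rewrite in_itv in t01.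
  - by exists A.
have : `[0, 1]%classic (1 : R) by rewrite /= in_itv /= ler01 lexx.
by rewrite -E1 => -[_ A1]; apply: no; exists 1; rewrite ler01 lexx.
Qed.

Definition injective_path (R : realType) (a : R -> 'rV[R]_4) : Prop :=
  continuous a /\ forall s t : R, 0 <= s <= 1 -> 0 <= t <= 1 -> a s = a t -> s = t.

Lemma path_closed (R : realType) (a : R -> 'rV[R]_4) (x y : R) :
  continuous a -> closed (a @` `[x, y]%classic).
Proof.
move=> ca; apply: compact_closed; first exact: norm_hausdorff.
by apply: continuous_compact; [exact: continuous_subspaceT | exact: segment_compact].
Qed.

(** The segment from [a u] to [a w] is covered by the closed images of [[0, v]] and [[v, 1]], and by
    injectivity a point in both is [a v]. *)
Lemma path_segment (R : realType) (a : R -> 'rV[R]_4) (u v w : R) :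
  injective_path a -> 0 <= u <= v -> v <= w <= 1 ->
  (forall t : R, 0 <= t <= 1 -> trace_of a (seg (a u) (a w) t)) ->
  exists t : R, 0 <= t <= 1 /\ a v = seg (a u) (a w) t.
Proof.
move=> [ca ia] /andP[u0 uv] /andP[vw w1] tr.
have cseg : continuous (seg (a u) (a w)) by exact: seg_cts.
have cl (x y : R) : closed (seg (a u) (a w) @^-1` (a @` `[x, y]%classic)).
  by have /continuous_closedP := cseg; apply; apply: path_closed.
have [t|||t [t01 [x xI xE] [y yI yE]]] := closed_cover_meet (cl 0 v) (cl v 1).
- move=> /tr[x /andP[x0 x1] xE]; have [xv|xv] := leP x v; [left|right]; exists x => //=;
    by rewrite in_itv /= ?x0 ?x1 ?(ltW xv) ?xv.
- by exists u; rewrite ?seg0 //= in_itv /= u0 uv.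
- by exists w; rewrite ?seg1 //= in_itv /= w1 vw.
move: xI yI; rewrite /= !in_itv /= => /andP[x0 xv] /andP[vy y1].
have xy : x = y by apply: ia; [lra | lra | rewrite xE yE].
by exists t; split=> //; have -> : v = x by lra.
Qed.

Definition convex_set (R : realType) (D : set 'rV[R]_4) : Prop :=
  forall x y (t : R), D x -> D y -> 0 <= t <= 1 -> D (seg x y t).

Lemma convex_in_path (R : realType) (i : 'I_4) (a : R -> 'rV[R]_4) (D : set 'rV[R]_4)
    (p q z : 'rV[R]_4) :
  injective_path a -> convex_set D -> D `<=` trace_of a -> D p -> D q -> D z ->
  cr i p q z = 0.
Proof.
move=> ia cD Da.
have mid (u v w : R) : 0 <= u <= v -> v <= w <= 1 -> D (a u) -> D (a w) ->
    cr i (a u) (a w) (a v) = 0.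
  move=> uv vw Du Dw.
  have [t t01|t [_ ->]] := path_segment ia uv vw; last exact: cr_chord.
  by apply: Da; apply: cD.
move=> Dp Dq Dz; have [s /andP[s0 s1] sp] := Da _ Dp.
have [t /andP[t0 t1] tq] := Da _ Dq; have [w /andP[w0 w1] wz] := Da _ Dz.
rewrite -sp -tq -wz in Dp Dq Dz *; clear p q z sp tq wz.
wlog sw : s w s0 s1 w0 w1 Dp Dz / s <= w.
  move=> W; case: (leP s w) => [|/ltW] sw; first exact: W.
  by rewrite cr_rot cr_swap W ?oppr0.
have [st|/ltW ts] := leP s t; last first.
  have b1 : 0 <= t <= s by rewrite t0 ts.
  have b2 : s <= w <= 1 by rewrite sw w1.
  by rewrite cr_rot mid.
have [tw|/ltW wt] := leP t w.
  have b1 : 0 <= s <= t by rewrite s0 st.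
  have b2 : t <= w <= 1 by rewrite tw w1.
  by rewrite cr_swap cr_rot mid ?oppr0.
have b1 : 0 <= s <= w by rewrite s0 sw.
have b2 : w <= t <= 1 by rewrite wt t1.
by rewrite mid.
Qed.

(** Induction on the number of arcs: if a point [x] of [D] is off the first arc, a homothety of
    centre [x] brings the three points into a ball avoiding that arc and multiplies the determinant
    by [t ^+ 2]. *)
Lemma convex_in_paths (R : realType) (i : 'I_4) (T : eqType) (s : seq T)
    (a : T -> R -> 'rV[R]_4) (D : set 'rV[R]_4) (p q z : 'rV[R]_4) :
  (forall k, k \in s -> injective_path (a k)) -> convex_set D ->
  (forall x, D x -> exists2 k, k \in s & trace_of (a k) x) ->
  D p -> D q -> D z -> cr i p q z = 0.
Proof.
elim: s D p q z => [|n s IHs] D p q z ia cD Da Dp Dq Dz; first by have [] := Da p Dp.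
have in_n : injective_path (a n) by apply: ia; rewrite mem_head.
have [sub|/existsNP[x /not_implyP[Dx nx]]] := pselect (D `<=` trace_of (a n)).
  exact: (convex_in_path i in_n cD sub).
have [e e0 eP] : exists2 e : R, 0 < e & forall y, ball x e y -> ~ trace_of (a n) y.
  have /nbhs_ballP[e e0 eP] : nbhs x (~` trace_of (a n)).
    apply: open_nbhs_nbhs; split=> //; apply: closed_openC.
    have -> : trace_of (a n) = a n @` `[0, 1]%classic.
      by apply/seteqP; split=> y [t t01 <-]; exists t; rewrite //= in_itv in t01 *.
    by apply: path_closed; case: in_n.
  by exists e.
have near_x y : nbhs (0 : R) (fun t => ball x e (seg x y t)).
  have c0 : nbhs (seg x y 0) (ball x e) by rewrite seg0; exact: nbhsx_ballx.
  exact: (@seg_cts R x y 0 _ c0).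
have /nbhs_ballP[d d0 dP] : nbhs (0 : R) (fun t => [/\ ball x e (seg x p t),
    ball x e (seg x q t) & ball x e (seg x z t)]).
  near=> t; split; near: t; exact: near_x.
have d0' : 0 < d by [].
pose t := Num.min (d / 2) 1.
have t0 : 0 < t by rewrite lt_min ltr01 andbT divr_gt0.
have t01 : 0 <= t <= 1 by rewrite (ltW t0) ge_min lexx orbT.
have [|bp bq bz] := dP t.
  rewrite /ball /= sub0r normrN gtr0_norm // gt_min ltr_pdivrMr //.
  by rewrite ltr_pMr // ltr1n.
have : cr i (seg x p t) (seg x q t) (seg x z t) = 0.
  apply: (IHs (D `&` ball x e)); try by split=> //; apply: cD.
  - by move=> k ks; apply: ia; rewrite in_cons ks orbT.
  - move=> y w u [Dy bally] [Dw ballw] u01; split; first exact: cD.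
    move: bally ballw; rewrite -ball_normE /= => bally ballw.
    have -> : x - seg y w u = (1 - u) *: (x - y) + u *: (x - w).
      by apply/rowP => l; rewrite !mxE; ring.
    apply: le_lt_trans (ler_normD _ _) _; rewrite !normrZ.
    case/andP: (u01) => u0 u1; rewrite ger0_norm ?subr_ge0 // ger0_norm //.
    by have := interp_lt u01 bally ballw; lra.
  - move=> y [Dy /eP ny]; have [k kn ky] := Da y Dy; exists k => //.
    by move: kn; rewrite in_cons => /predU1P[kn|//]; case: ny; rewrite -kn.
have -> : cr i (seg x p t) (seg x q t) (seg x z t) = t ^+ 2 * cr i p q z.
  by rewrite /cr !segE; ring.
by move/eqP; rewrite mulf_eq0 expf_eq0 /= gt_eqF //= => /eqP.
Unshelve. all: by end_near.
Qed.

Lemma hull_convex (R : realType) (s : seq 'rV[R]_4) : convex_set (hull s).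
Proof.
move=> x y t [w [w0 w1 ->]] [v [v0 v1 ->]] /andP[t0 t1].
exists (fun k => (1 - t) * w k + t * v k); split.
- by move=> k; rewrite addr_ge0 // mulr_ge0 // subr_ge0.
- by rewrite big_split /= -!mulr_sumr w1 v1; ring.
have -> (u u' : 'rV[R]_4) : seg u u' t = (1 - t) *: u + t *: u'.
  by apply/rowP => l; rewrite segE !mxE.
under [RHS]eq_bigr do rewrite scalerDl -!scalerA.
by rewrite big_split /= -!scaler_sumr.
Qed.

Lemma on_same_line (R : realType) (i : 'I_4) (p q x y z : 'rV[R]_4) :
  face i p -> face i q -> p != q -> face i x -> face i y -> x != y -> face i z ->
  cr i p q x = 0 -> cr i p q y = 0 -> cr i p q z = 0 <-> cr i x y z = 0.
Proof.
move=> fp fq pq fx fy xy fz px py; split=> pz.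
  have [t ->] := collinear fp fq fz pq pz; have [u ->] := collinear fp fq fx pq px.
  have [v ->] := collinear fp fq fy pq py; rewrite /cr !segE; ring.
by have [t ->] := collinear fx fy fz xy pz; rewrite cr_seg px py !mulr0 addr0.
Qed.

(** When [D] is empty or a single point, vertices of the face supply what is missing to define a
    line. *)
Lemma collinear_set (R : realType) (i : 'I_4) (D : set 'rV[R]_4) :
  D `<=` face i -> (forall p q z, D p -> D q -> D z -> cr i p q z = 0) ->
  exists p q, [/\ face i p, face i q, p != q & forall z, D z -> cr i p q z = 0].
Proof.
move=> Df Dc.
have [[p [q [Dp Dq pq]]]|one] := pselect (exists p q, [/\ D p, D q & p != q]).
  by exists p, q; split=> //; [exact: Df | exact: Df | move=> z; exact: Dc].
have vertex (m : 'I_3) : face i (delta_mx 0 (lift i m) : 'rV[R]_4).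
  split; last by rewrite mxE eqxx /= (negPf (neq_lift i m)).
  split=> [l|]; first by rewrite mxE eqxx /=; case: (l == _).
  rewrite (bigD1 (lift i m)) //= mxE !eqxx big1 ?addr0 // => l /negPf lm.
  by rewrite mxE lm andbF.
have vv : delta_mx 0 (lift i ord0) != delta_mx 0 (lift i (lift ord0 ord0)) :> 'rV[R]_4.
  apply/eqP => /rowP/(_ (lift i ord0)); rewrite !mxE !eqxx /=.
  by rewrite (inj_eq (@lift_inj _ i)) /= => /eqP; rewrite oner_eq0.
have [[p Dp]|no] := pselect (exists p, D p); last first.
  exists (delta_mx 0 (lift i ord0)), (delta_mx 0 (lift i (lift ord0 ord0))).
  by split=> // z Dz; case: no; exists z.
have [q fq pq] : exists2 q, face i q & p != q.
  have [pv|pv] := eqVneq p (delta_mx 0 (lift i ord0)); last by exists (delta_mx 0 (lift i ord0)).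
  by exists (delta_mx 0 (lift i (lift ord0 ord0))); rewrite ?pv.
exists p, q; split=> // [|z Dz]; first exact: Df.
suff -> : z = p by exact: cr_left.
by apply: contrapT => /eqP zp; apply: one; exists z, p.
Qed.

(** An injective path on a line is monotone in any coordinate not constant on this line. So [a u] is
    strictly between [a t] and [a v], and strict convexity applies. *)
Lemma line_between (R : realType) (i : 'I_4) (a : R -> 'rV[R]_4) (p q : 'rV[R]_4) (x y : R) :
  injective_path a -> face i p -> face i q -> p != q -> 0 <= x -> y <= 1 ->
  (forall t : R, x <= t <= y -> face i (a t) /\ cr i p q (a t) = 0) ->
  forall t u v : R, x <= t -> t < u -> u < v -> v <= y ->
  sqnorm (a u) < sqnorm (a t) \/ sqnorm (a u) < sqnorm (a v).
Proof.
move=> [ca ia] fp fq pq x0 y1 line t u v xt tu uv vy.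
have ex w : exists k, x <= w <= y -> a w = seg p q k.
  have [wI|wI] := boolP (x <= w <= y); last by exists 0.
  by have [fw lw] := line w wI; have [k wk] := collinear fp fq fw pq lw; exists k.
have [k kE] := boolp.choice ex.
have [l pql] : exists l, q 0 l - p 0 l != 0.
  apply: contrapT => no; move/eqP: pq; apply; apply/rowP => l; apply/eqP;
    rewrite eq_sym -subr_eq0.
  by apply: contrapT => /negP nl; apply: no; exists l.
pose h w := a w 0 l.
have hE (w : R) : x <= w <= y -> h w = p 0 l + k w * (q 0 l - p 0 l).
  by move=> wI; rewrite /h kE // segE; ring.
have ch : {within [set` `[t, v]], continuous h}.
  by apply: continuous_subspaceT; exact: cts_coord.
have hinj : {in `[t, v] &, injective h}.
  move=> w w'; rewrite !in_itv /= => wI wI' E.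
  have J : x <= w <= y by move: wI; lra.
  have J' : x <= w' <= y by move: wI'; lra.
  apply: ia; [by move: J; lra | by move: J'; lra |].
  by rewrite !kE //; congr seg; apply: (mulIf pql); move: E; rewrite !hE // => /addrI.
have It : t \in `[t, v] by rewrite in_itv /=; lra.
have Iu : u \in `[t, v] by rewrite in_itv /=; lra.
have Iv : v \in `[t, v] by rewrite in_itv /=; lra.
have [lam lam01 lamE] : exists2 m, 0 < m < 1 & h u = h t + m * (h v - h t).
  have mono : h t < h u < h v \/ h v < h u < h t.
    by case: (itv_continuous_inj_mono ch hinj) => m; [left|right]; rewrite !m // tu uv.
  have hvt : h v - h t != 0 by apply/eqP; case: mono; lra.
  exists ((h u - h t) / (h v - h t)); last by field.
  have : (h u - h t) / (h v - h t) * (h v - h t) = h u - h t by field.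
  set m := _ / _; case: mono => /andP[]; nra.
have bt : x <= t <= y by lra.
have bu : x <= u <= y by lra.
have bv : x <= v <= y by lra.
have uE : a u = seg (a t) (a v) lam.
  rewrite !kE // seg_seg; congr seg; apply: (mulIf pql).
  by move: lamE; rewrite !hE //; lra.
have atv : a t != a v.
  apply/eqP => /ia E; have : t = v by apply: E; lra.
  by lra.
apply/orP; rewrite -lt_max uE; apply: sqnorm_seg_lt => //; by rewrite le_max lexx ?orbT.
Qed.

Lemma cts_prod (R : realType) (T : topologicalType) (I : Type) (r : seq I) (P : pred I)
    (f : I -> T -> R) :
  (forall i, continuous (f i)) -> continuous (fun x => \prod_(i <- r | P i) f i x).
Proof.
move=> cf; elim: r => [|i r IHr].
  by under eq_fun do rewrite big_nil; exact: cts_cst.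
under eq_fun do rewrite big_cons.
by case: (P i) => //; apply: cts_mul.
Qed.

Section Breaks.
Variables (R : realType) (i : 'I_4) (a : R -> 'rV[R]_4) (T : finType) (p q : T -> 'rV[R]_4).
Hypothesis ia : injective_path a.
Hypothesis fa : forall t : R, 0 <= t <= 1 -> face i (a t).
Hypothesis fp : forall k, face i (p k).
Hypothesis fq : forall k, face i (q k).
Hypothesis pq : forall k, p k != q k.
Hypothesis cover : forall t : R, 0 <= t <= 1 -> exists k, cr i (p k) (q k) (a t) = 0.

Let g k t := cr i (p k) (q k) (a t).
Let same k k' := forall z, face i z -> cr i (p k) (q k) z = 0 <-> cr i (p k') (q k') z = 0.

Lemma cts_line k : continuous (g k).
Proof. by apply: cts_cr; [exact: cts_cst | exact: cts_cst | case: ia]. Qed.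

(** Lines sharing two distinct points coincide, so an injective path is on two different lines at
    one time at most. Pairs without such a time get the default 0. *)
Lemma crossing_times : exists b : T * T -> R, forall (k k' : T) (t : R), 0 <= t <= 1 ->
  g k t = 0 -> g k' t = 0 -> t = b (k, k') \/ same k k'.
Proof.
suff /boolp.choice[b bP] : forall kk : T * T, exists b, forall t : R, 0 <= t <= 1 ->
    g kk.1 t = 0 -> g kk.2 t = 0 -> t = b \/ same kk.1 kk.2.
  by exists b => k k' t; exact: (bP (k, k')).
move=> [k k']; have [[b [b01 bk bk']]|no] :=
  pselect (exists b : R, [/\ 0 <= b <= 1, g k b = 0 & g k' b = 0]).
  exists b => t t01 tk tk'; have [|tb] := eqVneq t b; [by left | right] => /= z fz.
  have ab : a t != a b by apply: contra_neq tb; apply: (proj2 ia).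
  have on k1 : g k1 t = 0 -> g k1 b = 0 -> cr i (p k1) (q k1) z = 0 <-> cr i (a t) (a b) z = 0.
    by apply: on_same_line => //; exact: fa.
  by rewrite on // on.
by exists 0 => t t01 tk tk'; case: no; exists t.
Qed.

Lemma clear_interval (x y : R) : 0 <= x -> x < y -> y <= 1 ->
  (forall (k k' : T) (t : R), x < t < y -> g k t = 0 -> g k' t = 0 -> same k k') ->
  exists k, forall t : R, x <= t <= y -> g k t = 0.
Proof.
move=> x0 xy y1 clear.
pose m : R := (x + y) / 2; have [k km] : exists k, g k m = 0 by apply: cover; rewrite /m; lra.
have mI : x < m < y by rewrite /m; lra.
(* Exactly one of [g k] and [other] vanishes at each time between x and y. *)
pose other t := \prod_(k' | ~~ `[< same k k' >]) g k' t.
have c_other : continuous other by apply: cts_prod; exact: cts_line.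
(* Positive where [g k] is nonzero, negative where it vanishes; a zero of [f] in the open interval
   would make both terms vanish. *)
pose f t := g k t * g k t - other t * other t.
have cf : continuous f by apply: cts_subR; apply: cts_mul => //; exact: cts_line.
have other0 (t : R) : x < t < y -> g k t = 0 -> other t != 0.
  move=> tI kt; apply/prodf_neq0 => k' /asboolPn nkk'; apply/eqP => k't.
  exact: nkk' (clear _ _ _ tI kt k't).
have other1 (t : R) : x < t < y -> g k t != 0 -> other t = 0.
  move=> tI /eqP kt; have [|k' k't] := cover (t := t); first by move: tI; lra.
  have nkk' : ~~ `[< same k k' >].
    by apply/asboolPn => /(_ (a t)) E; apply: kt; apply/E => //; apply: fa; move: tI; lra.
  by apply/eqP; rewrite prodf_seq_eq0; apply/hasP; exists k';
    rewrite ?mem_index_enum //= nkk' /g k't eqxx.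
have gz (t : R) : x < t < y -> g k t = 0.
  move=> tI; apply: contrapT => /eqP kt.
  have ft : 0 < f t by rewrite /f other1 // mulr0 subr0 -expr2 lt0r sqrf_eq0 kt sqr_ge0.
  have fm : f m < 0.
    by rewrite /f km mulr0 sub0r oppr_lt0 -expr2 lt0r sqrf_eq0 other0 ?sqr_ge0.
  have [s sI fs] : exists2 s, x < s < y & f s = 0.
    have [tm|mt] := leP t m.
      have [||s] := @IVT R f t m 0 tm; first exact: continuous_subspaceT.
        by rewrite ge_min (ltW fm) orbT le_max (ltW ft).
      by rewrite in_itv /= => sI fs; exists s => //; move: sI tI mI; lra.
    have [||s] := @IVT R f m t 0 (ltW mt); first exact: continuous_subspaceT.
      by rewrite ge_min (ltW fm) le_max (ltW ft) orbT.
    by rewrite in_itv /= => sI fs; exists s => //; move: sI tI mI; lra.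
  move/eqP: fs; rewrite /f subr_eq0 -!expr2 => /eqP fs.
  have [ks|ks] := eqVneq (g k s) 0.
    by have := other0 s sI ks; rewrite -(sqrf_eq0 (other s)) -fs ks expr0n eqxx.
  by move: fs; rewrite (other1 s sI ks) expr0n /= => /eqP; rewrite sqrf_eq0 (negPf ks).
(* Only the ends of the interval remain: were the square of [g k] nonzero there, half its value
   would be taken at an interior time. *)
exists k => t tI; apply: contrapT => /eqP kt.
have sq : 0 < g k t * g k t by rewrite -expr2 lt0r sqrf_eq0 kt sqr_ge0.
have cg : continuous (fun t => g k t * g k t) by apply: cts_mul; exact: cts_line.
have mm : g k m * g k m = 0 by rewrite km mulr0.
have half : g k t * g k t / 2 < g k t * g k t by lra.
have half0 : 0 <= g k t * g k t / 2 by lra.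
have absurd (s : R) : t <= s <= m \/ m <= s <= t -> g k s * g k s = g k t * g k t / 2 -> False.
  move=> sI sE; have [ks|/eqP ks] := eqVneq (g k s) 0; first by move: sE; rewrite ks mul0r; lra.
  apply: ks; apply: gz; case: (ltgtP s t) => [st|ts|st].
  - by move: sI tI mI; lra.
  - by move: sI tI mI; lra.
  - by move: sE; rewrite st; lra.
have [tm|mt] := leP t m.
  have [|s] := @IVT R _ t m (g k t * g k t / 2) tm (continuous_subspaceT cg).
    by rewrite mm ge_min le_max (ltW half) half0 ?orbT.
  by rewrite in_itv /= => sI; apply: absurd; left.
have [|s] := @IVT R _ m t (g k t * g k t / 2) (ltW mt) (continuous_subspaceT cg).
  by rewrite mm ge_min le_max (ltW half) half0 ?orbT.
by rewrite in_itv /= => sI; apply: absurd; right.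
Qed.

Lemma sqc_breaks : exists B : seq R, forall x y : R, 0 <= x -> x < y -> y <= 1 ->
  (forall b, b \in B -> ~ (x < b < y)) -> sqc (fun t => sqnorm (a (x + t * (y - x)))).
Proof.
have [b bP] := crossing_times; exists [seq b k | k : T * T] => x y x0 xy y1 nob.
have [k kE] : exists k, forall t : R, x <= t <= y -> g k t = 0.
  apply: clear_interval => // k k' t tI tk tk'.
  have t01 : 0 <= t <= 1 by move: tI; lra.
  have [tb|//] := bP k k' t t01 tk tk'.
  by have := nob (b (k, k')) (codom_f _ _); rewrite -tb.
move=> t u v t0 tu uv v1.
have line (w : R) : x <= w <= y -> face i (a w) /\ cr i (p k) (q k) (a w) = 0.
  by move=> wI; split; [apply: fa; move: wI; lra | exact: kE].
by apply: (line_between ia (fp k) (fq k) (pq k) x0 y1 line); nra.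
Qed.

End Breaks.

(** One subdivision will serve all arcs of a loop, so that their pieces are indexed by a product. *)
Lemma subdivision (R : realType) (B : seq R) : exists (K : nat) (T : nat -> R),
  [/\ T 0%N = 0, T K = 1,
      forall r r', (r < r')%N -> (r' <= K)%N -> T r < T r' &
      forall r b, (r < K)%N -> b \in B -> ~ (T r < b < T r.+1)].
Proof.
pose s := sort <=%O (undup (0 :: 1 :: [seq b <- B | 0 < b < 1])).
have s_mem b : (b \in s) = [|| b == 0, b == 1 | (0 < b < 1) && (b \in B)].
  by rewrite mem_sort mem_undup !inE mem_filter.
have s01 b : b \in s -> 0 <= b <= 1.
  by rewrite s_mem => /or3P[/eqP ->|/eqP ->|/andP[]]; lra.
have s_srt : sorted <%O s by rewrite sort_lt_sorted undup_uniq.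
have s_gt0 : (0 < size s)%N.
  have : 0 \in s by rewrite s_mem eqxx.
  by case: s {s_mem s01 s_srt}.
pose K := (size s).-1; pose T r := nth 0 s r.
have KE : size s = K.+1 by rewrite prednK.
have mono : forall r r', (r < size s)%N -> (r' < size s)%N -> (T r < T r') = (r < r')%N.
  by move=> r r' rs r's; exact: (lt_sorted_ltn_nth 0 s_srt).
have idx b : b \in s -> exists2 r, (r < size s)%N & T r = b.
  by move=> bs; exists (index b s); [rewrite index_mem | exact: nth_index].
have T01 r : (r < size s)%N -> 0 <= T r <= 1 by move=> rs; apply: s01; exact: mem_nth.
exists K, T; split.
- have [|r rs r0] := idx 0; first by rewrite s_mem eqxx.
  have : ~~ (0 < r)%N by rewrite -mono // r0 -leNgt; have := T01 0%N s_gt0; lra.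
  by rewrite -eqn0Ngt => /eqP rE; rewrite -r0 rE.
- have [|r rs r1] := idx 1; first by rewrite s_mem eqxx orbT.
  have Ks : (K < size s)%N by rewrite KE.
  have : ~~ (r < K)%N by rewrite -mono // r1 -leNgt; have := T01 K Ks; lra.
  by rewrite -leqNgt => Kr; rewrite -r1; congr T; lia.
- by move=> r r' rr' r'K; rewrite mono //; lia.
move=> r b rK bB /andP[rb br].
have r1 : (r.+1 < size s)%N by lia.
have r0 : (r < size s)%N by lia.
have b01 : 0 < b < 1 by have := T01 r r0; have := T01 r.+1 r1; lra.
have [|k ks kb] := idx b; first by rewrite s_mem b01 bB !orbT.
by move: rb br; rewrite -kb !mono //; lia.
Qed.

(** * Normal loops as systems of paths *)

Lemma clamp_cts (R : realType) (a : R -> 'rV[R]_4) :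
  {within `[0, 1], continuous a} -> continuous (fun t : R => a (Num.max 0 (Num.min 1 t))).
Proof.
move=> ca.
have cc : continuous (fun t : R => Num.max 0 (Num.min 1 t)).
  by apply: cts_max; [exact: cts_cst | apply: cts_min; [exact: cts_cst | exact: cts_id]].
have := @within_comp R R 'rV[R]_4 setT `[0, 1]%classic (fun t => Num.max 0 (Num.min 1 t)) a.
have cc' : {within setT, continuous (fun t : R => Num.max 0 (Num.min 1 t))}.
  by apply: continuous_subspaceT.
move=> /(_ cc')/(_ _ ca) H.
have h (t : R) : setT t -> [set` `[0, 1]] (Num.max 0 (Num.min 1 t)).
  by move=> _; rewrite /= in_itv /= le_max lexx /= ge_max ler01 ge_min lexx.
have := H h; by rewrite -continuous_subspace_setT.
Qed.

Record normal_path (R : realType) (i j k : 'I_4) (a : R -> 'rV[R]_4) : Prop := NormalPath {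
  np_inj : injective_path a;
  np_ij : i != j;
  np_ik : i != k;
  np_jk : j != k;
  np_start : open_face [:: i; j] (a 0);
  np_end : open_face [:: i; k] (a 1);
  np_int : forall t : R, 0 < t < 1 -> open_face [:: i] (a t)
}.

Lemma normal_arc_path (R : realType) (i j k : 'I_4) (A : set 'rV[R]_4) :
  normal_arc i j k A -> exists2 a, normal_path i j k a & trace_of a = A.
Proof.
move=> [ij ik jk [a [[ca trA] ia a0 a1 aI]]].
(* Clamping extends the arc by constants to a path continuous on the whole line, as [injective_path]
   demands. *)
pose c (t : R) := Num.max 0 (Num.min 1 t).
have cE (t : R) : 0 <= t <= 1 -> c t = t.
  by move=> /andP[t0 t1]; rewrite /c min_r // max_r.
have r0 := r01 R; have r1 := r11 R.
exists (fun t => a (c t)).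
  have c0 := cE 0 r0; have c1 := cE 1 r1; split=> //.
  - split; first exact: clamp_cts.
    by move=> s t s01 t01; rewrite (cE s) // (cE t) //; exact: ia.
  - by rewrite c0.
  - by rewrite c1.
  - move=> t t01; have t01' : 0 <= t <= 1 by move: t01; lra.
    by rewrite (cE t) //; exact: aI.
rewrite -trA; apply/seteqP; split=> x [t t01 <-]; exists t => //; by rewrite cE.
Qed.

Lemma np_face (R : realType) (i j k : 'I_4) (a : R -> 'rV[R]_4) (t : R) :
  normal_path i j k a -> 0 <= t <= 1 -> face i (a t).
Proof.
move=> N /andP[]; rewrite le_eqVlt => /predU1P[<- _|t0].
  by have [s0 z] := np_start N; split=> //; apply/eqP; rewrite z !inE eqxx.
rewrite le_eqVlt => /predU1P[->|t1].
  by have [s0 z] := np_end N; split=> //; apply/eqP; rewrite z !inE eqxx.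
have [|s0 z] := np_int N (t := t); first by rewrite t0.
by split=> //; apply/eqP; rewrite z !inE eqxx.
Qed.

Section PathsToSys.
Variables (R : realType) (m : nat) (i j k : 'I_m -> 'I_4) (a : 'I_m -> R -> 'rV[R]_4).
Hypothesis N : forall c, normal_path (i c) (j c) (k c) (a c).
Hypothesis disj : forall (c d : 'I_m) (t u : R), i c = i d -> 0 <= t <= 1 -> 0 <= u <= 1 ->
  a c t = a d u -> c = d.
Variables (K : nat) (T : nat -> R).
Hypothesis T0 : T 0%N = 0.
Hypothesis T1 : T K = 1.
Hypothesis Tlt : forall r r', (r < r')%N -> (r' <= K)%N -> T r < T r'.
Hypothesis Tsqc : forall (c : 'I_m) r, (r < K)%N ->
  sqc (fun t => sqnorm (a c (T r + t * (T r.+1 - T r)))).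

Let time (w : 'I_m * 'I_K) (t : R) := T w.2 + t * (T w.2.+1 - T w.2).
Let piece (w : 'I_m * 'I_K) (t : R) := a w.1 (time w t).

Lemma subdivision_le r r' : (r <= r')%N -> (r' <= K)%N -> T r <= T r'.
Proof. by rewrite leq_eqVlt => /predU1P[->//|lt] r'K; rewrite ltW // Tlt. Qed.

Lemma time_bounds (w : 'I_m * 'I_K) (t : R) : 0 <= t <= 1 -> T w.2 <= time w t <= T w.2.+1.
Proof. by move=> t01; have := Tlt (ltnSn w.2) (ltn_ord w.2); rewrite /time; nra. Qed.

Lemma time01 (w : 'I_m * 'I_K) (t : R) : 0 <= t <= 1 -> 0 <= time w t <= 1.
Proof.
move=> t01; have := time_bounds w t01.
have := subdivision_le (leq0n w.2) (ltnW (ltn_ord w.2));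
  have := subdivision_le (ltn_ord w.2) (leqnn K).
by rewrite T0 T1; lra.
Qed.

Lemma path_label (c : 'I_m) (t : R) (l : 'I_4) : 0 <= t <= 1 -> l != i c -> a c t 0 l = 0 ->
  (t = 0 /\ l = j c) \/ (t = 1 /\ l = k c).
Proof.
move=> /andP[t0 t1] li /eqP; move: t0 t1; rewrite le_eqVlt => /predU1P[<- _|t0].
  by have [_ ->] := np_start (N c); rewrite !inE (negPf li) /= => /eqP; left.
rewrite le_eqVlt => /predU1P[->|t1].
  by have [_ ->] := np_end (N c); rewrite !inE (negPf li) /= => /eqP; right.
by have [|_ ->] := np_int (N c) (t := t); rewrite ?t0 // !inE (negPf li).
Qed.

Lemma time0 (w : 'I_m * 'I_K) : time w 0 = T w.2.
Proof. by rewrite /time mul0r addr0. Qed.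

Lemma time1 (w : 'I_m * 'I_K) : time w 1 = T w.2.+1.
Proof. by rewrite /time mul1r addrC subrK. Qed.

(** The [K] pieces of an arc have [K.+1] nodes. Each arc owns a block of [K.+1] numbers, so the end
    of an arc never has the number of the start of another one. *)
Lemma paths_sys : sys [set: 'I_m * 'I_K] (fun w => i w.1) (fun w => w.1)
  (fun w => w.1 * K.+1 + w.2)%N (fun w => (w.1 * K.+1 + w.2).+1) piece.
Proof.
have r0 := r01 R; have r1 := r11 R.
have st_en (w v : 'I_m * 'I_K) : (w.1 * K.+1 + w.2).+1 = (v.1 * K.+1 + v.2)%N ->
    w.1 = v.1 /\ w.2.+1 = v.2.
  move=> E; have w2 := ltn_ord w.2; have v2 := ltn_ord v.2.
  have e1 : w.1 = v.1 by apply/val_inj; move: E => /=; nia.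
  by split=> //; move: E; rewrite e1; lia.
have lab_start w l : l != i w.1 -> piece w 0 0 l = 0 -> w.2 = 0%N :> nat /\ l = j w.1.
  move=> li /(path_label (time01 w r0) li); rewrite time0 => -[[t0 ->]|[t1 _]].
    split=> //; apply/eqP; rewrite eqn0Ngt; apply/negP => w0.
    by have := Tlt w0 (ltnW (ltn_ord w.2)); rewrite T0 t0 ltxx.
  by have := Tlt (ltn_ord w.2) (leqnn K); rewrite T1 t1 ltxx.
have lab_end w l : l != i w.1 -> piece w 1 0 l = 0 -> w.2.+1 = K :> nat /\ l = k w.1.
  move=> li /(path_label (time01 w r1) li); rewrite time1 => -[[t0 _]|[t1 ->]].
    by have := Tlt (ltn0Sn w.2) (ltn_ord w.2); rewrite T0 t0 ltxx.
  split=> //; apply/eqP; rewrite eqn_leq ltn_ord /= leqNgt; apply/negP => wK.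
  by have := Tlt wK (leqnn K); rewrite T1 t1 ltxx.
split.
- move=> w _; apply: (cts_comp _ (proj1 (np_inj (N w.1)))).
  by apply: cts_addR; [exact: cts_cst | apply: cts_mul; [exact: cts_id | exact: cts_cst]].
- by move=> w t _ t01; apply: (np_face (N w.1)); apply: time01.
- move=> w t l _ t01 li; have t01' : 0 <= t <= 1 by move: t01; lra.
  have tt : T w.2 < time w t < T w.2.+1.
    by have := Tlt (ltnSn w.2) (ltn_ord w.2); rewrite /time; nra.
  have b0 := subdivision_le (leq0n w.2) (ltnW (ltn_ord w.2));
    have b1 := subdivision_le (ltn_ord w.2) (leqnn K).
  rewrite T0 in b0; rewrite T1 in b1.
  by move=> /(path_label (time01 w t01') li)[] [e _]; move: tt b0 b1; rewrite e; lra.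
- move=> w v l _ _ /val_inj wv li /(lab_start _ _ li)[_ lj]; rewrite wv in li lj.
  move=> /(lab_end _ _ li)[_ lk].
  by have := np_jk (N v.1); rewrite -lj -lk eqxx.
- move=> w v t u _ _ ii t01 u01 E.
  have wv : w.1 = v.1 by exact: disj ii (time01 w t01) (time01 v u01) E.
  have tu : time w t = time v u.
    by apply: (proj2 (np_inj (N w.1))); rewrite ?time01 // {2}wv.
  have := time_bounds w t01; have := time_bounds v u01; rewrite tu => bv bw.
  have wK := ltn_ord w.2; have vK := ltn_ord v.2.
  have dw := Tlt (ltnSn w.2) wK; have dv := Tlt (ltnSn v.2) vK.
  case: (ltngtP w.2 v.2) => cmp.
  + have le1 := subdivision_le cmp (ltnW vK).
    have ew : T w.2.+1 = T v.2 by move: bv bw le1; lra.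
    have wv1 : w.2.+1 = v.2 :> nat.
      apply/eqP; rewrite eqn_leq cmp /= leqNgt; apply/negP => lt.
      by have := Tlt lt (ltnW vK); rewrite ew ltxx.
    apply: Or33; split; last by rewrite wv -wv1 addnS.
      by move: tu bv bw; rewrite /time ew; nra.
    by move: tu bv bw; rewrite /time -ew; nra.
  + have le1 := subdivision_le cmp (ltnW wK).
    have ew : T v.2.+1 = T w.2 by move: bv bw le1; lra.
    have wv1 : v.2.+1 = w.2 :> nat.
      apply/eqP; rewrite eqn_leq cmp /= leqNgt; apply/negP => lt.
      by have := Tlt lt (ltnW wK); rewrite ew ltxx.
    apply: Or32; split; last by rewrite wv -wv1 addnS.
      by move: tu bv bw; rewrite /time -ew; nra.
    by move: tu bv bw; rewrite /time ew; nra.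
  + have wv2 : w.2 = v.2 by apply: val_inj.
    apply: Or31; split; first by rewrite [w]surjective_pairing [v]surjective_pairing wv wv2.
    move: tu; rewrite /time wv2 => /addrI /mulIf; apply.
    by rewrite gt_eqF // subr_gt0.
- by move=> w _; rewrite ltnSn.
- move=> w v _ _ /st_en[wv wv2]; split; rewrite ?wv //.
    by rewrite /piece time0 time1 wv wv2.
  by move=> l li /lab_end -[|wK _]; rewrite ?wv //; have := ltn_ord v.2; rewrite -wv2 wK ltnn.
- move=> w _ nz; have w0 : (0 < w.2)%N.
    rewrite lt0n; apply/negP => /eqP w0; apply: (nz (j w.1));
      first by rewrite eq_sym (np_ij (N w.1)).
    rewrite /piece time0 w0 T0; apply/eqP.
    by have [_ ->] := np_start (N w.1); rewrite !inE eqxx orbT.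
  have lt : (w.2.-1 < K)%N by have := ltn_ord w.2; lia.
  by exists (w.1, Ordinal lt); rewrite ?inE /= -?addnS ?prednK.
- move=> w _ nz; have wK : (w.2.+1 < K)%N.
    rewrite ltn_neqAle ltn_ord andbT; apply/negP => /eqP wK; apply: (nz (k w.1)).
      by rewrite eq_sym (np_ik (N w.1)).
    rewrite /piece time1 wK T1; apply/eqP.
    by have [_ ->] := np_end (N w.1); rewrite !inE eqxx orbT.
  by exists (w.1, Ordinal wK); rewrite ?inE /= ?addnS.
- by move=> w _; apply: Tsqc.
Qed.

Lemma paths_img : img [set: 'I_m * 'I_K] piece = \bigcup_c trace_of (a c).
Proof.
apply/seteqP; split=> x.
  by move=> [w [t [_ t01 <-]]]; exists w.1 => //; exists (time w t) => //; exact: time01.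
move=> [c _ [t t01 <-]].
have [r rK rt] : exists2 r, (r < K)%N & T r <= t <= T r.+1.
  have : exists r, (r < K)%N && (t <= T r.+1).
    have K0 : (0 < K)%N by rewrite lt0n; apply/eqP => K0; move: T1; rewrite K0 T0 => /eqP;
      rewrite eq_sym oner_eq0.
    by exists K.-1; rewrite prednK // T1 leqnn; case/andP: t01.
  move=> /ex_minnP[r /andP[rK tr] rmin]; exists r => //; rewrite tr andbT.
  case: r rK tr rmin => [|r] rK tr rmin; first by rewrite T0; case/andP: t01.
  by rewrite leNgt; apply/negP => lt; have := rmin r; rewrite (ltW lt) (ltnW rK) ltnn;
    apply/implyP.
have d := Tlt (ltnSn r) rK.
exists (c, Ordinal rK), ((t - T r) / (T r.+1 - T r)); split=> //.
  by rewrite divr_ge0 ?ler_pdivrMr ?subr_gt0 ?mul1r //=; move: rt; lra.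
by rewrite /piece /time /= divfK ?subr_eq0 ?gt_eqF // addrC subrK.
Qed.

End PathsToSys.

Lemma normal_loop_paths (R : realType) (m : nat) (L : set 'rV[R]_4) :
  normal_loop m L -> exists (i j k : 'I_m -> 'I_4) (a : 'I_m -> R -> 'rV[R]_4),
    [/\ forall c, normal_path (i c) (j c) (k c) (a c),
        forall (c d : 'I_m) (t u : R), i c = i d -> 0 <= t <= 1 -> 0 <= u <= 1 ->
          a c t = a d u -> c = d &
        L = \bigcup_c trace_of (a c)].
Proof.
move=> [_ [A [i [arcs disj LE]]]].
have ex c : exists w : 'I_4 * 'I_4 * (R -> 'rV[R]_4),
    normal_path (i c) w.1.1 w.1.2 w.2 /\ trace_of w.2 = A c.
  by have [j [k /normal_arc_path[a na ta]]] := arcs c; exists (j, k, a).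
have [w wP] := boolp.choice ex.
exists i, (fun c => (w c).1.1), (fun c => (w c).1.2), (fun c => (w c).2); split.
- by move=> c; have [] := wP c.
- move=> c d t u icd t01 u01 E; apply: contrapT => /eqP cd.
  have := disj c d cd icd; apply/eqP/set0P; exists ((w c).2 t); split.
    by have [_ <-] := wP c; exists t.
  by have [_ <-] := wP d; exists u.
- by rewrite LE; apply: eq_bigcupr => c _; have [_ ->] := wP c.
Qed.

Section Surface.
Variables (R : realType) (M : topologicalType) (K : finType) (chi : K -> 'rV[R]_4 -> M).
Variables (S : set M) (t : K).
Hypothesis nS : normal_surface chi S.

Lemma bdry_paths : exists (T : finType) (a : T -> R -> 'rV[R]_4),
  (forall k, injective_path (a k)) /\
  forall x, on_tet_bdry chi t S x -> exists k, trace_of (a k) x.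
Proof.
have [_ _ /(_ t)[n [L [loops _ LE]]]] := nS.
have ex c : exists w : {m : nat & 'I_m -> R -> 'rV[R]_4},
    (forall d, injective_path (tagged w d)) /\ L c = \bigcup_d trace_of (tagged w d).
  have [m /normal_loop_paths[i [j [k [a [na _ Lc]]]]]] := loops c.
  exists (existT _ m a); split=> // d; exact: (np_inj (na d)).
have [w wP] := boolp.choice ex.
exists {c : 'I_n & 'I_(tag (w c))}, (fun k => tagged (w (tag k)) (tagged k)); split.
  by move=> k; have [+ _] := wP (tag k); apply.
move=> x; rewrite LE => -[c _]; have [_ ->] := wP c => -[d _ xd].
by exists (existT _ c d).
Qed.

(* A convex piece of the polyhedron in a face is contained in a finite union of
   arcs, hence has no interior. *)
Lemma face_lines (f : 'I_4) : exists (T : finType) (p q : T -> 'rV[R]_4),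
  [/\ forall k, face f (p k), forall k, face f (q k), forall k, p k != q k &
      forall x, in_tet chi t S x -> face f x -> exists k, cr f (p k) (q k) x = 0].
Proof.
have [_ /(_ t)[ss ssE] _] := nS.
have [T [a [ia aS]]] := bdry_paths.
have ex (k : 'I_(size ss)) : exists w : 'rV[R]_4 * 'rV[R]_4,
    [/\ face f w.1, face f w.2, w.1 != w.2 & forall x, hull (nth [::] ss k) x -> face f x ->
       cr f w.1 w.2 x = 0].
  have [|p q z Dp Dq Dz|p [q [fp fq pq pqD]]] :=
    @collinear_set R f (hull (nth [::] ss k) `&` face f).
  - by move=> x [].
  - apply: (@convex_in_paths R f T (enum T) a (hull (nth [::] ss k) `&` face f)) => //.
      move=> x y u [hx fx] [hy fy] u01; split; last exact: seg_face.
      exact: hull_convex.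
    move=> x [hx fx]; have [|b xb] := aS x; last by exists b; rewrite ?mem_enum.
    split; last by exists f; case: fx.
    by rewrite ssE; exists (nth [::] ss k) => //; apply: mem_nth.
  - by exists (p, q); split=> // x hx fx; apply: pqD.
have [w wP] := boolp.choice ex.
exists 'I_(size ss), (fun k => (w k).1), (fun k => (w k).2); split.
- by move=> k; have [] := wP k.
- by move=> k; have [] := wP k.
- by move=> k; have [] := wP k.
move=> x; rewrite ssE => -[s sss hx] fx.
have lt : (index s ss < size ss)%N by rewrite index_mem.
by exists (Ordinal lt); have [_ _ _] := wP (Ordinal lt); apply=> //=; rewrite nth_index.
Qed.

Lemma loop_pattern (c m : nat) (L : set 'rV[R]_4) :
  loop_of chi t S m L -> (loop_complexity m <= c)%N ->
  closed L /\ exists d : pattern (4 * c + 8).*2, has_pattern L d.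
Proof.
move=> [/normal_loop_paths[i [j [k [a [na disj LE]]]]] LS] mc.
(* The bound gives [m %/ 4 <= c + 1], and the remainder is at most 3. So there are fewer than
   [4 * c + 8] arcs, with two ends each, whence the size of the pattern. *)
have m_le : (m <= 4 * c + 7)%N.
  move: mc; rewrite /loop_complexity; case: eqP => [->|_]; first by lia.
  have := divn_eq m 4; have : (m %% 4 < 4)%N by rewrite ltn_mod.
  lia.
have sub b : trace_of (a b) `<=` in_tet chi t S.
  by move=> x xb; have [|] := LS x; first by rewrite LE; exists b.
have ex (b : 'I_m) : exists B : seq R, forall x y : R, 0 <= x -> x < y -> y <= 1 ->
    (forall b, b \in B -> ~ (x < b < y)) -> sqc (fun u => sqnorm (a b (x + u * (y - x)))).
  have [T [p [q [fp fq pq pqS]]]] := face_lines (i b).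
  have fb (u : R) : 0 <= u <= 1 -> face (i b) (a b u) by exact: np_face (na b).
  apply: (sqc_breaks (np_inj (na b)) fb fp fq pq) => u u01.
  by apply: pqS; [apply: sub; exists u | exact: fb].
have [B BP] := boolp.choice ex.
have [N [T [T0 T1 Tlt TB]]] := subdivision (flatten [seq B b | b : 'I_m]).
have Tsqc (b : 'I_m) r : (r < N)%N -> sqc (fun u => sqnorm (a b (T r + u * (T r.+1 - T r)))).
  move=> rN; apply: BP.
  - by rewrite -T0; apply: (subdivision_le Tlt) => //; apply: ltnW.
  - exact: Tlt.
  - by rewrite -T1; apply: (subdivision_le Tlt).
  - move=> x xB; apply: TB => //; apply/flattenP; exists (B b) => //.
    by apply: codom_f.
have S1 := paths_sys na disj T0 T1 Tlt Tsqc.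
have LI := paths_img a T0 T1 Tlt.
have [J [P [Q [PQ isoL]]]] := sys_straight S1.
rewrite LI -LE in isoL.
split; first by rewrite LE -LI; apply: img_closed => w wJ; exact: (sys_cts S1).
(* Even [r] stands for the start and odd [r] for the end of the arc [r./2]; numbers without an arc
   get the point 0. *)
pose q0 (r : 'I_(4 * c + 8).*2) := if insub r./2 is Some b then a b (odd r)%:R else 0.
apply: (straight_pattern (q0 := q0) PQ isoL) => x.
rewrite LE => -[b _ [u u01 <-]] [l [l' [ll' xl xl']]].
have [l'' l''i xl''] : exists2 l'', l'' != i b & a b u 0 l'' = 0.
  have [e|e] := eqVneq l (i b); last by exists l.
  by exists l'; rewrite // -e eq_sym.
suff end_point (e : bool) : u = e%:R -> exists r, a b u = q0 r.
  by case: (path_label na u01 l''i xl'') => -[uE _];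
    [exact: (end_point false) | exact: (end_point true)].
move=> uE; have lt : (e + b.*2 < (4 * c + 8).*2)%N.
  by have := ltn_ord b; case: e {uE}; rewrite -!mul2n; lia.
exists (Ordinal lt); rewrite /q0 /= half_bit_double oddD odd_double addbF oddb insubT //= => bm.
by rewrite uE; congr (a _ _); apply: val_inj.
Qed.

End Surface.

(** * Finiteness of typed compatibility classes *)

Section Finiteness.
Variables (R : realType) (M : topologicalType) (K : finType) (chi : K -> 'rV[R]_4 -> M).
Variable c : nat.
Let patterns := pattern (4 * c + 8).*2.

(** A loop may have several patterns, as neither its straight model nor the numbering of nodes is
    canonical. All are recorded, and one in common suffices to match two loops. *)
Definition colour (S : set M) : {set K * patterns} :=
  [set w | `[< exists m L, loop_of chi w.1 S m L /\ has_pattern L w.2 >]]%SET.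

Definition simple_surface (S : set M) : Prop :=
  normal_surface chi S /\ complexity_le chi c S.

Lemma same_colour_loop (F G : set M) (t : K) (m : nat) (L : set 'rV[R]_4) :
  simple_surface F -> simple_surface G -> colour F = colour G -> loop_of chi t F m L ->
  closed L /\ exists m' L', loop_of chi t G m' L' /\ iso L L'.
Proof.
move=> [nF cF] [nG cG] FG loopL.
have [cL [d Ld]] := loop_pattern nF loopL (cF _ _ _ loopL).
split=> //; have : (t, d) \in colour F by rewrite inE; apply/asboolP; exists m, L.
rewrite FG inE => /asboolP[m' [L' [loopL' Ld']]].
have [cL' _] := loop_pattern nG loopL' (cG _ _ _ loopL').
by exists m', L'; split=> //; exact: same_pattern_iso cL cL' Ld Ld'.
Qed.

Lemma compatible_sym (F G : set M) : compatible chi F G -> compatible chi G F.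
Proof.
move=> FG t; have [h [k [hP kP dis]]] := FG t; exists k, h; split=> //.
by move=> m n L N loopL loopN; rewrite setIC; exact: dis loopN loopL.
Qed.

(** Each loop of [F'] is carried to a loop of [F] of the same pattern and then moves as that loop
    does; several loops of [F'] may follow the same one. *)
Lemma compatible_colour (F F' G : set M) :
  simple_surface F -> simple_surface F' -> colour F = colour F' ->
  compatible chi F G -> compatible chi F' G.
Proof.
move=> sF sF' FF' FG t; have [h [k [hP kP dis]]] := FG t.
have ex L : exists g, forall m, loop_of chi t F' m L -> normal_isotopy L g /\
    exists m' L', loop_of chi t F m' L' /\ g 1 @` L = h L' 1 @` L'.
  have [[m loopL]|no] := pselect (exists m, loop_of chi t F' m L); last first.
    by exists (fun _ => id) => m loopL; case: no; exists m.
  have [cL [m' [L' [loopL' [e eL eL']]]]] := same_colour_loop sF' sF (esym FF') loopL.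
  have [|g gL gE] := normal_isotopy_trans cL eL (k := h L').
    by rewrite eL'; exact: hP loopL'.
  by exists g => m1 _; split=> //; exists m', L'; rewrite gE eL'.
have [g gP] := boolp.choice ex.
exists g, k; split=> // [m L loopL|m n L N loopL loopN].
  by have [] := gP L m loopL.
have [_ [m' [L' [loopL' ->]]]] := gP L m loopL.
exact: dis loopL' loopN.
Qed.

(** Maximality applies to the class enlarged by [F']. For the compatibility of [F'] with itself, [F]
    is replaced on one side and then on the other. *)
Lemma class_colour (C : set (set M)) (F F' : set M) :
  compatibility_class chi C -> C F -> simple_surface F -> simple_surface F' ->
  colour F = colour F' -> C F'.
Proof.
move=> [[nC pC] maxC] CF sF sF' FF'.
have F'G G : C G -> compatible chi F' G.
  by move=> CG; apply: compatible_colour sF sF' FF' _; exact: pC.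
apply: (maxC (C `|` [set F'])); [|by left|by right].
split=> [G [/nC //|->]|G H [CG|->] [CH|->]]; first by case: sF'.
- exact: pC.
- by apply: compatible_sym; exact: F'G.
- exact: F'G.
- by apply: compatible_colour sF sF' FF' _; apply: compatible_sym; exact: F'G.
Qed.

Variables T1 T2 : bd_torus R M K.

(** The codes range over a finite type; it is not claimed that each of them describes a typed
    class. *)
Definition coded_class (w : 'I_3 * 'I_3 * {set {set K * patterns}}) : set (set M) :=
  [set S | [/\ simple_surface S, colour S \in w.2,
               has_type chi T1 w.1.1 S & has_type chi T2 w.1.2 S]].

Lemma typed_class_coded (i1 i2 : 'I_3) (D : set (set M)) :
  typed_class chi T1 T2 i1 i2 D -> (forall S, D S -> complexity_le chi c S) ->
  exists X, D = coded_class (i1, i2, X).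
Proof.
move=> [C CC DE] Dc.
have simple S : D S -> simple_surface S.
  by move=> DS; split; [move: DS; rewrite DE => -[CS _ _]; exact: CC.1.1 | exact: Dc].
exists [set x | `[< exists S, D S /\ colour S = x >]]%SET; apply/seteqP; split=> S.
  move=> DS; have := DS; rewrite {1}DE => -[CS t1 t2]; split=> //; first exact: simple.
  by rewrite inE; apply/asboolP; exists S.
move=> [sS]; rewrite inE => /asboolP[F [DF FS]] t1 t2.
have := DF; rewrite DE => -[CF _ _]; split=> //.
exact: class_colour CC CF (simple F DF) sS FS.
Qed.

End Finiteness.

Unset Implicit Arguments.

Theorem theorem1p3 (R : realType) (M : topologicalType)
    (Mmanifold : manifold3 R M) (Mcompact : compact [set: M])
    (Mcomponents : at_most_two_components M)
    (Mirreducible : irreducible3 R M)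
    (Mincompressible : incompressible_bdry R M)
    (K : finType) (chi : K -> 'rV[R]_4 -> M) (chiT : triangulation chi)
    (o : K -> bool) (oP : orientation chi o)
    (T1 T2 : bd_torus R M K)
    (T1P : one_vertex_torus chi T1) (T2P : one_vertex_torus chi T2)
    (T12 : bt_set chi T1 <> bt_set chi T2)
    (T1o : basis_orientation chi T1 o false)
    (T2o : basis_orientation chi T2 o true)
    (Phi : 'I_3 -> 'I_3 -> set (set M) -> 'M[rat]_2)
    (PhiP : is_Phi chi T1 T2 Phi)
    (psi sigma : M -> M)
    (psi_homeo : homeo_on (bt_set chi T1) (bt_set chi T2) psi)
    (sigma_homeo : homeo_on (bt_set chi T2) (bt_set chi T2) sigma)
    (psi_SL2 : exists2 B : 'M[int]_2,
       induces (bt_cov T1) (bt_cov T2) psi B & \det B = 1)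
    (sigma_SL2 : exists2 A : 'M[int]_2,
       induces (bt_cov T2) (bt_cov T2) sigma A & \det A = 1)
    (sigma_anosov : anosov (bt_cov T2) sigma) :
  forall c : nat, exists N : nat, (0 < N)%N /\
    forall n : nat, (N <= n)%N ->
      (1%:E <= c_distance chi T1 T2 Phi c (iter n sigma \o psi))%E.
Proof.
move=> c.
have [B psiB detB] := psi_SL2; have [A sigmaA detA] := sigma_SL2.
have [_ cov2 _ _ _] := T2P.
have trA : 2 < `|\tr A|.
  have [A' sigmaA' trA'] := sigma_anosov.
  by rewrite (induces_unique cov2 sigmaA sigmaA').
pose code : Type := ('I_3 * 'I_3 * {set {set K * pattern (4 * c + 8).*2}})%type.
(* [Phi] is constrained on typed classes only, so a code that describes none gets the default 0. *)
have ex (w : code) : exists N : nat,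
  typed_class chi T1 T2 w.1.1 w.1.2 (coded_class chi T1 T2 w) ->
    forall n, (N <= n)%N -> forall q, ~ slope_image (bt_cov T1) (bt_cov T2) (iter n sigma \o psi)
      (mobius (Phi w.1.1 w.1.2 (coded_class chi T1 T2 w)) q) q.
  have [D|no] := pselect (typed_class chi T1 T2 w.1.1 w.1.2 (coded_class chi T1 T2 w));
    last by exists 0%N.
  have [detP _ _] := PhiP _ _ _ D.
  have [N NP] := eventually_no_fixed_slope cov2 psiB sigmaA detA trA detB detP.
  by exists N => _.
have [N NP] := boolp.choice ex.
(* The maximum over all codes works for every class at once; the successor makes it positive. *)
exists (\max_w N w).+1; split=> // n Nn; apply: le_ereal_inf_tmp => _ [i1 [i2 [D [DT Dc ->]]]].
apply: map_distance_ge1 => q.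
have [X DE] := typed_class_coded DT Dc; rewrite DE in DT *.
apply: (NP (i1, i2, X) DT n).
by apply: leq_trans (ltnW Nn); exact: leq_bigmax.
Qed.
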